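(* Let $\xi\in(0,\frac12)$ and let $s$ be a nonnegative real number. Let $T$ be an invertible bounded operator on a Banach space whose spectrum is included in $E_\xi$ and which satisfies $$\|T^{n}\| = O(n^{s}),\quad n\to+\infty,$$ and $$\|T^{-n}\| = O\big(e^{n^{\beta}}\big),\quad n\to+\infty,\quad\text{for some real } \beta<b(\xi).$$ Then, for every $\varepsilon>0$, $$\|T^{-n}\| = O\big(n^{s+\frac12+\varepsilon}\big),\quad n\to+\infty.$$
   Context: For $\xi\in(0,\frac12)$, $E_\xi$ denotes the perfect symmetric set associated to $\xi$, a subset of the unit circle: $$E_{\xi}=\Big\{\exp\Big(2i\pi(1-\xi)\sum_{n=1}^{+\infty}\epsilon_n\xi^{n-1}\Big):\ \epsilon_n=0\text{ or }1\ (n\ge1)\Big\},$$ and $$b(\xi)=\frac{\log\frac1\xi-\log 2}{2\log\frac1\xi-\log 2}.$$ *)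

(* Defs.v *)
From Stdlib Require Import Reals.
From Coquelicot Require Import Coquelicot.

Open Scope R_scope.

(* Stdlib reals with Coquelicot.  A complex Banach space is a
   [CompleteNormedModule C_AbsRing]; a bounded operator is a map satisfying
   Coquelicot's [is_linear], which includes the bound |T x| <= M |x|. *)

(* exp(i t) *)
Definition cis (t : R) : C := (cos t, sin t).

(* The digit sequence is indexed from 0: [eps n] is the (n+1)-st digit. *)
Definition perfect_symmetric_set (xi : R) (z : C) : Prop :=
  exists eps : nat -> R,
    (forall n, eps n = 0 \/ eps n = 1) /\
    z = cis (2 * PI * (1 - xi) * Series (fun n => eps n * xi ^ n)).

Definition b_exponent (xi : R) : R :=
  (ln (1 / xi) - ln 2) / (2 * ln (1 / xi) - ln 2).

Definition is_bounded_inverse {V : CompleteNormedModule C_AbsRing}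
    (T S : V -> V) : Prop :=
  is_linear S /\ (forall x, S (T x) = x) /\ (forall x, T (S x) = x).

Definition spectrum {V : CompleteNormedModule C_AbsRing}
    (T : V -> V) (l : C) : Prop :=
  ~ exists S : V -> V,
      is_bounded_inverse (fun x => minus (T x) (scal l x)) S.

Definition op_pow {V : Type} (T : V -> V) (n : nat) : V -> V :=
  fun x => Nat.iter n T x.

(* The supremum is finite, hence not affected by [real], when T is bounded. *)
Definition op_norm {V : CompleteNormedModule C_AbsRing} (T : V -> V) : R :=
  real (Lub_Rbar (fun r => exists x : V, norm x <= 1 /\ r = norm (T x))).

(* u n = O(v n) as n -> +oo *)
Definition is_bigO (u v : nat -> R) : Prop :=
  exists M : R, eventually (fun n => Rabs (u n) <= M * Rabs (v n)).

(* Main.v *)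
(* Let gamma = beta / (1 - beta), so that beta < b(xi) means gamma < 1 - dim E_xi. The Neumann series
   and a local Levinson argument (a mean value property with a polynomial multiplier, iterated at
   geometrically shrinking radii) bound the resolvent of T at z by exp(A d(z, E_xi)^-gamma) on both
   sides of the circle.

   With gamma < gamma' < 1 - dim E_xi, the sum U(z) of w^k xi^k / (1 + xi^k - z / e), over the 2^k
   left end points e of step k and over all k, with w = xi^-gamma', has positive real part and is
   comparable to d(z, E_xi)^-gamma'. The functions f = exp(-kappa U) decay at E_xi faster than
   the resolvent grows, so (with U truncated at step K, at radius 1 - xi^K, K -> infinity) f(T) = 0.

   Take kappa = N^-gamma' up to a constant and let h = f S_N, where S_N is the Taylor polynomial of
   degree N - 1 of 1 / f. Then h = 1 + sum_(k >= N) h_k z^k, and f(T) = 0 gives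
   T^-N = - sum_(k >= N) h_k T^(k - N). At this scale 1 / f is bounded on |z| = 1 - 1 / N and the i-th
   derivative of f is O(N^i) on the circle; Bessel's inequality bounds the P-th derivative of h by
   O(N^P) in mean square, and Cauchy-Schwarz gives sum_(k >= N) (k - N + 1)^s |h_k| = O(N^(s + 1/2)). *)

Require Import Defs.
From Stdlib Require Import Reals.
From Coquelicot Require Import Coquelicot.
From Stdlib Require Import Lra Lia List Factorial ClassicalEpsilon Classical.
Open Scope R_scope.

(** Distances are measured in powers of xi: at distance about xi^j from E_xi the resolvent is at
    most exp(A v^j) with v = xi^-gamma, and the potential is of size w^j. The proof then rests on
    two inequalities: v < w makes the product of f with the resolvent bounded, and 2 xi w < 1 makes
    the steps finer than the distance summable. Such a w exists exactly when beta < b(xi). The role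
    of h is to trade T^-N for nonnegative powers, whose growth is polynomial: S_N removes from f all
    powers below N except the constant 1. The size of kappa is forced from both sides: for larger
    kappa, 1 / f is unbounded at radius 1 - 1 / N, and for smaller kappa, f is not yet small at
    distance 1 / N, so that its derivatives exceed the scale N. The constants in the bounds on h
    must not depend on N, but the rate at which f decays at E_xi may, since K tends to infinity with
    N fixed. No integral occurs: Bessel's inequality, the mean value property and the functional
    calculus come from averages over m-th roots of unity. f(T) is reached through two-sided Poisson
    sums in T and T^-1, for which lower bounds of T - z on both sides of the circle suffice. *)

(** * Finite sums of real and complex numbers *)

Fixpoint rsum (f : nat -> R) (n : nat) : R :=
  match n with O => 0 | S n => rsum f n + f n end.

Fixpoint csum (f : nat -> C) (n : nat) : C :=
  match n with O => RtoC 0 | S n => (csum f n + f n)%C end.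

Lemma rsum_ext f g n : (forall k, (k < n)%nat -> f k = g k) -> rsum f n = rsum g n.
Proof.
  induction n; simpl; intros H; auto. rewrite IHn, H; auto.
Qed.

Lemma csum_ext f g n : (forall k, (k < n)%nat -> f k = g k) -> csum f n = csum g n.
Proof.
  induction n; simpl; intros H; auto. rewrite IHn, H; auto.
Qed.

Lemma rsum_le f g n : (forall k, (k < n)%nat -> f k <= g k) -> rsum f n <= rsum g n.
Proof.
  induction n; simpl; intros H; [lra|].
  apply Rplus_le_compat; auto.
Qed.

Lemma rsum_plus f g n : rsum (fun k => f k + g k) n = rsum f n + rsum g n.
Proof. induction n; simpl; [lra|]. rewrite IHn; ring. Qed.

Lemma rsum_scal c f n : rsum (fun k => c * f k) n = c * rsum f n.
Proof. induction n; simpl; [lra|]. rewrite IHn; ring. Qed.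

Lemma rsum_const c n : rsum (fun _ => c) n = INR n * c.
Proof. induction n; simpl rsum; [simpl; lra|]. rewrite IHn, S_INR; ring. Qed.

Lemma rsum_nonneg f n : (forall k, (k < n)%nat -> 0 <= f k) -> 0 <= rsum f n.
Proof.
  intros H. replace 0 with (rsum (fun _ => 0) n).
  - now apply rsum_le.
  - rewrite rsum_const; ring.
Qed.

Lemma csum_plus f g n : csum (fun k => (f k + g k)%C) n = (csum f n + csum g n)%C.
Proof. induction n; simpl; [ring|]. rewrite IHn; ring. Qed.

Lemma csum_scal c f n : csum (fun k => (c * f k)%C) n = (c * csum f n)%C.
Proof. induction n; simpl; [ring|]. rewrite IHn; ring. Qed.

Lemma csum_const c n : csum (fun _ => c) n = (RtoC (INR n) * c)%C.
Proof.
  induction n; simpl csum; [simpl; ring|].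
  rewrite IHn, S_INR, RtoC_plus; ring.
Qed.

Lemma csum_zero f n : (forall k, (k < n)%nat -> f k = RtoC 0) -> csum f n = RtoC 0.
Proof.
  intros H. rewrite (csum_ext f (fun _ => RtoC 0)), csum_const by auto. ring.
Qed.

Lemma csum_swap (f : nat -> nat -> C) n m :
  csum (fun i => csum (fun j => f i j) m) n = csum (fun j => csum (fun i => f i j) n) m.
Proof.
  induction n; simpl.
  - rewrite csum_const; ring.
  - rewrite IHn, <- csum_plus. reflexivity.
Qed.

Lemma csum_mult f g n m :
  (csum f n * csum g m)%C = csum (fun i => csum (fun j => (f i * g j)%C) m) n.
Proof.
  induction n; simpl; [ring|]. rewrite <- IHn, csum_scal. ring.
Qed.

Lemma csum_single f n i :
  (i < n)%nat -> (forall k, (k < n)%nat -> k <> i -> f k = RtoC 0) -> csum f n = f i.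
Proof.
  induction n; intros Hi H; [lia|]. simpl.
  destruct (Nat.eq_dec i n) as [->|Hne].
  - rewrite csum_zero; [ring|]. intros k Hk; apply H; lia.
  - rewrite IHn; [|lia|intros; apply H; lia]. rewrite (H n) by lia. ring.
Qed.

Lemma csum_first f n : csum f (S n) = (f O + csum (fun k => f (S k)) n)%C.
Proof.
  induction n; [simpl; ring|].
  change (csum f (S (S n))) with (csum f (S n) + f (S n))%C.
  rewrite IHn. simpl. ring.
Qed.

Lemma rsum_split f n m : rsum f (n + m) = rsum f n + rsum (fun k => f (n + k)%nat) m.
Proof.
  induction m; simpl.
  - rewrite Nat.add_0_r; ring.
  - rewrite Nat.add_succ_r. simpl. rewrite IHm. ring.
Qed.

Lemma csum_rev f n : csum f n = csum (fun k => f (n - 1 - k)%nat) n.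
Proof.
  induction n; [reflexivity|].
  rewrite (csum_first (fun k => f (S n - 1 - k)%nat)). simpl (csum f (S n)). rewrite IHn.
  replace (S n - 1 - 0)%nat with n by lia.
  rewrite (csum_ext (fun k => f (S n - 1 - S k)%nat) (fun k => f (n - 1 - k)%nat)).
  - ring.
  - intros k Hk. f_equal. lia.
Qed.

Lemma Cmod_csum f n : Cmod (csum f n) <= rsum (fun k => Cmod (f k)) n.
Proof.
  induction n; simpl; [rewrite Cmod_0; lra|].
  eapply Rle_trans; [apply Cmod_triangle|]. lra.
Qed.

Lemma Re_csum f n : Re (csum f n) = rsum (fun k => Re (f k)) n.
Proof. induction n; simpl; auto. rewrite <- IHn. reflexivity. Qed.

Lemma Im_csum f n : Im (csum f n) = rsum (fun k => Im (f k)) n.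
Proof. induction n; simpl; auto. rewrite <- IHn. reflexivity. Qed.

Lemma rsum_f_R0 f n : rsum f (S n) = sum_f_R0 f n.
Proof. induction n; simpl in *; [lra|]. rewrite <- IHn. lra. Qed.

Lemma rsum_geom q n : q <> 1 -> rsum (fun k => q ^ k) n = (1 - q ^ n) / (1 - q).
Proof.
  intros Hq. induction n; simpl; [field; lra|]. rewrite IHn. field. lra.
Qed.

Lemma le_epsilon_mult (a b c : R) : (forall e, 0 < e -> a <= b + c * e) -> a <= b.
Proof.
  intros H. apply le_epsilon. intros e He.
  assert (Hc : 0 < Rabs c + 1) by (pose proof (Rabs_pos c); lra).
  eapply Rle_trans; [apply (H (e / (Rabs c + 1))); now apply Rdiv_lt_0_compat|].
  apply Rplus_le_compat_l.
  replace e with ((Rabs c + 1) * (e / (Rabs c + 1))) at 2 by (field; lra).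
  apply Rmult_le_compat_r.
  - apply Rlt_le, Rdiv_lt_0_compat; lra.
  - pose proof (Rle_abs c); lra.
Qed.

Lemma pow_small (q e : R) : 0 <= q < 1 -> 0 < e ->
  exists N, forall n, (N <= n)%nat -> q ^ n < e.
Proof.
  intros Hq He.
  destruct (pow_lt_1_zero q) with (y := e) as [N HN]; auto.
  - rewrite Rabs_pos_eq; lra.
  - exists N. intros n Hn. specialize (HN n Hn).
    rewrite Rabs_pos_eq in HN; auto. apply pow_le; lra.
Qed.

(** * Power series with geometrically decaying coefficients *)

(** Power series analytic across the closed unit disc. The truncated potentials have their poles at
    radii 1 + xi^k, so everything built from them is of this kind and has values on the circle
    without any boundary limit. *)
Definition geo (a : nat -> C) : Prop :=
  exists M rho, 0 < rho < 1 /\ forall n, Cmod (a n) <= M * rho ^ n.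

Definition conv (a b : nat -> C) (n : nat) : C :=
  csum (fun k => (a k * (b (n - k)%nat))%C) (S n).

Definition deriv (a : nat -> C) (n : nat) : C := (RtoC (INR (S n)) * a (S n))%C.

(** Total, like [Series]; it is the sum of the power series when [geo a] and |z| <= 1. *)
Definition ev (a : nat -> C) (z : C) : C :=
  (Series (fun n => Re (a n * z ^ n)%C),
   Series (fun n => Im (a n * z ^ n)%C)).

Lemma bernoulli x n : 0 <= x -> 1 + INR n * x <= (1 + x) ^ n.
Proof.
  intros Hx. induction n; [simpl; lra|].
  rewrite S_INR. simpl.
  assert (0 <= INR n) by apply pos_INR.
  nra.
Qed.

(** Bernoulli's inequality for the powers of rho' / rho absorbs the factor n + 1. This small loss of
    rate is what makes [geo] stable under products and derivatives. *)
Lemma linear_geom rho : 0 < rho < 1 ->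
  exists M rho', 0 < M /\ 0 < rho' < 1 /\ rho <= rho' /\
    forall n, (INR n + 1) * rho ^ n <= M * rho' ^ n.
Proof.
  intros Hr. set (r' := (1 + rho) / 2). set (x := r' / rho - 1).
  assert (Hx : 0 < x).
  { unfold x, r'. apply Rmult_lt_reg_r with rho; [lra|].
    field_simplify; lra. }
  exists (1 + / x), r'.
  assert (0 < / x) by (now apply Rinv_0_lt_compat).
  repeat split; try (unfold r'; lra).
  intros n.
  replace r' with (rho * (1 + x)) by (unfold x; field; lra).
  rewrite Rpow_mult_distr.
  assert (0 < rho ^ n) by (apply pow_lt; lra).
  pose proof (bernoulli x n (Rlt_le _ _ Hx)) as Hb.
  assert (H3 : INR n + 1 <= (1 + / x) * (1 + x) ^ n).
  { apply Rle_trans with ((1 + / x) * (1 + INR n * x)).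
    - assert (/ x * x = 1) by (field; lra).
      assert (0 <= INR n) by apply pos_INR.
      replace ((1 + / x) * (1 + INR n * x)) with (1 + INR n * x + / x + INR n * (/ x * x)) by ring.
      rewrite H1. assert (0 <= INR n * x) by (apply Rmult_le_pos; lra). lra.
    - apply Rmult_le_compat_l; lra. }
  replace ((1 + / x) * (rho ^ n * (1 + x) ^ n)) with (((1 + / x) * (1 + x) ^ n) * rho ^ n) by ring.
  apply Rmult_le_compat_r; lra.
Qed.

Lemma geo_pos a : geo a ->
  exists M rho, 0 < M /\ 0 < rho < 1 /\ forall n, Cmod (a n) <= M * rho ^ n.
Proof.
  intros (M & rho & Hr & H). exists (Rabs M + 1), rho.
  pose proof (Rabs_pos M). repeat split; try lra.
  intros n. eapply Rle_trans; [apply H|].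
  apply Rmult_le_compat_r; [apply pow_le; lra|].
  pose proof (Rle_abs M); lra.
Qed.

Lemma geo_common a b : geo a -> geo b ->
  exists M rho, 0 < M /\ 0 < rho < 1 /\
    (forall n, Cmod (a n) <= M * rho ^ n) /\ (forall n, Cmod (b n) <= M * rho ^ n).
Proof.
  intros Ha Hb.
  destruct (geo_pos a Ha) as (M1 & r1 & HM1 & Hr1 & H1).
  destruct (geo_pos b Hb) as (M2 & r2 & HM2 & Hr2 & H2).
  exists (M1 + M2), (Rmax r1 r2).
  pose proof (Rmax_l r1 r2). pose proof (Rmax_r r1 r2).
  assert (Rmax r1 r2 < 1) by (apply Rmax_lub_lt; lra).
  repeat split; try lra; intros n.
  - eapply Rle_trans; [apply H1|].
    apply Rmult_le_compat; try lra; [apply pow_le; lra|apply pow_incr; lra].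
  - eapply Rle_trans; [apply H2|].
    apply Rmult_le_compat; try lra; [apply pow_le; lra|apply pow_incr; lra].
Qed.

Lemma geo_plus a b : geo a -> geo b -> geo (fun n => (a n + b n)%C).
Proof.
  intros Ha Hb. destruct (geo_common a b Ha Hb) as (M & r & HM & Hr & H1 & H2).
  exists (2 * M), r. split; auto. intros n.
  eapply Rle_trans; [apply Cmod_triangle|].
  specialize (H1 n); specialize (H2 n); lra.
Qed.

Lemma geo_scal c a : geo a -> geo (fun n => (c * a n)%C).
Proof.
  intros (M & r & Hr & H). exists (Cmod c * M), r. split; auto.
  intros n. rewrite Cmod_mult, Rmult_assoc. apply Rmult_le_compat_l; auto.
  apply Cmod_ge_0.
Qed.

Lemma geo_finite a n0 : (forall n, (n0 <= n)%nat -> a n = RtoC 0) -> geo a.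
Proof.
  intros H.
  assert (Hm : exists M, 0 < M /\ forall n, Cmod (a n) <= M * (/2) ^ n).
  { induction n0 in a, H |- *.
    - exists 1. split; [lra|]. intros n. rewrite H, Cmod_0 by lia.
      assert (0 < (/2)^n) by (apply pow_lt; lra). lra.
    - destruct (IHn0 (fun n => a (S n))) as (M & HM & Hn).
      { intros n Hn; apply H; lia. }
      exists (2 * M + Cmod (a O)). pose proof (Cmod_ge_0 (a O)).
      split; [lra|]. intros [|n]; [simpl; lra|].
      eapply Rle_trans; [apply Hn|].
      assert (0 < (/2)^n) by (apply pow_lt; lra). simpl. nra. }
  destruct Hm as (M & HM & Hn). exists M, (/2). split; [lra|auto].
Qed.

Lemma geo_conv a b : geo a -> geo b -> geo (conv a b).
Proof.
  intros Ha Hb. destruct (geo_common a b Ha Hb) as (M & r & HM & Hr & H1 & H2).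
  destruct (linear_geom r Hr) as (M' & r' & HM' & Hr' & Hle & H').
  exists (M * M * M'), r'. split; auto. intros n.
  unfold conv. eapply Rle_trans; [apply Cmod_csum|].
  apply Rle_trans with (rsum (fun _ => M * M * r ^ n) (S n)).
  - apply rsum_le. intros k Hk. rewrite Cmod_mult.
    replace (M * M * r ^ n) with ((M * r ^ k) * (M * r ^ (n - k))).
    + apply Rmult_le_compat; auto; apply Cmod_ge_0.
    + replace n with (k + (n - k))%nat at 2 by lia. rewrite pow_add. ring.
  - rewrite rsum_const, S_INR. specialize (H' n).
    assert (0 < M * M) by nra.
    replace ((INR n + 1) * (M * M * r ^ n)) with (M * M * ((INR n + 1) * r ^ n)) by ring.
    rewrite (Rmult_assoc (M * M)). apply Rmult_le_compat_l; lra.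
Qed.

Lemma geo_deriv a : geo a -> geo (deriv a).
Proof.
  intros Ha. destruct (geo_pos a Ha) as (M & r & HM & Hr & H).
  destruct (linear_geom r Hr) as (M' & r' & HM' & Hr' & Hle & H').
  exists (M * M'), r'. split; auto. intros n. unfold deriv.
  rewrite Cmod_mult, Cmod_R, Rabs_pos_eq, S_INR by apply pos_INR.
  specialize (H' n). specialize (H (S n)). simpl in H.
  assert (0 < r ^ n) by (apply pow_lt; lra).
  assert (0 <= INR n) by apply pos_INR.
  apply Rle_trans with ((INR n + 1) * (M * r ^ n)).
  - apply Rmult_le_compat_l; [lra|]. eapply Rle_trans; [apply H|].
    assert (0 < M * r ^ n) by nra. nra.
  - nra.
Qed.

Lemma geo_shrink a r : 0 <= r <= 1 -> geo a -> geo (fun n => (a n * RtoC (r ^ n))%C).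
Proof.
  intros Hr (M & q & Hq & H). exists M, q. split; auto. intros n.
  rewrite Cmod_mult, Cmod_R, Rabs_pos_eq by (apply pow_le; lra).
  rewrite <- (Rmult_1_r (M * q ^ n)).
  apply Rmult_le_compat; auto; [apply Cmod_ge_0|apply pow_le; lra|].
  rewrite <- (pow1 n). apply pow_incr; lra.
Qed.

Lemma real_series_tail (u : nat -> R) M q N :
  0 < q < 1 -> (forall n, Rabs (u n) <= M * q ^ n) ->
  ex_series u /\ ex_series (fun n => Rabs (u n)) /\
  Rabs (Series u - rsum u N) <= M * q ^ N / (1 - q).
Proof.
  intros Hq H.
  assert (Hg : ex_series (fun n => M * q ^ n)).
  { exists (M * / (1 - q)). apply (is_series_scal M (fun n => q ^ n)).
    apply is_series_geom. rewrite Rabs_pos_eq; lra. }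
  assert (Hu : ex_series u) by (apply (ex_series_le u (fun n => M * q ^ n)); auto).
  assert (Hau : ex_series (fun n => Rabs (u n))).
  { apply (ex_series_le (fun n => Rabs (u n)) (fun n => M * q ^ n)); auto.
    intros n. unfold norm; simpl. unfold abs; simpl. rewrite Rabs_Rabsolu. apply H. }
  split; [|split]; auto.
  assert (Hsh : Series u - rsum u N = Series (fun k => u (N + k)%nat)).
  { destruct N.
    - simpl. rewrite Rminus_0_r. apply Series_ext. reflexivity.
    - rewrite (Series_incr_n u (S N)); auto; [|lia].
      rewrite rsum_f_R0. simpl pred. lra. }
  rewrite Hsh.
  assert (Hg2 : is_series (fun n => M * q ^ N * q ^ n) (M * q ^ N * / (1 - q))).
  { apply (is_series_scal (M * q ^ N) (fun n => q ^ n)).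
    apply is_series_geom. rewrite Rabs_pos_eq; lra. }
  assert (Hb : forall k, Rabs (u (N + k)%nat) <= M * q ^ N * q ^ k).
  { intros k. rewrite Rmult_assoc, <- pow_add. auto. }
  eapply Rle_trans; [apply Series_Rabs|].
  - apply (ex_series_le (fun k => Rabs (u (N + k)%nat)) (fun n => M * q ^ N * q ^ n)).
    + intros n. unfold norm; simpl. unfold abs; simpl. rewrite Rabs_Rabsolu. apply Hb.
    + eexists; eassumption.
  - unfold Rdiv. rewrite <- (is_series_unique _ _ Hg2).
    apply Series_le; [|eexists; eassumption].
    intros n; split; [apply Rabs_pos|apply Hb].
Qed.

Lemma Cmod_Cpow_le1 z n : Cmod z <= 1 -> Cmod (z ^ n)%C <= 1.
Proof.
  intros H. rewrite Cmod_pow. rewrite <- (pow1 n).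
  apply pow_incr. split; [apply Cmod_ge_0|auto].
Qed.

Lemma term_bound a z M q n :
  Cmod z <= 1 -> (forall n, Cmod (a n) <= M * q ^ n) ->
  Cmod (a n * z ^ n)%C <= M * q ^ n.
Proof.
  intros Hz H. rewrite Cmod_mult. rewrite <- (Rmult_1_r (M * q ^ n)).
  apply Rmult_le_compat; auto; try apply Cmod_ge_0. now apply Cmod_Cpow_le1.
Qed.

Lemma im_le_Cmod (c : C) : Rabs (Im c) <= Cmod c.
Proof.
  eapply Rle_trans; [|apply Rmax_Cmod]. apply Rmax_r.
Qed.

Lemma Cmod_le_Re_Im (c : C) : Cmod c <= Rabs (Re c) + Rabs (Im c).
Proof.
  apply Rsqr_incr_0_var.
  - rewrite Rsqr_plus. unfold Rsqr at 1.
    replace (Cmod c * Cmod c) with (Cmod c ^ 2) by ring. rewrite Cmod2_alt.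
    rewrite <- !Rsqr_abs. unfold Rsqr.
    pose proof (Rabs_pos (Re c)); pose proof (Rabs_pos (Im c)). nra.
  - pose proof (Rabs_pos (Re c)); pose proof (Rabs_pos (Im c)); lra.
Qed.

Lemma ev_tail a z M q N :
  0 < q < 1 -> (forall n, Cmod (a n) <= M * q ^ n) -> Cmod z <= 1 ->
  Cmod (ev a z - csum (fun n => (a n * z ^ n)%C) N)%C <= 2 * M * q ^ N / (1 - q).
Proof.
  intros Hq H Hz.
  set (t := fun n => (a n * z ^ n)%C).
  assert (Ht : forall n, Cmod (t n) <= M * q ^ n) by (intros n; now apply term_bound).
  destruct (real_series_tail (fun n => Re (t n)) M q N Hq) as (_ & _ & H1).
  { intros n. eapply Rle_trans; [apply re_le_Cmod|apply Ht]. }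
  destruct (real_series_tail (fun n => Im (t n)) M q N Hq) as (_ & _ & H2).
  { intros n. eapply Rle_trans; [apply im_le_Cmod|apply Ht]. }
  eapply Rle_trans; [apply Cmod_le_Re_Im|].
  replace (Re (ev a z - csum t N)%C)
    with (Series (fun n => Re (t n)) - rsum (fun n => Re (t n)) N)
    by (rewrite <- Re_csum; reflexivity).
  replace (Im (ev a z - csum t N)%C)
    with (Series (fun n => Im (t n)) - rsum (fun n => Im (t n)) N)
    by (rewrite <- Im_csum; reflexivity).
  unfold Rdiv in *. lra.
Qed.

Lemma geo_series a z : geo a -> Cmod z <= 1 ->
  ex_series (fun n => Rabs (Re (a n * z ^ n)%C)) /\
  ex_series (fun n => Rabs (Im (a n * z ^ n)%C)).
Proof.
  intros (M & q & Hq & H) Hz. split.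
  - apply (real_series_tail _ M q O Hq).
    intros n. eapply Rle_trans; [apply re_le_Cmod|now apply term_bound].
  - apply (real_series_tail _ M q O Hq).
    intros n. eapply Rle_trans; [apply im_le_Cmod|now apply term_bound].
Qed.

Lemma ev_ext a b z : (forall n, a n = b n) -> ev a z = ev b z.
Proof.
  intros H. unfold ev. f_equal; apply Series_ext; intros n; now rewrite H.
Qed.

Lemma Cplx_eq (a b : C) : Re a = Re b -> Im a = Im b -> a = b.
Proof. destruct a, b; simpl; intros; subst; reflexivity. Qed.

Lemma ev_plus a b z : geo a -> geo b -> Cmod z <= 1 ->
  ev (fun n => (a n + b n)%C) z = (ev a z + ev b z)%C.
Proof.
  intros Ha Hb Hz.
  destruct (geo_series a z Ha Hz) as [A1 A2]. destruct (geo_series b z Hb Hz) as [B1 B2].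
  apply ex_series_Rabs in A1, A2, B1, B2.
  apply Cplx_eq.
  - change (Series (fun n => Re ((a n + b n) * z ^ n)%C)
      = Series (fun n => Re (a n * z ^ n)%C)
        + Series (fun n => Re (b n * z ^ n)%C)).
    rewrite <- Series_plus by assumption. apply Series_ext; intros n.
    now rewrite Cmult_plus_distr_r.
  - change (Series (fun n => Im ((a n + b n) * z ^ n)%C)
      = Series (fun n => Im (a n * z ^ n)%C)
        + Series (fun n => Im (b n * z ^ n)%C)).
    rewrite <- Series_plus by assumption. apply Series_ext; intros n.
    now rewrite Cmult_plus_distr_r.
Qed.

Lemma ev_scal c a z : geo a -> Cmod z <= 1 ->
  ev (fun n => (c * a n)%C) z = (c * ev a z)%C.
Proof.
  intros Ha Hz. destruct (geo_series a z Ha Hz) as [A1 A2].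
  apply ex_series_Rabs in A1, A2.
  apply Cplx_eq.
  - change (Series (fun n => Re (c * a n * z ^ n)%C)
      = Re c * Series (fun n => Re (a n * z ^ n)%C)
        - Im c * Series (fun n => Im (a n * z ^ n)%C)).
    rewrite <- !Series_scal_l, <- Series_minus.
    + apply Series_ext; intros n. unfold Re, Im; simpl. ring.
    + exact (@ex_series_scal R_AbsRing R_NormedModule (Re c) _ A1).
    + exact (@ex_series_scal R_AbsRing R_NormedModule (Im c) _ A2).
  - change (Series (fun n => Im (c * a n * z ^ n)%C)
      = Re c * Series (fun n => Im (a n * z ^ n)%C)
        + Im c * Series (fun n => Re (a n * z ^ n)%C)).
    rewrite <- !Series_scal_l, <- Series_plus.
    + apply Series_ext; intros n. unfold Re, Im; simpl. ring.
    + exact (@ex_series_scal R_AbsRing R_NormedModule (Re c) _ A2).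
    + exact (@ex_series_scal R_AbsRing R_NormedModule (Im c) _ A1).
Qed.

Lemma ev_conv a b z : geo a -> geo b -> Cmod z <= 1 ->
  ev (conv a b) z = (ev a z * ev b z)%C.
Proof.
  intros Ha Hb Hz.
  set (s := fun n => (a n * z ^ n)%C). set (t := fun n => (b n * z ^ n)%C).
  destruct (geo_series a z Ha Hz) as [A1 A2]. destruct (geo_series b z Hb Hz) as [B1 B2].
  pose proof (ex_series_Rabs _ A1) as A1'. pose proof (ex_series_Rabs _ A2) as A2'.
  pose proof (ex_series_Rabs _ B1) as B1'. pose proof (ex_series_Rabs _ B2) as B2'.
  apply Series_correct in A1', A2', B1', B2'.
  assert (Hterm : forall n, (conv a b n * z ^ n)%C
            = csum (fun k => (s k * (t (n - k)%nat))%C) (S n)).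
  { intros n. unfold conv. rewrite Cmult_comm, <- csum_scal. apply csum_ext.
    intros k Hk. unfold s, t.
    replace n with (k + (n - k))%nat at 1 by lia. rewrite Cpow_add_r. ring. }
  apply Cplx_eq.
  - change (Series (fun n => Re (conv a b n * z ^ n)%C) =
      Series (fun n => Re (s n)) * Series (fun n => Re (t n))
      - Series (fun n => Im (s n)) * Series (fun n => Im (t n))).
    apply is_series_unique.
    eapply is_series_ext; [|apply (is_series_minus _ _ _ _
      (is_series_mult _ _ _ _ A1' B1' A1 B1) (is_series_mult _ _ _ _ A2' B2' A2 B2))].
    intros n. cbv beta. rewrite Hterm, Re_csum.
    rewrite <- !rsum_f_R0. unfold minus, plus, opp; simpl AbelianGroup.sort.
    change (rsum (fun k => Re (s k) * Re (t (n - k)%nat)) (S n)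
      + - rsum (fun k => Im (s k) * Im (t (n - k)%nat)) (S n)
      = rsum (fun k => Re (s k * (t (n - k)%nat))%C) (S n)).
    replace (- rsum (fun k => Im (s k) * Im (t (n - k)%nat)) (S n))
      with (-1 * rsum (fun k => Im (s k) * Im (t (n - k)%nat)) (S n)) by ring.
    rewrite <- rsum_scal, <- rsum_plus. apply rsum_ext. intros k _.
    rewrite re_mult. ring.
  - change (Series (fun n => Im (conv a b n * z ^ n)%C) =
      Series (fun n => Re (s n)) * Series (fun n => Im (t n))
      + Series (fun n => Im (s n)) * Series (fun n => Re (t n))).
    apply is_series_unique.
    eapply is_series_ext; [|apply (is_series_plus _ _ _ _
      (is_series_mult _ _ _ _ A1' B2' A1 B2) (is_series_mult _ _ _ _ A2' B1' A2 B1))].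
    intros n. cbv beta. rewrite Hterm, Im_csum.
    rewrite <- !rsum_f_R0. unfold plus; simpl AbelianGroup.sort.
    change (rsum (fun k => Re (s k) * Im (t (n - k)%nat)) (S n)
      + rsum (fun k => Im (s k) * Re (t (n - k)%nat)) (S n)
      = rsum (fun k => Im (s k * (t (n - k)%nat))%C) (S n)).
    rewrite <- rsum_plus. apply rsum_ext. intros k _.
    rewrite im_mult. ring.
Qed.

Lemma deriv_conv a b n :
  deriv (conv a b) n = (conv (deriv a) b n + conv a (deriv b) n)%C.
Proof.
  unfold deriv, conv.
  rewrite <- csum_scal.
  rewrite (csum_ext _ (fun k => (RtoC (INR k) * (a k * (b (S n - k)%nat)) +
        RtoC (INR (S n - k)) * (a k * (b (S n - k)%nat)))%C)).
  2:{ intros k Hk. replace (S n) with (k + (S n - k))%nat at 1 by lia.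
      rewrite plus_INR, RtoC_plus. ring. }
  rewrite csum_plus. f_equal.
  - rewrite csum_first. simpl (INR 0).
    rewrite (csum_ext (fun k => (RtoC (INR (S k)) * (a (S k) * (b (S n - S k)%nat)))%C)
      (fun k => (RtoC (INR (S k)) * a (S k) * (b (n - k)%nat))%C)).
    + ring.
    + intros k Hk. replace (S n - S k)%nat with (n - k)%nat by lia. ring.
  - change (csum ?f (S (S n))) with (csum f (S n) + f (S n))%C. cbv beta.
    replace (S n - S n)%nat with O by lia. simpl (INR 0).
    rewrite (csum_ext (fun k => (RtoC (INR (S n - k)) * (a k * (b (S n - k)%nat)))%C)
      (fun k => (a k * (RtoC (INR (S (n - k))) * b (S (n - k))))%C)).
    + ring.
    + intros k Hk. replace (S n - k)%nat with (S (n - k)) by lia. ring.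
Qed.

Lemma deriv_ext a b : (forall n, a n = b n) -> forall n, deriv a n = deriv b n.
Proof. intros H n. unfold deriv. now rewrite H. Qed.

(** * Roots of unity and Bessel's inequality *)

Lemma cis_plus a b : cis (a + b) = (cis a * cis b)%C.
Proof.
  apply Cplx_eq; unfold cis; simpl.
  - rewrite cos_plus; ring.
  - rewrite sin_plus; ring.
Qed.

Lemma cis_0 : cis 0 = RtoC 1.
Proof. unfold cis. now rewrite cos_0, sin_0. Qed.

Lemma cis_opp a : cis (- a) = Cconj (cis a).
Proof. unfold cis, Cconj; simpl. now rewrite cos_neg, sin_neg. Qed.

Lemma Cmod_cis a : Cmod (cis a) = 1.
Proof.
  unfold Cmod, cis; simpl.
  replace (cos a * (cos a * 1) + sin a * (sin a * 1)) with 1; [apply sqrt_1|].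
  pose proof (sin2_cos2 a). unfold Rsqr in *. lra.
Qed.

Lemma cis_pow a n : (cis a ^ n)%C = cis (INR n * a).
Proof.
  induction n.
  - simpl. rewrite Rmult_0_l, cis_0. reflexivity.
  - rewrite Cpow_S, IHn, S_INR, <- cis_plus. f_equal. ring.
Qed.

Lemma cis_2PI_nat n : cis (2 * PI * INR n) = RtoC 1.
Proof.
  unfold cis.
  replace (2 * PI * INR n) with (0 + 2 * INR n * PI) by ring.
  now rewrite cos_period, sin_period, cos_0, sin_0.
Qed.

Lemma cis_neq_1 x : 0 < Rabs x < 1 -> cis (2 * PI * x) <> RtoC 1.
Proof.
  intros Hx H. assert (Hc : cos (2 * (PI * x)) = 1).
  { rewrite <- Rmult_assoc. change (cos (2 * PI * x)) with (Re (cis (2 * PI * x))).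
    now rewrite H. }
  rewrite cos_2a_sin in Hc.
  assert (Hs : sin (PI * x) = 0) by nra.
  assert (Hs2 : sin (PI * Rabs x) = 0).
  { unfold Rabs; destruct Rcase_abs; auto.
    replace (PI * - x) with (- (PI * x)) by ring. rewrite sin_neg, Hs. ring. }
  pose proof PI_RGT_0.
  assert (0 < sin (PI * Rabs x)) by (apply sin_gt_0; nra). lra.
Qed.

Definition root (m k : nat) : C := cis (2 * PI * (INR k / INR m)).

Lemma root_orthogonal m i j : (i < m)%nat -> (j < m)%nat ->
  csum (fun k => (root m k ^ i * Cconj (root m k ^ j)%C)%C) m
  = if Nat.eq_dec i j then RtoC (INR m) else RtoC 0.
Proof.
  intros Hi Hj.
  assert (Hm : 0 < INR m) by (apply lt_0_INR; lia).
  set (x := (INR i - INR j) / INR m).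
  rewrite (csum_ext _ (fun k => (cis (2 * PI * x) ^ k)%C)).
  2:{ intros k _. unfold root. rewrite !cis_pow, <- cis_opp, <- cis_plus.
      f_equal. unfold x. field. lra. }
  destruct (Nat.eq_dec i j) as [->|Hne].
  - replace (2 * PI * x) with 0 by (unfold x; field; lra). rewrite cis_0.
    rewrite (csum_ext _ (fun _ => RtoC 1)) by (intros; apply Cpow_1_l).
    rewrite csum_const. ring.
  - assert (Hq : cis (2 * PI * x) <> RtoC 1).
    { apply cis_neq_1. unfold x.
      unfold Rdiv. rewrite Rabs_mult, Rabs_inv, (Rabs_pos_eq (INR m)) by lra.
      assert (0 < Rabs (INR i - INR j)).
      { apply Rabs_pos_lt. intros Hc. apply Hne, INR_eq. lra. }
      assert (Rabs (INR i - INR j) < INR m).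
      { apply lt_INR in Hi, Hj. pose proof (pos_INR i). pose proof (pos_INR j).
        apply Rabs_def1; lra. }
      split.
      - apply Rmult_lt_0_compat; [lra|]. now apply Rinv_0_lt_compat.
      - apply Rmult_lt_reg_r with (INR m); [lra|].
        rewrite Rmult_assoc, Rinv_l; lra. }
    assert (Hqm : (cis (2 * PI * x) ^ m)%C = RtoC 1).
    { rewrite cis_pow.
      replace (INR m * (2 * PI * x)) with (2 * PI * INR i + - (2 * PI * INR j))
        by (unfold x; field; lra).
      rewrite cis_plus, cis_opp, !cis_2PI_nat.
      apply Cplx_eq; simpl; ring. }
    assert (Hg : forall n, ((RtoC 1 - cis (2 * PI * x)) *
        csum (fun k => (cis (2 * PI * x) ^ k)%C) n)%C
       = (RtoC 1 - cis (2 * PI * x) ^ n)%C).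
    { induction n; [simpl; ring|]. rewrite Cpow_S. simpl csum.
      rewrite Cmult_plus_distr_l, IHn. ring. }
    specialize (Hg m). rewrite Hqm in Hg.
    set (S := csum _ m) in *.
    assert (Hne1 : (RtoC 1 - cis (2 * PI * x))%C <> RtoC 0).
    { intros Hc. apply Hq.
      replace (cis (2 * PI * x)) with (RtoC 1 - (RtoC 1 - cis (2 * PI * x)))%C by ring.
      rewrite Hc. ring. }
    replace S with (/ (RtoC 1 - cis (2 * PI * x)) *
        ((RtoC 1 - cis (2 * PI * x)) * S))%C by (field; auto).
    rewrite Hg. ring.
Qed.

Lemma Cconj_csum f n : Cconj (csum f n) = csum (fun k => Cconj (f k)) n.
Proof.
  induction n; simpl.
  - apply Cplx_eq; simpl; ring.
  - rewrite <- IHn. apply Cplx_eq; simpl; ring.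
Qed.

Lemma RtoC_rsum f n : RtoC (rsum f n) = csum (fun k => RtoC (f k)) n.
Proof. induction n; simpl; auto. now rewrite RtoC_plus, IHn. Qed.

(** Plancherel's identity of the discrete Fourier transform of length m. It stands for the integral
    over the circle: a polynomial of degree below m is measured in mean square by its values at the
    m-th roots of unity. *)
Lemma parseval p m :
  rsum (fun k => Cmod (csum (fun n => (p n * root m k ^ n)%C) m) ^ 2) m
  = INR m * rsum (fun n => Cmod (p n) ^ 2) m.
Proof.
  apply RtoC_inj. rewrite RtoC_rsum, RtoC_mult, RtoC_rsum.
  rewrite (csum_ext _ (fun k => csum (fun i => csum (fun j =>
     (p i * Cconj (p j) * (root m k ^ i * Cconj (root m k ^ j)%C))%C) m) m)).
  2:{ intros k _. rewrite Cmod2_conj, Cconj_csum, csum_mult.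
      apply csum_ext; intros i _. apply csum_ext; intros j _.
      rewrite Cmult_conj. ring. }
  rewrite csum_swap, <- csum_scal. apply csum_ext. intros i Hi.
  rewrite csum_swap, (csum_single _ m i); auto.
  - rewrite csum_scal, root_orthogonal by auto.
    destruct (Nat.eq_dec i i); [|lia]. rewrite Cmod2_conj. ring.
  - intros j Hj Hne. rewrite csum_scal, root_orthogonal by auto.
    destruct (Nat.eq_dec i j); [lia|]. ring.
Qed.

Definition delta (n : nat) : C := match n with O => RtoC 1 | _ => RtoC 0 end.

Lemma geo_delta : geo delta.
Proof. apply (geo_finite _ 1). intros [|n] H; [lia|reflexivity]. Qed.

Lemma conv_delta a n : conv a delta n = a n.
Proof.
  unfold conv. rewrite (csum_single _ (S n) n); [|lia|].
  - rewrite Nat.sub_diag. simpl. ring.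
  - intros k Hk Hne. destruct (n - k)%nat eqn:E; [lia|]. simpl. ring.
Qed.

Lemma root_unit m k : (k < m)%nat -> exists t, 0 <= t <= 1 /\ root m k = cis (2 * PI * t).
Proof.
  intros H. exists (INR k / INR m). split; [|reflexivity].
  assert (0 < INR m) by (apply lt_0_INR; lia).
  apply lt_INR in H. pose proof (pos_INR k). split.
  - apply Rdiv_le_0_compat; lra.
  - apply Rmult_le_reg_r with (INR m); [lra|]. unfold Rdiv.
    rewrite Rmult_assoc, Rinv_l; lra.
Qed.

Lemma ev_unif_limit a : geo a -> forall e, 0 < e -> exists N0, forall N z, (N0 <= N)%nat ->
  Cmod z <= 1 -> Cmod (ev a z - csum (fun n => (a n * z ^ n)%C) N)%C <= e.
Proof.
  intros Ha e He. destruct (geo_pos a Ha) as (M & q & HM & Hq & H).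
  destruct (pow_small q (e * (1 - q) / (2 * M))) as [N0 HN0]; [lra| |].
  { apply Rdiv_lt_0_compat; [apply Rmult_lt_0_compat|]; lra. }
  exists N0. intros N z HN Hz.
  eapply Rle_trans; [apply (ev_tail a z M q N); auto|].
  specialize (HN0 N HN). apply Rmult_lt_compat_l with (r := 2 * M) in HN0; [|lra].
  replace (2 * M * (e * (1 - q) / (2 * M))) with (e * (1 - q)) in HN0 by (field; lra).
  apply Rmult_le_reg_r with (1 - q); [lra|].
  replace (2 * M * q ^ N / (1 - q) * (1 - q)) with (2 * M * q ^ N) by (field; lra). lra.
Qed.

Lemma ev_bounded a : geo a -> exists B, 0 < B /\ forall z, Cmod z <= 1 -> Cmod (ev a z) <= B.
Proof.
  intros Ha. destruct (geo_pos a Ha) as (M & q & HM & Hq & H).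
  exists (2 * M / (1 - q)). split; [apply Rdiv_lt_0_compat; lra|].
  intros z Hz. pose proof (ev_tail a z M q O Hq H Hz) as Ht. simpl in Ht.
  replace (ev a z - RtoC 0)%C with (ev a z) in Ht by ring. lra.
Qed.

Lemma Cmod_minus_sym a b : Cmod (a - b)%C = Cmod (b - a)%C.
Proof. rewrite <- Cmod_opp. f_equal. ring. Qed.

Lemma Cmod_le_minus a b : Cmod a <= Cmod b + Cmod (a - b)%C.
Proof.
  replace a with (b + (a - b))%C at 1 by ring. apply Cmod_triangle.
Qed.

(** Multiplication by a function bounded by B on the circle has norm at most B on square summable
    sequences. [parseval] only sees polynomials of degree below m, so b and the product are
    truncated at m; the truncation errors are uniform on the circle and tend to 0. *)
Lemma bessel_conv a b B S : geo a -> geo b -> 0 <= B ->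
  (forall t, 0 <= t <= 1 -> Cmod (ev a (cis (2 * PI * t))) <= B) ->
  (forall N, rsum (fun n => Cmod (b n) ^ 2) N <= S) ->
  forall N, rsum (fun n => Cmod (conv a b n) ^ 2) N <= B ^ 2 * S.
Proof.
  intros Ha Hb HB HBa HS N.
  pose proof (geo_conv a b Ha Hb) as Hc.
  destruct (ev_bounded b Hb) as (Bb & HBb & Hevb).
  apply (le_epsilon_mult _ _ ((B + 1) * (2 * B * (Bb + 1) + (B + 1)))).
  (* Capping e at 1 keeps the square of the error w = (B + 1) e below a multiple of e. *)
  intros e' He'. set (e := Rmin e' 1).
  assert (He : 0 < e <= 1).
  { unfold e. split; [apply Rmin_glb_lt; lra|apply Rmin_r]. }
  destruct (ev_unif_limit _ Hc e (proj1 He)) as [N1 HN1].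
  destruct (ev_unif_limit _ Hb e (proj1 He)) as [N2 HN2].
  set (m := (N + N1 + N2 + 1)%nat).
  assert (Hm : 0 < INR m) by (apply lt_0_INR; lia).
  apply Rle_trans with (rsum (fun n => Cmod (conv a b n) ^ 2) m).
  { replace m with (N + (N1 + N2 + 1))%nat by lia. rewrite rsum_split.
    assert (0 <= rsum (fun k => Cmod (conv a b (N + k)) ^ 2) (N1 + N2 + 1)); [|lra].
    apply rsum_nonneg. intros; apply pow2_ge_0. }
  apply Rmult_le_reg_l with (INR m); auto. rewrite <- parseval.
  set (w := (B + 1) * e).
  apply Rle_trans with (rsum (fun k => B ^ 2 *
    Cmod (csum (fun n => (b n * root m k ^ n)%C) m) ^ 2
    + (2 * B * (Bb + 1) * w + w ^ 2)) m).
  { apply rsum_le. intros k Hk.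
    destruct (root_unit m k Hk) as (t & Ht & Hroot).
    assert (Hz : Cmod (root m k) <= 1) by (unfold root; rewrite Cmod_cis; lra).
    specialize (HN1 m (root m k) ltac:(lia) Hz). specialize (HN2 m (root m k) ltac:(lia) Hz).
    specialize (Hevb _ Hz). specialize (HBa t Ht). rewrite <- Hroot in HBa.
    rewrite ev_conv in HN1 by auto.
    set (pc := csum (fun n => (conv a b n * root m k ^ n)%C) m) in *.
    set (pb := csum (fun n => (b n * root m k ^ n)%C) m) in *.
    set (A := ev a (root m k)) in *. set (Bv := ev b (root m k)) in *.
    assert (H1 : Cmod pc <= B * Cmod Bv + e).
    { pose proof (Cmod_le_minus pc (A * Bv)%C) as Hx.
      rewrite Cmod_minus_sym, Cmod_mult in Hx.
      assert (Cmod A * Cmod Bv <= B * Cmod Bv) by (apply Rmult_le_compat_r; [apply Cmod_ge_0|auto]).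
      lra. }
    pose proof (Cmod_le_minus Bv pb) as H2.
    pose proof (Cmod_le_minus pb Bv) as H3. rewrite Cmod_minus_sym in H3.
    pose proof (Cmod_ge_0 pc). pose proof (Cmod_ge_0 pb). pose proof (Cmod_ge_0 Bv).
    assert (Hpc : Cmod pc <= B * Cmod pb + w) by (unfold w; nra).
    assert (Hpb : Cmod pb <= Bb + 1) by lra.
    assert (0 <= w) by (unfold w; nra).
    apply Rle_trans with ((B * Cmod pb + w) ^ 2); [apply pow_incr; lra|].
    assert (B * Cmod pb * w <= B * (Bb + 1) * w).
    { apply Rmult_le_compat_r; auto. apply Rmult_le_compat_l; auto. }
    nra. }
  rewrite rsum_plus, rsum_scal, parseval, rsum_const.
  replace (B ^ 2 * (INR m * rsum (fun n => Cmod (b n) ^ 2) m) + INR m * (2 * B * (Bb + 1) * w + w ^ 2))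
    with (INR m * (B ^ 2 * rsum (fun n => Cmod (b n) ^ 2) m + (2 * B * (Bb + 1) * w + w ^ 2))) by ring.
  apply Rmult_le_compat_l; [lra|]. apply Rplus_le_compat.
  - apply Rmult_le_compat_l; [apply pow2_ge_0|auto].
  - assert (Hee : e <= e') by apply Rmin_l.
    assert (w ^ 2 <= (B + 1) * ((B + 1) * e)).
    { replace (w ^ 2) with ((B + 1) * ((B + 1) * (e * e))) by (unfold w; ring).
      repeat (apply Rmult_le_compat_l; [lra|]). nra. }
    apply Rle_trans with ((B + 1) * (2 * B * (Bb + 1) + (B + 1)) * e).
    + replace (2 * B * (Bb + 1) * w) with (2 * B * (Bb + 1) * (B + 1) * e) by (unfold w; ring). lra.
    + apply Rmult_le_compat_l; auto.
      apply Rmult_le_pos; [lra|]. assert (0 <= B * (Bb + 1)) by (apply Rmult_le_pos; lra). lra.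
Qed.

Lemma bessel a B : geo a -> 0 <= B ->
  (forall t, 0 <= t <= 1 -> Cmod (ev a (cis (2 * PI * t))) <= B) ->
  forall N, rsum (fun n => Cmod (a n) ^ 2) N <= B ^ 2.
Proof.
  intros Ha HB H N.
  rewrite (rsum_ext _ (fun n => Cmod (conv a delta n) ^ 2)) by (intros; now rewrite conv_delta).
  rewrite <- (Rmult_1_r (B ^ 2)). apply bessel_conv; auto.
  - apply geo_delta.
  - intros n. induction n as [|[|n] IH]; simpl in *; [lra| |].
    + rewrite Cmod_1. lra.
    + rewrite Cmod_0. lra.
Qed.

(** Bessel's inequality with bound 0. Together with [identity_theorem] it allows identities between
    coefficients to be checked on values on the circle, where convolution is multiplication. *)
Lemma identity_zero a : geo a -> (forall t, ev a (cis (2 * PI * t)) = RtoC 0) ->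
  forall n, a n = RtoC 0.
Proof.
  intros Ha H n. apply Cmod_eq_0.
  pose proof (bessel a 0 Ha (Rle_refl 0)) as Hb.
  assert (Hs : rsum (fun n => Cmod (a n) ^ 2) (S n) <= 0 ^ 2).
  { apply Hb. intros t _. rewrite H, Cmod_0. lra. }
  change (rsum (fun n => Cmod (a n) ^ 2) n + Cmod (a n) ^ 2 <= 0 ^ 2) in Hs.
  assert (0 <= rsum (fun n => Cmod (a n) ^ 2) n).
  { apply rsum_nonneg. intros; apply pow2_ge_0. }
  pose proof (Cmod_ge_0 (a n)).
  destruct (Req_dec (Cmod (a n)) 0) as [|Hne]; auto.
  assert (0 < Cmod (a n) ^ 2) by (apply pow_lt; lra). lra.
Qed.

Lemma identity_theorem a b : geo a -> geo b ->
  (forall t, ev a (cis (2 * PI * t)) = ev b (cis (2 * PI * t))) ->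
  forall n, a n = b n.
Proof.
  intros Ha Hb H n.
  assert (Hd : (a n + RtoC (-1) * b n)%C = RtoC 0).
  { apply (identity_zero (fun n => (a n + RtoC (-1) * b n)%C)).
    - apply geo_plus; auto. now apply geo_scal.
    - intros t. rewrite ev_plus, ev_scal, H; auto.
      + replace (-1) with (- (1)) by ring. rewrite RtoC_opp. ring.
      + rewrite Cmod_cis; lra.
      + now apply geo_scal.
      + rewrite Cmod_cis; lra. }
  replace (a n) with (a n + RtoC (-1) * b n + b n)%C.
  - rewrite Hd. ring.
  - replace (-1) with (- (1)) by ring. rewrite RtoC_opp. ring.
Qed.

(** * Geometric kernels *)

Lemma geo_pow q : Cmod q < 1 -> geo (fun n => (q ^ n)%C).
Proof.
  intros Hq. exists 1, (Rmax (Cmod q) (/ 2)).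
  pose proof (Cmod_ge_0 q). pose proof (Rmax_l (Cmod q) (/ 2)). pose proof (Rmax_r (Cmod q) (/ 2)).
  split.
  - split; [lra|]. apply Rmax_lub_lt; lra.
  - intros n. rewrite Cmod_pow, Rmult_1_l. apply pow_incr. lra.
Qed.

Lemma one_minus_neq_0 q z : Cmod q < 1 -> Cmod z <= 1 -> (RtoC 1 - q * z)%C <> RtoC 0.
Proof.
  intros Hq Hz H.
  assert (He : (q * z)%C = RtoC 1).
  { replace (q * z)%C with (RtoC 1 - (RtoC 1 - q * z))%C by ring.
    rewrite H. ring. }
  assert (Hm : Cmod q * Cmod z = 1) by (rewrite <- Cmod_mult, He, Cmod_1; lra).
  pose proof (Cmod_ge_0 q). pose proof (Cmod_ge_0 z). nra.
Qed.

Lemma ev_pow q z : Cmod q < 1 -> Cmod z <= 1 ->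
  ev (fun n => (q ^ n)%C) z = (/ (RtoC 1 - q * z))%C.
Proof.
  intros Hq Hz. pose proof (one_minus_neq_0 q z Hq Hz) as Hne.
  set (d := (RtoC 1 - q * z)%C) in *.
  assert (Hs : forall N, (csum (fun n => (q ^ n * z ^ n)%C) N * d)%C
     = (RtoC 1 - (q * z) ^ N)%C).
  { induction N; [simpl; ring|].
    simpl csum. rewrite Cmult_plus_distr_r, IHN, Cpow_S, <- Cpow_mult_l. unfold d. ring. }
  set (E := ev (fun n => (q ^ n)%C) z).
  assert (H0 : (E * d - RtoC 1)%C = RtoC 0).
  { apply Cmod_eq_0. apply Rle_antisym; [|apply Cmod_ge_0].
    apply (le_epsilon_mult _ _ (Cmod d + 1)). intros e He.
    destruct (ev_unif_limit _ (geo_pow q Hq) e He) as [N1 HN1].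
    destruct (pow_small (Cmod q) e) as [N2 HN2]; auto.
    { split; [apply Cmod_ge_0|auto]. }
    specialize (HN1 (N1 + N2)%nat z ltac:(lia) Hz). specialize (HN2 (N1 + N2)%nat ltac:(lia)).
    specialize (Hs (N1 + N2)%nat). fold E in HN1.
    set (S := csum _ _) in *.
    replace (E * d - RtoC 1)%C with
      ((E - S) * d + - (q * z) ^ (N1 + N2))%C.
    - eapply Rle_trans; [apply Cmod_triangle|].
      rewrite Cmod_opp, Cmod_mult, Cmod_pow, Cmod_mult, Rpow_mult_distr.
      assert (0 <= Cmod z ^ (N1 + N2) <= 1).
      { split; [apply pow_le, Cmod_ge_0|]. rewrite <- (pow1 (N1 + N2)).
        apply pow_incr. split; [apply Cmod_ge_0|auto]. }
      assert (0 <= Cmod q ^ (N1 + N2)) by (apply pow_le, Cmod_ge_0).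
      pose proof (Cmod_ge_0 d). nra.
    - replace ((E - S) * d)%C with (E * d - S * d)%C by ring.
      rewrite Hs. ring. }
  replace E with (E * d * / d)%C by (field; auto).
  replace (E * d)%C with (E * d - RtoC 1 + RtoC 1)%C by ring.
  rewrite H0. field. auto.
Qed.

Definition derivn (l : nat) (a : nat -> C) : nat -> C := Nat.iter l deriv a.

Lemma geo_derivn l a : geo a -> geo (derivn l a).
Proof. intros H. induction l; simpl; auto. now apply geo_deriv. Qed.

Lemma derivn_ext l a b : (forall n, a n = b n) -> forall n, derivn l a n = derivn l b n.
Proof. intros H. induction l; simpl; auto. now apply deriv_ext. Qed.

Lemma derivn_S l a n : derivn (S l) a n = derivn l (deriv a) n.
Proof.
  revert n. induction l; intros n; [reflexivity|].
  change (derivn (S (S l)) a n) with (deriv (derivn (S l) a) n).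
  change (derivn (S l) (deriv a) n) with (deriv (derivn l (deriv a)) n).
  apply deriv_ext. auto.
Qed.

Lemma derivn_plus l a b n :
  derivn l (fun n => (a n + b n)%C) n = (derivn l a n + derivn l b n)%C.
Proof.
  revert n. induction l; intros n; [reflexivity|]. simpl.
  unfold deriv at 1. rewrite IHl. unfold deriv. ring.
Qed.

Lemma derivn_scal l c a n :
  derivn l (fun n => (c * a n)%C) n = (c * derivn l a n)%C.
Proof.
  revert n. induction l; intros n; [reflexivity|]. simpl.
  unfold deriv at 1. rewrite IHl. unfold deriv. ring.
Qed.

(** The coefficients of 1 / (1 - q z)^j, as iterated convolutions so that binomial coefficients
    never appear. *)
Fixpoint kpow (q : C) (j : nat) : nat -> C :=
  match j with O => delta | S j => conv (kpow q j) (fun n => (q ^ n)%C) end.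

Lemma geo_kpow q j : Cmod q < 1 -> geo (kpow q j).
Proof.
  intros Hq. induction j; simpl; [apply geo_delta|].
  apply geo_conv; auto. now apply geo_pow.
Qed.

Lemma ev_delta z : Cmod z <= 1 -> ev delta z = RtoC 1.
Proof.
  intros Hz. rewrite (ev_ext delta (fun n => (RtoC 0 ^ n)%C)).
  - rewrite ev_pow; auto.
    + replace (RtoC 1 - RtoC 0 * z)%C with (RtoC 1) by ring. field.
    + rewrite Cmod_0; lra.
  - intros [|n]; simpl; auto. ring.
Qed.

Lemma ev_kpow q j z : Cmod q < 1 -> Cmod z <= 1 ->
  ev (kpow q j) z = ((/ (RtoC 1 - q * z)) ^ j)%C.
Proof.
  intros Hq Hz. induction j.
  - now apply ev_delta.
  - simpl kpow. rewrite ev_conv, IHj, ev_pow; auto.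
    + rewrite Cpow_S. ring.
    + now apply geo_kpow.
    + now apply geo_pow.
Qed.

Lemma deriv_pow q n :
  deriv (fun n => (q ^ n)%C) n = (q * conv (fun n => (q ^ n)%C) (fun n => (q ^ n)%C) n)%C.
Proof.
  unfold deriv, conv.
  rewrite (csum_ext _ (fun _ => (q ^ n)%C)).
  - rewrite csum_const, Cpow_S. ring.
  - intros k Hk. rewrite <- Cpow_add_r. f_equal. lia.
Qed.

Lemma deriv_kpow q j : Cmod q < 1 -> forall n,
  deriv (kpow q j) n = (RtoC (INR j) * q * kpow q (S j) n)%C.
Proof.
  intros Hq. pose proof (geo_pow q Hq) as Hg. induction j; intros n.
  - simpl INR. unfold deriv; simpl. ring.
  - revert n. apply identity_theorem.
    + apply geo_deriv, geo_kpow, Hq.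
    + apply geo_scal, geo_kpow, Hq.
    + intros t. assert (Hz : Cmod (cis (2 * PI * t)) <= 1) by (rewrite Cmod_cis; lra).
      set (z := cis (2 * PI * t)) in *.
      pose proof (geo_kpow q j Hq) as Hj.
      rewrite ev_scal, ev_kpow by (auto; now apply geo_kpow).
      change (kpow q (S j)) with (conv (kpow q j) (fun n => (q ^ n)%C)).
      rewrite (ev_ext _ _ z (deriv_conv _ _)), ev_plus, !ev_conv, (ev_ext _ _ z IHj), (ev_ext _ _ z (deriv_pow q)),
       !ev_scal, ev_conv, !ev_kpow, ev_pow;
       auto using geo_conv, geo_deriv, geo_kpow.
      rewrite !Cpow_S, S_INR, RtoC_plus; ring.
Qed.

Lemma derivn_kernel q l n : Cmod q < 1 ->
  derivn l (fun n => (q ^ n)%C) n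
  = (RtoC (INR (fact l)) * q ^ l * kpow q (S l) n)%C.
Proof.
  intros Hq. revert n. induction l; intros n.
  - simpl derivn. simpl kpow.
    rewrite (identity_theorem (fun n => (q ^ n)%C) (conv delta (fun n => (q ^ n)%C))); simpl.
    + ring.
    + now apply geo_pow.
    + apply geo_conv; [apply geo_delta|now apply geo_pow].
    + intros t. assert (Hz : Cmod (cis (2 * PI * t)) <= 1) by (rewrite Cmod_cis; lra).
      rewrite ev_conv, ev_delta; auto.
      * ring.
      * apply geo_delta.
      * now apply geo_pow.
  - change (derivn (S l) ?a n) with (deriv (derivn l a) n).
    rewrite (deriv_ext _ _ IHl). unfold deriv at 1.
    replace (RtoC (INR (S n)) * (RtoC (INR (fact l)) * q ^ l * kpow q (S l) (S n)))%C
      with (RtoC (INR (fact l)) * q ^ l * deriv (kpow q (S l)) n)%C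
      by (unfold deriv; ring).
    rewrite deriv_kpow by auto.
    rewrite fact_simpl, mult_INR, RtoC_mult, Cpow_S. ring.
Qed.

Lemma ev_derivn_kernel q l z : Cmod q < 1 -> Cmod z <= 1 ->
  ev (derivn l (fun n => (q ^ n)%C)) z
  = (RtoC (INR (fact l)) * q ^ l *
        (/ (RtoC 1 - q * z)) ^ (S l))%C.
Proof.
  intros Hq Hz. rewrite (ev_ext _ _ z (fun n => derivn_kernel q l n Hq)).
  rewrite ev_scal, ev_kpow; auto. now apply geo_kpow.
Qed.

(** * Exponentials of power series *)

(** Course-of-values recursion: the coefficient n + 1 needs all earlier ones, so [exp_pre g n] is a
    whole sequence, final at the indices up to n. *)
Fixpoint exp_pre (g : nat -> C) (n : nat) : nat -> C :=
  match n with
  | O => fun _ => RtoC 1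
  | S n => let p := exp_pre g n in fun k =>
      if Nat.leb k n then p k
      else (RtoC (/ INR (S n)) * csum (fun j => (g j * (p (n - j)%nat))%C) (S n))%C
  end.

(* [pexp g] is the solution of [f' = g f], [f 0 = 1]. *)
Definition pexp (g : nat -> C) (n : nat) : C := exp_pre g n n.

Lemma exp_pre_stable g n k : (k <= n)%nat -> exp_pre g n k = pexp g k.
Proof.
  induction n; intros H.
  - replace k with O by lia. reflexivity.
  - destruct (Nat.eq_dec k (S n)) as [->|Hne]; [reflexivity|].
    simpl. destruct (Nat.leb_spec k n); [apply IHn; lia|lia].
Qed.

Lemma deriv_pexp g n : deriv (pexp g) n = conv g (pexp g) n.
Proof.
  unfold deriv, conv. unfold pexp at 1. cbn [exp_pre]. cbv zeta.
  destruct (Nat.leb_spec (S n) n); [lia|].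
  rewrite (csum_ext (fun j => (g j * (exp_pre g n (n - j)%nat))%C)
    (fun k => (g k * (pexp g (n - k)%nat))%C)).
  - rewrite Cmult_assoc, <- RtoC_mult, Rinv_r; [ring|]. apply not_0_INR; lia.
  - intros k Hk. rewrite exp_pre_stable by lia. reflexivity.
Qed.

Lemma pexp_0 g : pexp g O = RtoC 1.
Proof. reflexivity. Qed.

Lemma pexp_rec g n : pexp g (S n) =
  (RtoC (/ INR (S n)) * conv g (pexp g) n)%C.
Proof.
  rewrite <- deriv_pexp. unfold deriv.
  rewrite Cmult_assoc, <- RtoC_mult, Rinv_l; [ring|]. apply not_0_INR; lia.
Qed.

Lemma finite_geo_bound (f : nat -> C) r n0 : 0 < r ->
  exists B, 0 < B /\ forall k, (k <= n0)%nat -> Cmod (f k) <= B * r ^ k.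
Proof.
  intros Hr. induction n0.
  - exists (Cmod (f O) + 1). pose proof (Cmod_ge_0 (f O)). split; [lra|].
    intros k Hk. replace k with O by lia. simpl. lra.
  - destruct IHn0 as (B & HB & H). pose proof (Cmod_ge_0 (f (S n0))).
    assert (Hp : 0 < r ^ S n0) by (apply pow_lt; auto).
    assert (Hq : 0 <= Cmod (f (S n0)) / r ^ S n0) by (apply Rdiv_le_0_compat; auto).
    exists (B + Cmod (f (S n0)) / r ^ S n0). split; [lra|].
    intros k Hk. destruct (Nat.eq_dec k (S n0)) as [->|Hne].
    + rewrite Rmult_plus_distr_r. unfold Rdiv. rewrite Rmult_assoc, Rinv_l by lra.
      assert (0 < B * r ^ S n0) by (apply Rmult_lt_0_compat; auto). lra.
    + eapply Rle_trans; [apply H; lia|]. apply Rmult_le_compat_r; [|lra].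
      apply pow_le; lra.
Qed.

(** Strong induction along the recursion: convolution with g costs a factor A = M / (r' - r), and
    the division by the index pays for it as soon as the index exceeds A. The finitely many earlier
    coefficients are absorbed in B. *)
Lemma geo_pexp g : geo g -> geo (pexp g).
Proof.
  intros Hg. destruct (geo_pos g Hg) as (M & r & HM & Hr & H).
  set (r' := (1 + r) / 2). assert (Hr' : r < r' < 1) by (unfold r'; lra).
  set (A := M / (r' - r)).
  destruct (INR_unbounded A) as [n0 Hn0].
  destruct (finite_geo_bound (pexp g) r' n0) as (B & HB & Hfin); [lra|].
  exists B, r'. split; [lra|].
  intros n. induction n as [n IH] using Wf_nat.lt_wf_ind.
  destruct (Nat.le_gt_cases n n0) as [Hle|Hgt]; [now apply Hfin|].
  destruct n as [|n]; [lia|].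
  rewrite pexp_rec, Cmod_mult, Cmod_R.
  assert (Hn1 : 0 < INR (S n)) by (apply lt_0_INR; lia).
  rewrite Rabs_pos_eq by (apply Rlt_le, Rinv_0_lt_compat; auto).
  apply Rmult_le_reg_l with (INR (S n)); auto.
  rewrite <- Rmult_assoc, Rinv_r, Rmult_1_l by lra.
  set (q := r / r').
  assert (Hq : 0 < q < 1).
  { unfold q. split; [apply Rdiv_lt_0_compat; lra|].
    apply Rmult_lt_reg_r with r'; [lra|]. unfold Rdiv. rewrite Rmult_assoc, Rinv_l; lra. }
  apply Rle_trans with (rsum (fun j => (M * B * r' ^ n) * q ^ j) (S n)).
  - unfold conv. eapply Rle_trans; [apply Cmod_csum|]. apply rsum_le. intros k Hk.
    rewrite Cmod_mult.
    replace (M * B * r' ^ n * q ^ k) with ((M * r ^ k) * (B * r' ^ (n - k))).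
    + apply Rmult_le_compat; try apply Cmod_ge_0; auto. apply IH. lia.
    + replace r with (q * r') by (unfold q; field; lra). rewrite Rpow_mult_distr.
      replace n with (k + (n - k))%nat at 2 by lia. rewrite pow_add. ring.
  - rewrite rsum_scal, rsum_geom by lra.
    assert (Hqn : 0 < q ^ S n) by (apply pow_lt; lra).
    assert (Hs : (1 - q ^ S n) / (1 - q) <= / (1 - q)).
    { unfold Rdiv. rewrite <- (Rmult_1_l (/ (1 - q))) at 2. apply Rmult_le_compat_r; [|lra].
      apply Rlt_le, Rinv_0_lt_compat; lra. }
    assert (Hrn : 0 < r' ^ n) by (apply pow_lt; lra).
    assert (HMB : 0 < M * B * r' ^ n) by (apply Rmult_lt_0_compat; [apply Rmult_lt_0_compat|]; auto).
    eapply Rle_trans; [apply Rmult_le_compat_l; [lra|apply Hs]|].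
    replace (M * B * r' ^ n * / (1 - q)) with (A * (B * r' ^ S n))
      by (unfold A, q; simpl; field; lra).
    apply Rmult_le_compat_r.
    + apply Rmult_le_pos; [lra|]. apply pow_le; lra.
    + assert (INR n0 <= INR (S n)) by (apply le_INR; lia). lra.
Qed.

Lemma geo_CV_radius (a : nat -> R) M q : 0 < q < 1 ->
  (forall n, Rabs (a n) <= M * q ^ n) -> forall x, 0 <= x <= 1 ->
  Rbar_lt (Rabs x) (CV_radius a).
Proof.
  intros Hq H x Hx.
  set (y := 2 / (1 + q)). assert (Hy : 1 < y).
  { unfold y. apply Rmult_lt_reg_r with (1 + q); [lra|].
    unfold Rdiv. rewrite Rmult_assoc, Rinv_l; lra. }
  assert (Hyq : y * q < 1).
  { unfold y. apply Rmult_lt_reg_r with (1 + q); [lra|]. field_simplify; lra. }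
  apply Rbar_lt_le_trans with (Finite y).
  - simpl. rewrite Rabs_pos_eq; lra.
  - apply (proj1 (Lub.Lub_Rbar_correct (CV_disk a))). unfold CV_disk.
    apply (real_series_tail (fun n => a n * y ^ n) M (y * q) O).
    + split; [|auto]. apply Rmult_lt_0_compat; lra.
    + intros n. rewrite Rabs_mult, (Rabs_pos_eq (y ^ n)) by (apply pow_le; lra).
      rewrite Rpow_mult_distr. replace (M * (y ^ n * q ^ n)) with (M * q ^ n * y ^ n) by ring.
      apply Rmult_le_compat_r; auto. apply pow_le; lra.
Qed.

Lemma ev_radial a z r :
  ev a (RtoC r * z)%C = (PSeries (fun n => Re (a n * z ^ n)%C) r,
                             PSeries (fun n => Im (a n * z ^ n)%C) r).
Proof.
  unfold ev, PSeries. f_equal; apply Series_ext; intros n;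
    rewrite Cpow_mult_l, <- RtoC_pow; unfold Re, Im; simpl; ring.
Qed.

(** Along a radius the real and the imaginary part are real power series in r, so that
    differentiation is that of [PSeries]. *)
Lemma ev_radial_derive a z r : geo a -> Cmod z <= 1 -> 0 <= r <= 1 ->
  is_derive (fun r => Re (ev a (RtoC r * z)%C)) r
    (Re (z * ev (deriv a) (RtoC r * z)%C)%C) /\
  is_derive (fun r => Im (ev a (RtoC r * z)%C)) r
    (Im (z * ev (deriv a) (RtoC r * z)%C)%C).
Proof.
  intros Ha Hz Hr. destruct (geo_pos a Ha) as (M & q & HM & Hq & H).
  assert (Hrz : Cmod (RtoC r * z)%C <= 1).
  { rewrite Cmod_mult, Cmod_R, Rabs_pos_eq by lra. pose proof (Cmod_ge_0 z). nra. }
  assert (He : (z * ev (deriv a) (RtoC r * z)%C)%C =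
    ev (fun n => (z * deriv a n)%C) (RtoC r * z)%C).
  { rewrite ev_scal; auto. now apply geo_deriv. }
  rewrite He, (ev_radial (fun n => (z * deriv a n)%C)). clear He.
  assert (HR : forall n, Rabs (Re (a n * z ^ n)%C) <= M * q ^ n).
  { intros n. eapply Rle_trans; [apply re_le_Cmod|]. now apply term_bound. }
  assert (HI : forall n, Rabs (Im (a n * z ^ n)%C) <= M * q ^ n).
  { intros n. eapply Rle_trans; [apply im_le_Cmod|]. now apply term_bound. }
  split.
  - match goal with |- is_derive ?f r (Re (?x, _)) => change (is_derive f r x) end.
    apply (is_derive_ext (PSeries (fun n => Re (a n * z ^ n)%C))).
    { intros t. now rewrite ev_radial. }
    replace (PSeries (fun n => Re (z * deriv a n * z ^ n)%C) r)
      with (PSeries (PS_derive (fun n => Re (a n * z ^ n)%C)) r).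
    + apply is_derive_PSeries. now apply (geo_CV_radius _ M q).
    + apply PSeries_ext. intros n. unfold PS_derive, deriv.
      rewrite <- re_scal_l. f_equal. rewrite Cpow_S. ring.
  - match goal with |- is_derive ?f r (Im (_, ?x)) => change (is_derive f r x) end.
    apply (is_derive_ext (PSeries (fun n => Im (a n * z ^ n)%C))).
    { intros t. now rewrite ev_radial. }
    replace (PSeries (fun n => Im (z * deriv a n * z ^ n)%C) r)
      with (PSeries (PS_derive (fun n => Im (a n * z ^ n)%C)) r).
    + apply is_derive_PSeries. now apply (geo_CV_radius _ M q).
    + apply PSeries_ext. intros n. unfold PS_derive, deriv.
      rewrite Cpow_S. unfold Im; simpl; ring.
Qed.

Lemma ev_0 a : geo a -> ev a (RtoC 0) = a O.
Proof.
  intros Ha.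
  assert (H0 : Cmod (RtoC 0) <= 1) by (rewrite Cmod_0; lra).
  destruct (geo_series a (RtoC 0) Ha H0) as [H1 H2].
  apply Cplx_eq.
  - change (Series (fun n => Re (a n * RtoC 0 ^ n)%C) = Re (a O)).
    rewrite Series_incr_1 by (now apply ex_series_Rabs).
    rewrite (Series_ext _ (fun _ => 0 * 0)), Series_scal_l.
    + unfold Re; simpl; ring.
    + intros n. rewrite Cpow_S. unfold Re; simpl; ring.
  - change (Series (fun n => Im (a n * RtoC 0 ^ n)%C) = Im (a O)).
    rewrite Series_incr_1 by (now apply ex_series_Rabs).
    rewrite (Series_ext _ (fun _ => 0 * 0)), Series_scal_l.
    + unfold Im; simpl; ring.
    + intros n. rewrite Cpow_S. unfold Im; simpl; ring.
Qed.

(* The square modulus divided by [exp (2 Re v)] has zero radial derivative. *)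
Lemma Cmod_pexp v z : geo v -> Cmod z <= 1 ->
  Cmod (ev (pexp (deriv v)) z) = exp (Re (ev v z) - Re (v O)).
Proof.
  intros Hv Hz.
  pose proof (geo_deriv v Hv) as Hg. pose proof (geo_pexp _ Hg) as Hf.
  set (f := pexp (deriv v)) in *.
  set (phi := fun r => (Re (ev f (RtoC r * z)%C) * Re (ev f (RtoC r * z)%C)
    + Im (ev f (RtoC r * z)%C) * Im (ev f (RtoC r * z)%C))
    * exp (- (2 * Re (ev v (RtoC r * z)%C)))).
  assert (Hd : forall r, 0 <= r <= 1 -> is_derive phi r 0).
  { intros r Hr.
    assert (Hrz : Cmod (RtoC r * z)%C <= 1).
    { rewrite Cmod_mult, Cmod_R, Rabs_pos_eq by lra. pose proof (Cmod_ge_0 z). nra. }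
    destruct (ev_radial_derive f z r Hf Hz Hr) as [D1 D2].
    destruct (ev_radial_derive v z r Hv Hz Hr) as [D3 _].
    assert (He : ev (deriv f) (RtoC r * z)%C
      = (ev (deriv v) (RtoC r * z)%C * ev f (RtoC r * z)%C)%C).
    { rewrite <- ev_conv by auto. apply ev_ext, deriv_pexp. }
    rewrite He in D1, D2.
    unfold phi.
    set (X := fun r => Re (ev f (RtoC r * z)%C)) in *.
    set (Y := fun r => Im (ev f (RtoC r * z)%C)) in *.
    set (P := fun r => Re (ev v (RtoC r * z)%C)) in *.
    rewrite Cmult_assoc, re_mult in D1. rewrite Cmult_assoc, im_mult in D2.
    set (G := (z * ev (deriv v) (RtoC r * z)%C)%C) in *.
    change (Re (ev f (RtoC r * z)%C)) with (X r) in D1, D2.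
    change (Im (ev f (RtoC r * z)%C)) with (Y r) in D1, D2.
    change (is_derive (fun r => (X r * X r + Y r * Y r) * exp (- (2 * P r))) r 0).
    evar_last.
    - apply (is_derive_mult (fun r => X r * X r + Y r * Y r) (fun r => exp (- (2 * P r)))).
      + apply (is_derive_plus (fun r => X r * X r) (fun r => Y r * Y r)).
        * apply (is_derive_mult X X); eauto. intros; apply Rmult_comm.
        * apply (is_derive_mult Y Y); eauto. intros; apply Rmult_comm.
      + apply (is_derive_comp exp (fun r => - (2 * P r))).
        * apply is_derive_exp.
        * apply (is_derive_opp (fun r => 2 * P r)). apply is_derive_scal. exact D3.
      + intros; apply Rmult_comm.
    - unfold plus, mult, scal, opp; simpl. unfold mult; simpl. ring. }
  assert (Hc : phi 0 = phi 1).
  { apply (eq_is_derive phi 0 1); [|lra]. intros t Ht. now apply Hd. }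
  unfold phi in Hc.
  replace (RtoC 0 * z)%C with (RtoC 0) in Hc by ring.
  replace (RtoC 1 * z)%C with z in Hc by ring.
  rewrite !ev_0 in Hc by auto.
  change (f O) with (RtoC 1) in Hc. change (Re (RtoC 1)) with 1 in Hc. change (Im (RtoC 1)) with 0 in Hc.
  assert (Hsq : Cmod (ev f z) ^ 2 = exp (Re (ev v z) - Re (v O)) ^ 2).
  { rewrite Cmod2_alt.
    replace (exp (Re (ev v z) - Re (v O)) ^ 2) with (exp (- (2 * Re (v O))) * exp (2 * Re (ev v z))).
    - replace (exp (- (2 * Re (v O)))) with
        ((Re (ev f z) * Re (ev f z) + Im (ev f z) * Im (ev f z)) * exp (- (2 * Re (ev v z)))) by lra.
      rewrite Rmult_assoc, <- exp_plus.
      replace (- (2 * Re (ev v z)) + 2 * Re (ev v z)) with 0 by ring. rewrite exp_0. ring.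
    - rewrite <- exp_plus. simpl. rewrite Rmult_1_r, <- exp_plus. f_equal. ring. }
  apply Rsqr_inj.
  - apply Cmod_ge_0.
  - apply Rlt_le, exp_pos.
  - rewrite !Rsqr_pow2. exact Hsq.
Qed.

(** [pexp (deriv v)] is exp(v - v(0)). The product with the exponential of the opposite has
    derivative 0, read off from its values on the circle, and constant term 1. *)
Lemma pexp_inverse v : geo v -> forall n,
  conv (pexp (deriv v)) (pexp (deriv (fun n => (RtoC (-1) * v n)%C))) n = delta n.
Proof.
  intros Hv. set (v' := fun n => (RtoC (-1) * v n)%C).
  assert (Hv' : geo v') by now apply geo_scal.
  pose proof (geo_deriv _ Hv) as Hg. pose proof (geo_pexp _ Hg) as Hf.
  pose proof (geo_deriv _ Hv') as Hg'. pose proof (geo_pexp _ Hg') as Hf'.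
  assert (H0 : forall n, deriv (conv (pexp (deriv v)) (pexp (deriv v'))) n = RtoC 0).
  { apply identity_zero; [now apply geo_deriv, geo_conv|].
    intros t. set (z := cis (2 * PI * t)).
    assert (Hz : Cmod z <= 1) by (unfold z; rewrite Cmod_cis; lra).
    rewrite (ev_ext _ _ z (deriv_conv _ _)), ev_plus, !ev_conv,
      !(ev_ext _ _ z (deriv_pexp _)), !ev_conv; auto using geo_conv, geo_deriv.
    assert (He : ev (deriv v') z = (RtoC (-1) * ev (deriv v) z)%C).
    { rewrite <- ev_scal by auto. apply ev_ext. intros n. unfold v', deriv. ring. }
    rewrite He. replace (-1) with (- (1)) by ring. rewrite RtoC_opp. ring. }
  intros [|n].
  - unfold conv. cbn [csum Nat.sub]. rewrite !pexp_0. unfold delta. ring.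
  - specialize (H0 n). unfold deriv at 1 in H0. simpl delta.
    set (x := conv _ _ _) in *.
    replace x with (RtoC (/ INR (S n)) * (RtoC (INR (S n)) * x))%C.
    + rewrite H0. ring.
    + rewrite Cmult_assoc, <- RtoC_mult, Rinv_l; [ring|]. apply not_0_INR; lia.
Qed.

(** * Derivative bounds for products and exponentials *)

(** Leibniz's rule at a single point with a common scale y: each derivative falls on one of the two
    factors and costs y there, and the 2^l terms are equal in size. *)
Lemma derivn_conv_bound l : forall a b z y A B, geo a -> geo b -> Cmod z <= 1 ->
  0 <= y -> 0 <= A -> 0 <= B ->
  (forall i, (i <= l)%nat -> Cmod (ev (derivn i a) z) <= A * y ^ i) ->
  (forall i, (i <= l)%nat -> Cmod (ev (derivn i b) z) <= B * y ^ i) ->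
  Cmod (ev (derivn l (conv a b)) z) <= 2 ^ l * A * B * y ^ l.
Proof.
  induction l; intros a b z y A B Ha Hb Hz Hy HA HB H1 H2.
  - simpl derivn. rewrite ev_conv, Cmod_mult by auto.
    specialize (H1 O (le_n _)). specialize (H2 O (le_n _)). simpl in *.
    rewrite Rmult_1_r in H1, H2.
    apply Rle_trans with (A * B); [|lra].
    apply Rmult_le_compat; auto; apply Cmod_ge_0.
  - rewrite (ev_ext _ _ z (derivn_S l (conv a b))).
    rewrite (ev_ext _ _ z (derivn_ext l _ _ (deriv_conv a b))).
    rewrite (ev_ext _ _ z (derivn_plus l _ _)).
    rewrite ev_plus; auto using geo_derivn, geo_conv, geo_deriv.
    eapply Rle_trans; [apply Cmod_triangle|].
    pose proof (IHl (deriv a) b z y (A * y) B) as I1.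
    pose proof (IHl a (deriv b) z y A (B * y)) as I2.
    assert (0 <= A * y) by (apply Rmult_le_pos; auto).
    assert (0 <= B * y) by (apply Rmult_le_pos; auto).
    assert (I1' : Cmod (ev (derivn l (conv (deriv a) b)) z) <= 2 ^ l * (A * y) * B * y ^ l).
    { apply I1; auto using geo_deriv.
      intros i Hi. rewrite <- (ev_ext _ _ z (derivn_S i a)).
      eapply Rle_trans; [apply H1; lia|]. simpl. lra. }
    assert (I2' : Cmod (ev (derivn l (conv a (deriv b))) z) <= 2 ^ l * A * (B * y) * y ^ l).
    { apply I2; auto using geo_deriv.
      intros i Hi. rewrite <- (ev_ext _ _ z (derivn_S i b)).
      eapply Rle_trans; [apply H2; lia|]. simpl. lra. }
    simpl. lra.
Qed.

(** Mirrors f' = v' f: one more derivative costs the 2^i of Leibniz's rule, the factorial in the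
    bound on v and the previous constant. [Rmax] makes the sequence nondecreasing, so that the
    constant of order i serves all lower orders. *)
Fixpoint pexp_const (i : nat) : R :=
  match i with
  | O => 1
  | S i => Rmax (pexp_const i) (2 ^ i * INR (fact (S i)) * pexp_const i)
  end.

Lemma pexp_const_pos i : 1 <= pexp_const i.
Proof.
  induction i; simpl; [lra|]. eapply Rle_trans; [apply IHi|apply Rmax_l].
Qed.

(** The factor |f(z)| on the right is the point of the estimate: near the Cantor set y is large, but
    |f(z)| is exponentially small. *)
Lemma derivn_pexp_bound v z y : geo v -> Cmod z <= 1 -> 0 <= y ->
  (forall i, Cmod (ev (derivn (S i) v) z) <= INR (fact (S i)) * y ^ S i) ->
  forall i, Cmod (ev (derivn i (pexp (deriv v))) z)
    <= pexp_const i * y ^ i * Cmod (ev (pexp (deriv v)) z).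
Proof.
  intros Hv Hz Hy H. set (f := pexp (deriv v)).
  pose proof (geo_deriv v Hv) as Hg. pose proof (geo_pexp _ Hg) as Hf. fold f in Hf.
  set (X := Cmod (ev f z)). assert (HX : 0 <= X) by apply Cmod_ge_0.
  enough (Hs : forall i l, (l <= i)%nat ->
    Cmod (ev (derivn l f) z) <= pexp_const i * y ^ l * X) by (intros i; now apply Hs).
  induction i; intros l Hl.
  - replace l with O by lia. simpl. unfold X. lra.
  - destruct (Nat.eq_dec l (S i)) as [->|Hne].
    + rewrite (ev_ext _ _ z (derivn_S i f)).
      unfold f at 1. rewrite (ev_ext _ _ z (derivn_ext i _ _ (deriv_pexp (deriv v)))). fold f.
      pose proof (pexp_const_pos i) as Hc.
      assert (HF : 0 <= INR (fact (S i))) by apply pos_INR.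
      apply Rle_trans with (2 ^ i * (INR (fact (S i)) * y) * (pexp_const i * X) * y ^ i).
      * apply derivn_conv_bound; auto.
        -- apply Rmult_le_pos; auto.
        -- apply Rmult_le_pos; lra.
        -- intros j Hj. rewrite <- (ev_ext _ _ z (derivn_S j v)).
           eapply Rle_trans; [apply H|]. simpl (y ^ S j).
           rewrite <- Rmult_assoc. apply Rmult_le_compat_r; [now apply pow_le|].
           apply Rmult_le_compat_r; auto. apply le_INR, fact_le. lia.
        -- intros j Hj. eapply Rle_trans; [apply IHi; auto|]. lra.
      * simpl pexp_const. simpl (y ^ S i).
        replace (2 ^ i * (INR (fact (S i)) * y) * (pexp_const i * X) * y ^ i)
          with (2 ^ i * INR (fact (S i)) * pexp_const i * (y * y ^ i * X)) by ring.
        rewrite (Rmult_assoc (Rmax _ _)). apply Rmult_le_compat_r.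
        -- apply Rmult_le_pos; auto. apply Rmult_le_pos; auto. now apply pow_le.
        -- apply Rmax_r.
    + eapply Rle_trans; [apply IHi; lia|].
      rewrite (Rmult_assoc (pexp_const i)), (Rmult_assoc (pexp_const (S i))).
      apply Rmult_le_compat_r.
      * apply Rmult_le_pos; auto. now apply pow_le.
      * apply Rmax_l.
Qed.

(** * The Cantor construction *)

Fixpoint lsum {A : Type} (f : A -> R) (l : list A) : R :=
  match l with nil => 0 | x :: l => f x + lsum f l end.

Lemma lsum_app {A} (f : A -> R) l l' : lsum f (l ++ l') = lsum f l + lsum f l'.
Proof. induction l; simpl; [lra|]. rewrite IHl; lra. Qed.

Lemma lsum_map {A B} (f : B -> R) (g : A -> B) l : lsum f (map g l) = lsum (fun x => f (g x)) l.
Proof. induction l; simpl; auto. now rewrite IHl. Qed.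

Lemma lsum_le {A} (f g : A -> R) l : (forall x, In x l -> f x <= g x) -> lsum f l <= lsum g l.
Proof.
  induction l; simpl; intros H; [lra|]. apply Rplus_le_compat; auto.
Qed.

Lemma lsum_ext {A} (f g : A -> R) l : (forall x, In x l -> f x = g x) -> lsum f l = lsum g l.
Proof. induction l; simpl; intros H; auto. rewrite H, IHl; auto. Qed.

Lemma lsum_scal {A} c (f : A -> R) l : lsum (fun x => c * f x) l = c * lsum f l.
Proof. induction l; simpl; [lra|]. rewrite IHl; lra. Qed.

Lemma lsum_plus {A} (f g : A -> R) l : lsum (fun x => f x + g x) l = lsum f l + lsum g l.
Proof. induction l; simpl; [lra|]. rewrite IHl; lra. Qed.

Lemma lsum_const {A} c (l : list A) : lsum (fun _ => c) l = INR (length l) * c.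
Proof. induction l; simpl lsum; [simpl; lra|]. simpl length. rewrite IHl, S_INR; lra. Qed.

Lemma lsum_member {A} (f : A -> R) l x : (forall y, In y l -> 0 <= f y) -> In x l -> f x <= lsum f l.
Proof.
  intros Hp Hin. induction l as [|a l IH]; [easy|]. simpl.
  assert (0 <= lsum f l).
  { replace 0 with (lsum (fun _ : A => 0) l) by (rewrite lsum_const; ring).
    apply lsum_le. intros; apply Hp; now right. }
  assert (0 <= f a) by (apply Hp; now left).
  destruct Hin as [->|Hin]; [lra|].
  assert (f x <= lsum f l) by (apply IH; auto; intros; apply Hp; now right). lra.
Qed.

(** Left end points of the 2^k intervals of length xi^k, as angles divided by 2 pi. The recursion
    prepends a digit rather than appending one, which exhibits the self-similarity. *)
Fixpoint endpoints (xi : R) (k : nat) : list R :=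
  match k with
  | O => 0 :: nil
  | S k => map (fun th => xi * th) (endpoints xi k)
           ++ map (fun th => 1 - xi + xi * th) (endpoints xi k)
  end.

Definition digits (eps : nat -> R) : Prop := forall n, eps n = 0 \/ eps n = 1.

Definition digit_sum (xi : R) (eps : nat -> R) : R :=
  (1 - xi) * Series (fun n => eps n * xi ^ n).

Lemma ex_digit_series xi eps : 0 < xi < 1 -> digits eps -> ex_series (fun n => eps n * xi ^ n).
Proof.
  intros Hxi H. apply (real_series_tail _ 1 xi O Hxi).
  intros n. assert (0 < xi ^ n) by (apply pow_lt; lra).
  rewrite Rabs_mult, (Rabs_pos_eq (xi ^ n)) by lra.
  apply Rmult_le_compat_r; [lra|].
  destruct (H n) as [-> | ->]; rewrite Rabs_pos_eq; lra.
Qed.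

Lemma digit_sum_shift xi eps : 0 < xi < 1 -> digits eps ->
  digit_sum xi eps = (1 - xi) * eps O + xi * digit_sum xi (fun n => eps (S n)).
Proof.
  intros Hxi H. unfold digit_sum.
  rewrite Series_incr_1 by (now apply ex_digit_series).
  rewrite (Series_ext (fun k => eps (S k) * xi ^ S k) (fun k => xi * (eps (S k) * xi ^ k))).
  - rewrite Series_scal_l. simpl. ring.
  - intros n. simpl. ring.
Qed.

Lemma digit_sum_range xi eps : 0 < xi < 1 -> digits eps -> 0 <= digit_sum xi eps <= 1.
Proof.
  intros Hxi H. unfold digit_sum.
  assert (Hg : is_series (fun n => xi ^ n) (/ (1 - xi))) by (apply is_series_geom; rewrite Rabs_pos_eq; lra).
  assert (Hb : forall n, 0 <= eps n * xi ^ n <= xi ^ n).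
  { intros n. assert (0 < xi ^ n) by (apply pow_lt; lra). destruct (H n) as [-> | ->]; lra. }
  assert (H0 : 0 <= Series (fun n => eps n * xi ^ n)).
  { replace 0 with (Series (fun n => 0 * xi ^ n)) by (rewrite Series_scal_l; ring).
    apply Series_le; [|now apply ex_digit_series]. intros n. specialize (Hb n). lra. }
  assert (H1 : Series (fun n => eps n * xi ^ n) <= / (1 - xi)).
  { rewrite <- (is_series_unique _ _ Hg). apply Series_le; [auto|eexists; eauto]. }
  split; [apply Rmult_le_pos; lra|].
  apply Rle_trans with ((1 - xi) * / (1 - xi)).
  - apply Rmult_le_compat_l; lra.
  - rewrite Rinv_r; lra.
Qed.

Lemma endpoints_range xi k th : 0 < xi < 1 -> In th (endpoints xi k) -> 0 <= th <= 1.
Proof.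
  intros Hxi. revert th. induction k; simpl; intros th H.
  - destruct H as [<-|[]]. lra.
  - apply in_app_iff in H. destruct H as [H|H]; apply in_map_iff in H;
      destruct H as (t & <- & Ht); apply IHk in Ht; nra.
Qed.

Lemma endpoints_length xi k : INR (length (endpoints xi k)) = 2 ^ k.
Proof.
  induction k; simpl; [lra|]. rewrite length_app, !length_map, plus_INR, IHk. ring.
Qed.

Lemma endpoints_approx xi k : forall eps, 0 < xi < 1 -> digits eps ->
  exists th, In th (endpoints xi k) /\ 0 <= digit_sum xi eps - th <= xi ^ k.
Proof.
  induction k; intros eps Hxi H.
  - exists 0. split; [now left|]. pose proof (digit_sum_range xi eps Hxi H). simpl. lra.
  - destruct (IHk (fun n => eps (S n)) Hxi (fun n => H (S n))) as (th & Hin & Hb).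
    rewrite (digit_sum_shift xi eps Hxi H).
    set (s := digit_sum xi (fun n => eps (S n))) in *.
    assert (Hb' : 0 <= xi * (s - th) <= xi ^ S k).
    { simpl. split; [apply Rmult_le_pos; lra|apply Rmult_le_compat_l; lra]. }
    destruct (H O) as [E|E]; rewrite E.
    + exists (xi * th). split; [|lra]. simpl. apply in_app_iff. left. now apply (in_map (fun th => xi * th)).
    + exists (1 - xi + xi * th). split; [|lra]. simpl. apply in_app_iff. right.
      now apply (in_map (fun th => 1 - xi + xi * th)).
Qed.

(** The digits are continued by zeros. As the end points belong to the set, a point far from the set
    is far from the end points of every step. *)
Lemma endpoints_digits xi k : forall th, 0 < xi < 1 -> In th (endpoints xi k) ->
  exists eps, digits eps /\ digit_sum xi eps = th.
Proof.
  induction k; intros th Hxi Hin.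
  - destruct Hin as [<-|[]]. exists (fun _ => 0). split; [now left|].
    unfold digit_sum. rewrite Series_scal_l. ring.
  - simpl in Hin. apply in_app_iff in Hin.
    destruct Hin as [H|H]; apply in_map_iff in H; destruct H as (t & <- & Ht);
      destruct (IHk t Hxi Ht) as (eps & He & <-).
    + assert (Hd : digits (fun n => match n with O => 0 | S n => eps n end)).
      { intros [|n]; [now left|apply He]. }
      exists (fun n => match n with O => 0 | S n => eps n end). split; auto.
      rewrite digit_sum_shift by auto.
      change (fun n => eps n) with eps. ring.
    + assert (Hd : digits (fun n => match n with O => 1 | S n => eps n end)).
      { intros [|n]; [now right|apply He]. }
      exists (fun n => match n with O => 1 | S n => eps n end). split; auto.
      rewrite digit_sum_shift by auto.
      change (fun n => eps n) with eps. ring.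
Qed.

(* Self-similarity: after rescaling by [1 / xi] one half of the sum is a sum of the
   previous level, while the other half stays away from [t]. *)
Lemma endpoints_inverse_sum xi : 0 < xi < 1 / 2 -> exists M, 0 < M /\
  forall j k t, (j <= k)%nat ->
    lsum (fun th => / Rmax (Rabs (t - th)) (xi ^ j)) (endpoints xi k)
    <= M * 2 ^ k * (/ (2 * xi)) ^ j.
Proof.
  intros Hxi. set (p := / (2 * xi)). set (c1 := / (1 / 2 - xi)).
  assert (Hp : 1 < p).
  { unfold p. rewrite <- Rinv_1. apply Rinv_lt_contravar; lra. }
  assert (Hp2 : 2 * p = / xi) by (unfold p; field; lra).
  assert (Hc1 : 0 < c1) by (apply Rinv_0_lt_compat; lra).
  set (D := c1 / (2 * (p - 1))).
  assert (HD : 0 < D) by (apply Rdiv_lt_0_compat; lra).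
  exists (1 + D). split; [lra|].
  (* The subtracted D closes the recursion: p ((1 + D) p^j - D) + c1 / 2 = (1 + D) p^(j + 1) - D is
     the equation that determines D, with c1 the contribution of the far half. *)
  enough (Hs : forall j k t, (j <= k)%nat ->
    lsum (fun th => / Rmax (Rabs (t - th)) (xi ^ j)) (endpoints xi k)
    <= 2 ^ k * ((1 + D) * p ^ j - D)).
  { intros j k t Hjk. eapply Rle_trans; [now apply Hs|].
    assert (0 < 2 ^ k) by (apply pow_lt; lra).
    replace ((1 + D) * 2 ^ k * p ^ j) with (2 ^ k * ((1 + D) * p ^ j)) by ring.
    apply Rmult_le_compat_l; lra. }
  induction j; intros k t Hjk.
  - rewrite <- (endpoints_length xi k). simpl (_ ^ 0).
    replace (INR (length (endpoints xi k)) * ((1 + D) * 1 - D))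
      with (lsum (fun _ : R => 1) (endpoints xi k)) by (rewrite lsum_const; ring).
    apply lsum_le. intros th _. rewrite <- Rinv_1 at 2.
    apply Rinv_le_contravar; [lra|apply Rmax_r].
  - destruct k; [lia|]. simpl endpoints. rewrite lsum_app, !lsum_map.
    assert (Hk : 0 < 2 ^ k) by (apply pow_lt; lra).
    assert (Hnear : forall t', lsum (fun x => / Rmax (Rabs (t' - xi * x)) (xi ^ S j)) (endpoints xi k)
      <= 2 ^ k * (2 * (p * ((1 + D) * p ^ j - D)))).
    { intros t'. apply Rle_trans with (/ xi *
        lsum (fun x => / Rmax (Rabs (t' / xi - x)) (xi ^ j)) (endpoints xi k)).
      - rewrite <- lsum_scal. apply lsum_le. intros x _. apply Req_le.
        rewrite <- Rinv_mult. f_equal. simpl.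
        rewrite <- RmaxRmult by lra. f_equal.
        rewrite <- (Rabs_pos_eq xi) at 2 by lra. rewrite <- Rabs_mult. f_equal. field. lra.
      - replace (2 ^ k * (2 * (p * ((1 + D) * p ^ j - D))))
          with (/ xi * (2 ^ k * ((1 + D) * p ^ j - D))) by (rewrite <- Hp2; ring).
        apply Rmult_le_compat_l; [apply Rlt_le, Rinv_0_lt_compat; lra|]. apply IHj. lia. }
    assert (Hfar : forall t', (forall x, In x (endpoints xi k) -> 1 / 2 - xi <= Rabs (t' - xi * x)) ->
      lsum (fun x => / Rmax (Rabs (t' - xi * x)) (xi ^ S j)) (endpoints xi k) <= 2 ^ k * c1).
    { intros t' H. rewrite <- (endpoints_length xi k), <- lsum_const.
      apply lsum_le. intros x Hx. apply Rinv_le_contravar; [lra|].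
      eapply Rle_trans; [exact (H x Hx)|apply Rmax_l]. }
    rewrite (lsum_ext (fun x => / Rmax (Rabs (t - (1 - xi + xi * x))) (xi ^ S j))
       (fun x => / Rmax (Rabs ((t - (1 - xi)) - xi * x)) (xi ^ S j))).
    2:{ intros x _. do 3 f_equal. ring. }
    replace (2 ^ S k * ((1 + D) * p ^ S j - D))
      with (2 ^ k * (2 * (p * ((1 + D) * p ^ j - D))) + 2 ^ k * c1).
    2:{ replace c1 with (2 * (p - 1) * D) by (unfold D; field; lra). simpl. ring. }
    destruct (Rle_dec t (1 / 2)) as [Ht|Ht].
    + apply Rplus_le_compat; [apply Hnear|]. apply Hfar.
      intros x Hx. apply endpoints_range in Hx; [|lra].
      rewrite Rabs_left1; nra.
    + rewrite Rplus_comm. apply Rplus_le_compat; [apply Hnear|]. apply Hfar.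
      intros x Hx. apply endpoints_range in Hx; [|lra].
      rewrite Rabs_right; nra.
Qed.

(** * Chords of the unit circle *)

Lemma Rabs_sin_le x : Rabs (sin x) <= Rabs x.
Proof.
  assert (H : forall y, 0 <= y -> Rabs (sin y) <= y).
  { intros y Hy. destruct (Rle_dec y 1) as [H1|H1].
    - destruct Hy as [Hy| <-]; [|rewrite sin_0, Rabs_R0; lra].
      pose proof (sin_lt_x y Hy). pose proof PI2_3_2.
      rewrite Rabs_pos_eq; [lra|]. apply sin_ge_0; lra.
    - pose proof (SIN_bound y). apply Rle_trans with 1; [apply Rabs_le; lra|lra]. }
  destruct (Rle_dec 0 x).
  - rewrite (Rabs_pos_eq x) by auto. auto.
  - rewrite (Rabs_left x) by lra. rewrite <- Rabs_Ropp, <- sin_neg. apply H. lra.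
Qed.

Lemma Cmod_sqr_coords a b : Cmod (a, b) ^ 2 = a ^ 2 + b ^ 2.
Proof. rewrite Cmod2_alt. reflexivity. Qed.

Lemma Cmod_affine_cis b r phi :
  Cmod (RtoC b - RtoC r * cis phi)%C ^ 2
  = (b - r) ^ 2 + 4 * b * r * sin (phi / 2) ^ 2.
Proof.
  replace (RtoC b - RtoC r * cis phi)%C with ((b - r * cos phi, - (r * sin phi)) : C)
    by (apply Cplx_eq; simpl; ring).
  rewrite Cmod_sqr_coords.
  replace (cos phi) with (1 - 2 * sin (phi / 2) * sin (phi / 2)).
  - pose proof (sin2_cos2 phi) as H. unfold Rsqr in H.
    assert (Hc : cos phi = 1 - 2 * sin (phi / 2) * sin (phi / 2)).
    { rewrite <- cos_2a_sin. f_equal. field. }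
    rewrite Hc in H. set (x := sin (phi / 2)) in *. set (y := sin phi) in *.
    replace ((- (r * y)) ^ 2) with (r ^ 2 * (y * y)) by ring.
    replace (y * y) with (1 - (1 - 2 * x * x) * (1 - 2 * x * x)) by lra. ring.
  - rewrite <- cos_2a_sin. f_equal. field.
Qed.

Lemma Rle_sqr a b : 0 <= b -> a ^ 2 <= b ^ 2 -> a <= b.
Proof. intros Hb H. apply Rsqr_incr_0_var; auto. rewrite !Rsqr_pow2. exact H. Qed.

Lemma Cmod_cis_minus a b : Cmod (cis a - cis b)%C <= Rabs (a - b).
Proof.
  apply Rle_sqr; [apply Rabs_pos|].
  replace (Cmod (cis a - cis b)%C) with (Cmod (RtoC 1 - RtoC 1 * cis (b - a))%C).
  - rewrite Cmod_affine_cis.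
    replace ((1 - 1) ^ 2 + 4 * 1 * 1 * sin ((b - a) / 2) ^ 2) with ((2 * Rabs (sin ((b - a) / 2))) ^ 2).
    + apply pow_incr. split; [pose proof (Rabs_pos (sin ((b - a) / 2))); lra|].
      pose proof (Rabs_sin_le ((b - a) / 2)) as H.
      unfold Rdiv in H. rewrite (Rabs_mult (b - a)), (Rabs_pos_eq (/ 2)), Rabs_minus_sym in H by lra.
      unfold Rdiv. lra.
    + rewrite Rpow_mult_distr, pow2_abs. ring.
  - assert (H : (cis (- a) * cis a)%C = RtoC 1).
    { rewrite <- cis_plus, Rplus_opp_l. apply cis_0. }
    replace (RtoC 1 - RtoC 1 * cis (b - a))%C
      with (cis (- a) * (cis a - cis b))%C.
    + rewrite Cmod_mult, Cmod_cis. ring.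
    + replace (b - a) with (- a + b) by ring. rewrite cis_plus.
      replace (cis (- a) * (cis a - cis b))%C
        with (cis (- a) * cis a - cis (- a) * cis b)%C by ring.
      rewrite H. ring.
Qed.

Lemma sin_PI_lower y : 0 <= y <= 1 / 2 -> y <= sin (PI * y).
Proof.
  intros Hy. pose proof PI2_3_2. pose proof PI_4. pose proof PI_RGT_0.
  assert (Hu : 0 <= PI * y <= 2) by nra.
  assert (Hu' : 3 * y <= PI * y) by nra.
  set (u := PI * y) in *.
  assert (Hlb : sin_lb u <= sin u) by (apply SIN; unfold u; nra).
  assert (Hs : u / 3 <= sin_lb u).
  { unfold sin_lb, sin_approx. simpl. unfold sin_term. simpl.
    assert (H2 : 0 <= u * u <= 4) by nra.
    set (v := u * u) in *.
    replace (1 * (u * 1 / 1) + -1 * 1 * (u * (u * (u * 1)) / 6))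
      with (u * (1 - v / 6)) by (unfold v; field).
    match goal with |- _ <= ?e => replace e with (u * (1 - v / 6 + v * v / 120 - v * v * v / 5040))
      by (unfold v; field) end.
    unfold Rdiv at 1. apply Rmult_le_compat_l; [lra|].
    assert (0 <= v * v) by nra.
    assert (v * v * v <= 4 * (v * v)) by nra. lra. }
  lra.
Qed.

Definition circ_dist (x : R) (m : R) : R :=
  / Rmax (Rabs x) m + / Rmax (Rabs (x + 1)) m + / Rmax (Rabs (x - 1)) m.

(* The three shifts account for the wrap-around of the angle. *)
Lemma inv_chord_bound b r x m d xi : 1 <= b -> 0 <= r <= 1 -> -1 <= x <= 1 -> 0 < m -> 0 < xi < 1 / 2 ->
  d = Cmod (RtoC b - RtoC r * cis (2 * PI * x))%C ->
  xi * m <= d -> / d <= / xi * circ_dist x m.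
Proof.
  intros Hb Hr Hx Hm Hxi Hd Hmd.
  assert (Hd0 : 0 < d) by (assert (0 < xi * m) by (apply Rmult_lt_0_compat; lra); lra).
  (* For r >= 1 / 4 the angular term of the chord gives this, for smaller r the radial one. *)
  assert (Hsin : Rabs (sin (PI * x)) / 2 <= d).
  { apply Rle_sqr; [lra|]. rewrite Hd, Cmod_affine_cis.
    replace (2 * PI * x / 2) with (PI * x) by field.
    replace ((Rabs (sin (PI * x)) / 2) ^ 2) with (sin (PI * x) ^ 2 / 4)
      by (rewrite <- (pow2_abs (sin (PI * x))); field).
    assert (H1 : 0 <= sin (PI * x) ^ 2 <= 1).
    { split; [apply pow2_ge_0|]. pose proof (SIN_bound (PI * x)). nra. }
    set (s := sin (PI * x) ^ 2) in *.
    destruct (Rle_dec (1 / 4) r).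
    - assert (1 <= 4 * b * r) by nra. assert (0 <= (b - r) ^ 2) by apply pow2_ge_0. nra.
    - assert (1 / 2 <= (b - r) ^ 2) by nra.
      assert (0 <= 4 * b * r) by (apply Rmult_le_pos; lra). nra. }
  assert (Hpos : forall y, 0 <= / Rmax (Rabs y) m).
  { intros y. apply Rlt_le, Rinv_0_lt_compat. pose proof (Rmax_r (Rabs y) m). lra. }
  assert (Hone : forall y, Rabs y <= Rabs (sin (PI * x)) -> / d <= / xi * / Rmax (Rabs y) m).
  { intros y Hy. rewrite <- Rinv_mult.
    pose proof (Rmax_r (Rabs y) m).
    apply Rinv_le_contravar; [apply Rmult_lt_0_compat; lra|].
    unfold Rmax. destruct Rle_dec; auto.
    assert (0 <= Rabs y) by apply Rabs_pos. nra. }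
  assert (Hsum : forall y, y = x \/ y = x + 1 \/ y = x - 1 ->
    Rabs y <= Rabs (sin (PI * x)) -> / d <= / xi * circ_dist x m).
  { intros y Hy Hle. eapply Rle_trans; [now apply (Hone y)|].
    apply Rmult_le_compat_l; [apply Rlt_le, Rinv_0_lt_compat; lra|].
    unfold circ_dist.
    pose proof (Hpos x). pose proof (Hpos (x + 1)). pose proof (Hpos (x - 1)).
    destruct Hy as [-> | [-> | ->]]; lra. }
  assert (Habs : forall y, Rabs y <= 1 / 2 -> Rabs y <= Rabs (sin (PI * y))).
  { intros y Hy. pose proof (Rabs_pos y).
    assert (H1 : Rabs y <= sin (PI * Rabs y)) by (apply sin_PI_lower; lra).
    destruct (Rle_dec 0 y).
    - rewrite (Rabs_pos_eq y) in * by auto. pose proof (Rle_abs (sin (PI * y))). lra.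
    - rewrite (Rabs_left y) in * by lra.
      replace (PI * - y) with (- (PI * y)) in H1 by ring. rewrite sin_neg in H1.
      rewrite <- Rabs_Ropp. pose proof (Rle_abs (- sin (PI * y))). lra. }
  assert (Hshift : forall y, sin (PI * (y + 1)) = - sin (PI * y)).
  { intros y. replace (PI * (y + 1)) with (PI * y + PI) by ring. apply neg_sin. }
  destruct (Rle_dec x (-1 / 2)); [|destruct (Rle_dec x (1 / 2))].
  - apply (Hsum (x + 1)); auto. rewrite <- (Rabs_Ropp (sin (PI * x))), <- Hshift.
    apply Habs, Rabs_le. lra.
  - apply (Hsum x); auto. apply Habs, Rabs_le. lra.
  - apply (Hsum (x - 1)); auto.
    replace (sin (PI * x)) with (- sin (PI * (x - 1))).
    + rewrite Rabs_Ropp. apply Habs, Rabs_le. lra.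
    + rewrite <- Hshift. do 2 f_equal. ring.
Qed.

(** * The potential *)

(* A triple (alpha, b, th) stands for the function alpha / (b - cis (- 2 pi th) z). *)
Definition kernel : Type := (R * R * R)%type.

Definition kden (p : kernel) (z : C) : C :=
  let '(_, b, th) := p in (RtoC b - cis (- (2 * PI * th)) * z)%C.

Definition kweight (p : kernel) : R := fst (fst p).

Definition kgood (p : kernel) : Prop := 0 <= kweight p /\ 1 < snd (fst p).

Definition kratio (p : kernel) : C :=
  let '(_, b, th) := p in (RtoC (/ b) * cis (- (2 * PI * th)))%C.

Fixpoint kser (l : list kernel) : nat -> C :=
  match l with
  | nil => fun _ => RtoC 0
  | p :: l => fun n => (RtoC (kweight p / snd (fst p)) * kratio p ^ n + kser l n)%C
  end.

Lemma Cmod_kratio p : kgood p -> Cmod (kratio p) = / snd (fst p).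
Proof.
  destruct p as [[a b] th]. unfold kgood; simpl. intros [_ H].
  rewrite Cmod_mult, Cmod_cis, Cmod_R, Rabs_pos_eq; [ring|].
  apply Rlt_le, Rinv_0_lt_compat; lra.
Qed.

Lemma Cmod_kratio_lt p : kgood p -> Cmod (kratio p) < 1.
Proof.
  intros H. rewrite Cmod_kratio by auto. destruct H.
  rewrite <- Rinv_1. apply Rinv_lt_contravar; lra.
Qed.

Lemma kden_ratio p z : kgood p ->
  kden p z = (RtoC (snd (fst p)) * (RtoC 1 - kratio p * z))%C.
Proof.
  destruct p as [[a b] th]. unfold kgood, kratio, kden; simpl. intros [_ H].
  rewrite RtoC_inv by lra. field. intros Hc. apply RtoC_inj in Hc. lra.
Qed.

Lemma kden_neq_0 p z : kgood p -> Cmod z <= 1 -> kden p z <> RtoC 0.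
Proof.
  intros Hp Hz. rewrite kden_ratio by auto. apply Cmult_neq_0.
  - intros Hc. apply RtoC_inj in Hc. destruct Hp. lra.
  - apply one_minus_neq_0; auto. now apply Cmod_kratio_lt.
Qed.

Lemma geo_kser l : (forall p, In p l -> kgood p) -> geo (kser l).
Proof.
  induction l as [|p l IH]; intros H.
  - now apply (geo_finite _ 0).
  - simpl. apply geo_plus.
    + apply geo_scal, geo_pow, Cmod_kratio_lt, H. now left.
    + apply IH. intros; apply H. now right.
Qed.

Lemma ev_zero l z : Cmod z <= 1 -> ev (derivn l (fun _ => RtoC 0)) z = RtoC 0.
Proof.
  intros Hz.
  assert (H0 : forall n, derivn l (fun _ => RtoC 0) n = (RtoC 0 * delta n)%C).
  { induction l; intros n; simpl; [ring|]. unfold deriv. rewrite IHl. ring. }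
  rewrite (ev_ext _ _ z H0), ev_scal; auto using geo_delta. ring.
Qed.

Lemma kser_bound l L z : (forall p, In p L -> kgood p) -> Cmod z <= 1 ->
  Cmod (ev (derivn l (kser L)) z)
  <= INR (fact l) * lsum (fun p => kweight p * (/ Cmod (kden p z)) ^ S l) L.
Proof.
  intros H Hz. induction L as [|p L IH].
  - simpl kser. rewrite ev_zero, Cmod_0 by auto. simpl. lra.
  - assert (Hp : kgood p) by (apply H; now left).
    assert (HL : forall p, In p L -> kgood p) by (intros; apply H; now right).
    pose proof (Cmod_kratio_lt p Hp) as Hq.
    simpl kser. rewrite (ev_ext _ _ z (derivn_plus l _ _)).
    rewrite ev_plus; auto using geo_derivn, geo_scal, geo_pow, geo_kser.
    eapply Rle_trans; [apply Cmod_triangle|]. cbn [lsum]. rewrite Rmult_plus_distr_l.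
    apply Rplus_le_compat; [|now apply IH].
    rewrite (ev_ext _ _ z (derivn_scal l _ _)), ev_scal, ev_derivn_kernel; auto using geo_derivn, geo_pow.
    pose proof (one_minus_neq_0 (kratio p) z Hq Hz) as Hne.
    rewrite kden_ratio by auto.
    destruct Hp as [Ha Hb].
    assert (Hf : 0 <= INR (fact l)) by apply pos_INR.
    rewrite !Cmod_mult, !Cmod_pow, Cmod_inv, !Cmod_R, Cmod_kratio by (auto; now split).
    rewrite (Rabs_pos_eq (snd (fst p))), (Rabs_pos_eq (INR (fact l))), Rabs_pos_eq by
      (lra || (apply Rdiv_le_0_compat; lra)).
    rewrite Rinv_mult, Rpow_mult_distr. simpl.
    set (x := (/ snd (fst p)) ^ l). set (y := (/ Cmod _) ^ l).
    apply Req_le. field. split; [|lra]. now apply Rgt_not_eq, Cmod_gt_0.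
Qed.

Lemma Re_kser L z : (forall p, In p L -> kgood p) -> Cmod z <= 1 ->
  Re (ev (kser L) z) = lsum (fun p => kweight p * (Re (kden p z) / Cmod (kden p z) ^ 2)) L.
Proof.
  intros H Hz. induction L as [|p L IH].
  - change (kser nil) with (derivn 0 (fun _ => RtoC 0)). rewrite ev_zero by auto. reflexivity.
  - assert (Hp : kgood p) by (apply H; now left).
    assert (HL : forall p, In p L -> kgood p) by (intros; apply H; now right).
    pose proof (Cmod_kratio_lt p Hp) as Hq.
    simpl kser. rewrite ev_plus; auto using geo_scal, geo_pow, geo_kser.
    rewrite re_plus, IH by auto. cbn [lsum]. f_equal.
    rewrite ev_scal, ev_pow by auto using geo_pow.
    pose proof (one_minus_neq_0 (kratio p) z Hq Hz) as Hne.
    pose proof (kden_neq_0 p z Hp Hz) as Hk.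
    assert (Hb : 1 < snd (fst p)) by apply Hp.
    replace (RtoC (kweight p / snd (fst p)) * / (RtoC 1 - kratio p * z))%C
      with (RtoC (kweight p) * / kden p z)%C.
    + rewrite re_scal_l. f_equal.
      rewrite Cmod2_alt. destruct (kden p z) as [x y]. reflexivity.
    + rewrite kden_ratio by auto. rewrite RtoC_div by lra.
      assert (RtoC (snd (fst p)) <> RtoC 0) by (intros Hc; apply RtoC_inj in Hc; lra).
      field. auto.
Qed.

Section Potential.

Context (xi w : R) (Hxi : 0 < xi < 1 / 2) (Hw : 1 < w) (Hxw : 2 * xi * w < 1).

(** The pole over each end point is pushed out of the disc by xi^k, the length of the intervals of
    step k: the kernel has height w^k and width of order xi^k on the circle. *)
Definition level (k : nat) : list kernel :=
  map (fun th => (w ^ k * xi ^ k, 1 + xi ^ k, th)) (endpoints xi k).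

Fixpoint levels (K : nat) : list kernel :=
  match K with O => level 0 | S K => levels K ++ level (S K) end.

Lemma in_levels K p : In p (levels K) <->
  exists k th, (k <= K)%nat /\ In th (endpoints xi k) /\ p = (w ^ k * xi ^ k, 1 + xi ^ k, th).
Proof.
  assert (Hl : forall k, In p (level k) <->
    exists th, In th (endpoints xi k) /\ p = (w ^ k * xi ^ k, 1 + xi ^ k, th)).
  { intros k. unfold level. rewrite in_map_iff. split; intros (th & H1 & H2); eauto. }
  induction K.
  - change (levels 0) with (level 0). rewrite Hl. split.
    + intros (th & H1 & H2). exists O, th. auto.
    + intros (k & th & H1 & H2 & H3). replace k with O in * by lia. eauto.
  - change (levels (S K)) with (levels K ++ level (S K)).
    rewrite in_app_iff, IHK, Hl. split.
    + intros [(k & th & H1 & H2 & H3)|(th & H1 & H2)]; [exists k, th; auto|exists (S K), th; auto].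
    + intros (k & th & H1 & H2 & H3). destruct (Nat.eq_dec k (S K)) as [->|Hne].
      * right. eauto.
      * left. exists k, th. split; [lia|auto].
Qed.

Lemma levels_good K p : In p (levels K) -> kgood p.
Proof.
  rewrite in_levels. intros (k & th & _ & _ & ->). unfold kgood, kweight; simpl.
  assert (0 < xi ^ k) by (apply pow_lt; lra). assert (0 < w ^ k) by (apply pow_lt; lra).
  split; [apply Rmult_le_pos; lra|lra].
Qed.

Lemma kden_polar p r t :
  kden p (RtoC r * cis (2 * PI * t))%C
  = (RtoC (snd (fst p)) - RtoC r * cis (2 * PI * (t - snd p)))%C.
Proof.
  destruct p as [[a b] th]. simpl.
  replace (2 * PI * (t - th)) with (- (2 * PI * th) + 2 * PI * t) by ring.
  rewrite cis_plus. ring.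
Qed.

Lemma Re_kden_pos p z : kgood p -> Cmod z <= 1 -> snd (fst p) - 1 <= Re (kden p z).
Proof.
  destruct p as [[a b] th]. unfold kgood, kden; simpl. intros _ Hz.
  pose proof (re_le_Cmod (cis (- (2 * PI * th)) * z)%C) as H.
  rewrite Cmod_mult, Cmod_cis in H.
  pose proof (Rle_abs (Re (cis (- (2 * PI * th)) * z)%C)) as H2.
  unfold Re in *; simpl in *. lra.
Qed.

Lemma kden_ge p z : kgood p -> Cmod z <= 1 -> snd (fst p) - 1 <= Cmod (kden p z).
Proof.
  intros Hp Hz. pose proof (Re_kden_pos p z Hp Hz). pose proof (re_le_Cmod (kden p z)).
  pose proof (Rle_abs (Re (kden p z))). lra.
Qed.

(** Size, up to a constant, of the contribution of step k at distance about xi^j from the set: w^k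
    as long as k <= j, then decay by the factor 2 xi w < 1 at each finer step. *)
Definition sum_weight (j k : nat) : R := w ^ min j k * (2 * xi * w) ^ (k - min j k).

Lemma sum_weight_bound : exists M, 0 < M /\ forall j K, rsum (sum_weight j) (S K) <= M * w ^ j.
Proof.
  set (P := 2 * xi * w). assert (HP : 0 < P) by (unfold P; repeat apply Rmult_lt_0_compat; lra).
  assert (Ha : 0 < w / (w - 1)) by (apply Rdiv_lt_0_compat; lra).
  assert (Hb : 0 < P / (1 - P)) by (apply Rdiv_lt_0_compat; unfold P in *; lra).
  exists (w / (w - 1) + P / (1 - P)). split; [lra|].
  intros j.
  assert (Hlow : forall K, (K <= j)%nat -> rsum (sum_weight j) (S K) <= w ^ K * (w / (w - 1))).
  { induction K; intros H.
    - simpl. unfold sum_weight. rewrite Nat.min_0_r. simpl.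
      assert (1 < w / (w - 1)).
      { apply Rmult_lt_reg_r with (w - 1); [lra|]. unfold Rdiv. rewrite Rmult_assoc, Rinv_l; lra. }
      lra.
    - change (rsum (sum_weight j) (S K) + sum_weight j (S K) <= w ^ S K * (w / (w - 1))).
      unfold sum_weight at 2. rewrite Nat.min_r, Nat.sub_diag by lia. simpl (_ ^ 0).
      specialize (IHK ltac:(lia)).
      replace (w ^ S K * (w / (w - 1))) with (w ^ K * (w / (w - 1)) + w ^ S K * 1)
        by (simpl; field; lra).
      lra. }
  assert (Hwj : 0 < w ^ j) by (apply pow_lt; lra).
  assert (Hhigh : forall d, rsum (sum_weight j) (S (j + d))
    <= w ^ j * (w / (w - 1) + P / (1 - P) * (1 - P ^ d))).
  { induction d.
    - rewrite Nat.add_0_r. eapply Rle_trans; [now apply Hlow|]. simpl. lra.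
    - rewrite Nat.add_succ_r.
      change (rsum (sum_weight j) (S (j + d)) + sum_weight j (S (j + d)) <=
         w ^ j * (w / (w - 1) + P / (1 - P) * (1 - P ^ S d))).
      unfold sum_weight at 2. rewrite Nat.min_l by lia.
      replace (S (j + d) - j)%nat with (S d) by lia. fold P.
      replace (w ^ j * (w / (w - 1) + P / (1 - P) * (1 - P ^ S d))) with
        (w ^ j * (w / (w - 1) + P / (1 - P) * (1 - P ^ d)) + w ^ j * P ^ S d)
        by (simpl; field; unfold P in *; lra).
      lra. }
  intros K. destruct (Nat.le_gt_cases K j) as [HK|HK].
  - eapply Rle_trans; [now apply Hlow|].
    apply Rle_trans with (w ^ j * (w / (w - 1))).
    + apply Rmult_le_compat_r; [lra|]. apply Rle_pow; [lra|lia].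
    + assert (0 < P / (1 - P) * w ^ j) by (now apply Rmult_lt_0_compat). lra.
  - replace K with (j + (K - j))%nat by lia. eapply Rle_trans; [apply Hhigh|].
    rewrite Rmult_comm. apply Rmult_le_compat_r; [lra|].
    assert (0 < P ^ (K - j)) by (apply pow_lt; auto).
    assert (0 < P / (1 - P) * P ^ (K - j)) by (now apply Rmult_lt_0_compat). lra.
Qed.

(** [endpoints_inverse_sum] at resolution xi^(min j k) bounds step k by a multiple of
    [sum_weight j k]. The position of the point enters only through lower bounds on the
    denominators, so that the same estimate serves on the circle, on the circle of radius 1 - xi^J
    and at the origin. *)
Lemma potential_upper : exists M, 0 < M /\ forall K j r t, 0 <= r <= 1 -> 0 <= t <= 1 ->
  (forall k th, (k <= K)%nat -> In th (endpoints xi k) ->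
     xi ^ S (min j k) <= Cmod (kden (w ^ k * xi ^ k, 1 + xi ^ k, th) (RtoC r * cis (2 * PI * t))%C)) ->
  lsum (fun p => kweight p * / Cmod (kden p (RtoC r * cis (2 * PI * t))%C)) (levels K) <= M * w ^ j.
Proof.
  destruct (endpoints_inverse_sum xi Hxi) as (M1 & HM1 & HH).
  destruct sum_weight_bound as (M2 & HM2 & HS).
  exists (3 * M1 / xi * M2). split.
  { apply Rmult_lt_0_compat; auto. apply Rdiv_lt_0_compat; lra. }
  intros K j r t Hr Ht Hd. set (z := (RtoC r * cis (2 * PI * t))%C) in *.
  assert (Hlev : forall k, (k <= K)%nat -> lsum (fun p => kweight p * / Cmod (kden p z)) (level k)
     <= 3 * M1 / xi * sum_weight j k).
  { intros k Hk. unfold level. rewrite lsum_map. cbn [kweight fst].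
    set (m := min j k). assert (Hm : (m <= k)%nat) by (unfold m; lia).
    assert (Hxm : 0 < xi ^ m) by (apply pow_lt; lra).
    assert (Hwk : 0 < w ^ k * xi ^ k) by (apply Rmult_lt_0_compat; apply pow_lt; lra).
    apply Rle_trans with (lsum (fun th => w ^ k * xi ^ k * (/ xi * circ_dist (t - th) (xi ^ m))) (endpoints xi k)).
    - apply lsum_le. intros th Hth. apply Rmult_le_compat_l; [lra|].
      pose proof (endpoints_range xi k th ltac:(lra) Hth).
      assert (0 < xi ^ k) by (apply pow_lt; lra).
      apply (inv_chord_bound (1 + xi ^ k) r); try lra.
      + unfold z. now rewrite kden_polar.
      + unfold z. rewrite kden_polar. specialize (Hd k th Hk Hth).
        unfold z in Hd. rewrite kden_polar in Hd. exact Hd.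
    - rewrite lsum_scal, lsum_scal.
      assert (H3 : lsum (fun th => circ_dist (t - th) (xi ^ m)) (endpoints xi k)
        <= 3 * (M1 * 2 ^ k * (/ (2 * xi)) ^ m)).
      { unfold circ_dist. rewrite !lsum_plus.
        pose proof (HH m k t Hm) as H1.
        pose proof (HH m k (t + 1) Hm) as H2.
        pose proof (HH m k (t - 1) Hm) as H3.
        rewrite (lsum_ext (fun th => / Rmax (Rabs (t + 1 - th)) (xi ^ m))
          (fun th => / Rmax (Rabs (t - th + 1)) (xi ^ m))) in H2 by (intros; do 3 f_equal; ring).
        rewrite (lsum_ext (fun th => / Rmax (Rabs (t - 1 - th)) (xi ^ m))
          (fun th => / Rmax (Rabs (t - th - 1)) (xi ^ m))) in H3 by (intros; do 3 f_equal; ring).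
        lra. }
      apply Rle_trans with (w ^ k * xi ^ k * (/ xi * (3 * (M1 * 2 ^ k * (/ (2 * xi)) ^ m)))).
      + apply Rmult_le_compat_l; [lra|]. apply Rmult_le_compat_l; auto.
        apply Rlt_le, Rinv_0_lt_compat; lra.
      + apply Req_le. unfold sum_weight. fold m.
        replace k with (m + (k - m))%nat at 1 2 3 by lia.
        rewrite !pow_add, pow_inv, !Rpow_mult_distr. field.
        repeat split; try apply pow_nonzero; lra. }
  assert (Hind : forall K', (K' <= K)%nat ->
    lsum (fun p => kweight p * / Cmod (kden p z)) (levels K') <= 3 * M1 / xi * rsum (sum_weight j) (S K')).
  { induction K'; intros HK.
    - simpl rsum. rewrite Rplus_0_l. now apply Hlev.
    - change (levels (S K')) with (levels K' ++ level (S K')). rewrite lsum_app.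
      change (rsum (sum_weight j) (S (S K'))) with (rsum (sum_weight j) (S K') + sum_weight j (S K')).
      rewrite Rmult_plus_distr_l. apply Rplus_le_compat; [apply IHK'; lia|now apply Hlev]. }
  eapply Rle_trans; [now apply Hind|].
  rewrite (Rmult_assoc _ M2). apply Rmult_le_compat_l; auto.
  apply Rlt_le, Rdiv_lt_0_compat; lra.
Qed.

(** 13 = 5 + 8: an interval of step j spans an arc of length 2 pi xi^j <= 8 xi^j, so a point that is
    not near at step j keeps the distance 5 xi^j from the whole set. This leaves room for a radial
    displacement by 2 xi^K. *)
Definition near (j : nat) (t : R) : Prop :=
  exists th, In th (endpoints xi j) /\
    Cmod (cis (2 * PI * t) - cis (2 * PI * th))%C <= 13 * xi ^ j.

(** The level j stands for the logarithm of the distance to the set, cut off at K like the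
    potential. Nearness at j bounds the potential from below, failure at j + 1 bounds it from
    above. *)
Lemma near_level K t : exists j, (j <= K)%nat /\ near j t /\ (j = K \/ ~ near (S j) t).
Proof.
  assert (H0 : near 0 t).
  { exists 0. split; [now left|]. simpl.
    eapply Rle_trans; [apply Cmod_triangle|]. rewrite Cmod_opp, !Cmod_cis. lra. }
  induction K.
  - exists O. auto.
  - destruct IHK as (j & Hj & Hn & [->|Hf]).
    + destruct (excluded_middle_informative (near (S K) t)).
      * exists (S K). auto.
      * exists K. auto.
    + exists j. auto.
Qed.

Lemma not_near_far j t : ~ near (S j) t -> forall eps, digits eps ->
  5 * xi ^ S j <= Cmod (cis (2 * PI * t) - cis (2 * PI * digit_sum xi eps))%C.
Proof.
  intros Hn eps He.
  destruct (endpoints_approx xi (S j) eps ltac:(lra) He) as (th & Hin & Hth).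
  assert (Hgt : 13 * xi ^ S j < Cmod (cis (2 * PI * t) - cis (2 * PI * th))%C).
  { apply Rnot_le_lt. intros Hle. apply Hn. now exists th. }
  pose proof (Cmod_cis_minus (2 * PI * digit_sum xi eps) (2 * PI * th)) as Hc.
  assert (Hc2 : Rabs (2 * PI * digit_sum xi eps - 2 * PI * th) <= 8 * xi ^ S j).
  { pose proof PI_4. pose proof PI_RGT_0.
    replace (2 * PI * digit_sum xi eps - 2 * PI * th) with (2 * PI * (digit_sum xi eps - th)) by ring.
    rewrite Rabs_pos_eq by (apply Rmult_le_pos; lra).
    apply Rmult_le_compat; lra. }
  pose proof (Cmod_triangle (cis (2 * PI * t) - cis (2 * PI * digit_sum xi eps))%C
    (cis (2 * PI * digit_sum xi eps) - cis (2 * PI * th))%C) as Ht.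
  replace (cis (2 * PI * t) - cis (2 * PI * digit_sum xi eps) +
        (cis (2 * PI * digit_sum xi eps) - cis (2 * PI * th)))%C
    with (cis (2 * PI * t) - cis (2 * PI * th))%C in Ht by ring.
  lra.
Qed.

(* Moving the pole [e] radially outwards moves it away from the closed unit disc. *)
Lemma kden_ge_chord a b th t : 1 <= b ->
  Cmod (cis (2 * PI * t) - cis (2 * PI * th))%C <= Cmod (kden (a, b, th) (cis (2 * PI * t))).
Proof.
  intros Hb. apply Rle_sqr; [apply Cmod_ge_0|].
  replace (Cmod (kden (a, b, th) (cis (2 * PI * t)))) with
    (Cmod (RtoC b - RtoC 1 * cis (2 * PI * (t - th)))%C).
  - replace (Cmod (cis (2 * PI * t) - cis (2 * PI * th))%C) with
      (Cmod (RtoC 1 - RtoC 1 * cis (2 * PI * (t - th)))%C).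
    + rewrite !Cmod_affine_cis.
      assert (0 <= sin (2 * PI * (t - th) / 2) ^ 2) by apply pow2_ge_0. nra.
    + assert (H : (cis (2 * PI * th) * cis (- (2 * PI * th)))%C = RtoC 1).
      { rewrite <- cis_plus, Rplus_opp_r. apply cis_0. }
      replace (cis (2 * PI * t) - cis (2 * PI * th))%C with
        (- cis (2 * PI * th) * (RtoC 1 - RtoC 1 * cis (2 * PI * (t - th))))%C.
      * rewrite Cmod_mult, Cmod_opp, Cmod_cis. ring.
      * replace (2 * PI * (t - th)) with (2 * PI * t + - (2 * PI * th)) by ring.
        rewrite cis_plus.
        replace (- cis (2 * PI * th) * (RtoC 1 -
        RtoC 1 * (cis (2 * PI * t) * cis (- (2 * PI * th)))))%C
          with (cis (2 * PI * t) * (cis (2 * PI * th) * cis (- (2 * PI * th))) -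
        cis (2 * PI * th))%C by ring.
        rewrite H. ring.
  - f_equal. rewrite <- (Cmult_1_l (cis (2 * PI * t))). now rewrite kden_polar.
Qed.

(** Up to step j the offset xi^k of the pole suffices; for finer steps it is the distance to the
    set, which contains the end points. *)
Lemma kden_level_lower K j t k th : (k <= K)%nat -> In th (endpoints xi k) ->
  (j = K \/ ~ near (S j) t) ->
  xi ^ S (min j k) <= Cmod (kden (w ^ k * xi ^ k, 1 + xi ^ k, th) (cis (2 * PI * t))).
Proof.
  intros Hk Hth Hj.
  assert (Hxk : 0 < xi ^ k) by (apply pow_lt; lra).
  destruct (Nat.le_gt_cases k j) as [Hkj|Hkj].
  - rewrite Nat.min_r by auto.
    apply Rle_trans with (xi ^ k); [simpl; nra|].
    replace (xi ^ k) with (snd (fst ((w ^ k * xi ^ k, 1 + xi ^ k), th)) - 1) at 1 by (simpl; ring).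
    apply kden_ge; [|rewrite Cmod_cis; lra].
    apply (levels_good K), in_levels. now exists k, th.
  - rewrite Nat.min_l by lia. destruct Hj as [->|Hn]; [lia|].
    destruct (endpoints_digits xi k th ltac:(lra) Hth) as (eps & He & <-).
    pose proof (not_near_far j t Hn eps He).
    assert (0 < xi ^ S j) by (apply pow_lt; lra).
    eapply Rle_trans; [|apply kden_ge_chord; lra]. lra.
Qed.

(** All kernels have positive real part, so a single one of step j suffices. Its denominator has
    real part at least xi^j and modulus at most (1 + 13) xi^j, whence 196 = 14^2. *)
Lemma potential_lower K j t : (j <= K)%nat -> near j t ->
  w ^ j / 196 <= Re (ev (kser (levels K)) (cis (2 * PI * t))).
Proof.
  intros Hj (th & Hth & Hnear). set (z := cis (2 * PI * t)) in *.
  assert (Hz : Cmod z <= 1) by (unfold z; rewrite Cmod_cis; lra).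
  rewrite Re_kser by (auto; apply levels_good).
  set (p := ((w ^ j * xi ^ j, 1 + xi ^ j), th) : kernel).
  assert (Hin : In p (levels K)) by (apply in_levels; now exists j, th).
  assert (Hpos : forall q, In q (levels K) -> 0 <= Re (kden q z) / Cmod (kden q z) ^ 2).
  { intros q Hq. pose proof (levels_good K q Hq) as Hg. pose proof (Re_kden_pos q z Hg Hz).
    apply Rdiv_le_0_compat; [destruct Hg; lra|]. apply pow_lt, Cmod_gt_0. now apply kden_neq_0. }
  apply Rle_trans with (kweight p * (Re (kden p z) / Cmod (kden p z) ^ 2)).
  2:{ apply (lsum_member (fun p => kweight p * (Re (kden p z) / Cmod (kden p z) ^ 2))); auto.
      intros q Hq. apply Rmult_le_pos; [apply (levels_good K q Hq)|auto]. }
  pose proof (levels_good K p Hin) as Hg. pose proof (Re_kden_pos p z Hg Hz) as Hre.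
  assert (Hx : 0 < xi ^ j) by (apply pow_lt; lra). assert (Hwj : 0 < w ^ j) by (apply pow_lt; lra).
  assert (Hmod : Cmod (kden p z) <= 14 * xi ^ j).
  { unfold p, kden.
    replace (RtoC (1 + xi ^ j) - cis (- (2 * PI * th)) * z)%C with
      (RtoC (xi ^ j) + - cis (- (2 * PI * th)) * (z - cis (2 * PI * th)))%C.
    - eapply Rle_trans; [apply Cmod_triangle|].
      rewrite Cmod_mult, Cmod_opp, Cmod_cis, Cmod_R, Rabs_pos_eq by lra. lra.
    - assert (H : (cis (2 * PI * th) * cis (- (2 * PI * th)))%C = RtoC 1).
      { rewrite <- cis_plus, Rplus_opp_r. apply cis_0. }
      rewrite RtoC_plus, <- H. ring. }
  assert (Hk0 : 0 < Cmod (kden p z)) by (apply Cmod_gt_0; now apply kden_neq_0).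
  cbn [kweight fst snd p] in *.
  replace (1 + xi ^ j - 1) with (xi ^ j) in Hre by ring.
  apply Rle_trans with (w ^ j * xi ^ j * (xi ^ j / (14 * xi ^ j) ^ 2)).
  - apply Req_le. field. lra.
  - apply Rmult_le_compat_l; [apply Rmult_le_pos; lra|].
    unfold Rdiv. apply Rmult_le_compat; try lra.
    + apply Rlt_le, Rinv_0_lt_compat, pow_lt. lra.
    + apply Rinv_le_contravar; [now apply pow_lt|]. apply pow_incr. lra.
Qed.

End Potential.

(** * Estimates in the mean *)

Definition l2_le (a : nat -> C) (B : R) : Prop :=
  forall m, rsum (fun n => Cmod (a n) ^ 2) m <= B ^ 2.

Lemma l2_le_ext a b B : (forall n, a n = b n) -> l2_le a B -> l2_le b B.
Proof.
  intros H Ha m. rewrite (rsum_ext _ (fun n => Cmod (a n) ^ 2)); auto.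
  intros; now rewrite H.
Qed.

Lemma l2_le_plus a b B : l2_le a B -> l2_le b B -> l2_le (fun n => (a n + b n)%C) (2 * B).
Proof.
  intros Ha Hb m.
  apply Rle_trans with (rsum (fun n => 2 * Cmod (a n) ^ 2 + 2 * Cmod (b n) ^ 2) m).
  - apply rsum_le. intros k _. pose proof (Cmod_triangle (a k) (b k)).
    pose proof (Cmod_ge_0 (a k + b k)%C).
    apply Rle_trans with ((Cmod (a k) + Cmod (b k)) ^ 2); [apply pow_incr; lra|].
    assert (0 <= (Cmod (a k) - Cmod (b k)) ^ 2) by apply pow2_ge_0. nra.
  - rewrite rsum_plus, !rsum_scal. specialize (Ha m). specialize (Hb m). nra.
Qed.

(** Leibniz's rule as in [derivn_conv_bound], with the second factor measured in mean square: the
    second factor will be a partial sum of 1 / f, which is controlled in this norm. *)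
Lemma l2_derivn_conv l : forall a b y A B, geo a -> geo b -> 0 <= y -> 0 <= A ->
  (forall i t, (i <= l)%nat -> 0 <= t <= 1 -> Cmod (ev (derivn i a) (cis (2 * PI * t))) <= A * y ^ i) ->
  (forall i, (i <= l)%nat -> l2_le (derivn i b) (B * y ^ i)) ->
  l2_le (derivn l (conv a b)) (2 ^ l * A * B * y ^ l).
Proof.
  induction l; intros a b y A B Ha Hb Hy HA H1 H2.
  - simpl derivn. intros m. simpl (2 ^ 0). simpl (y ^ 0).
    replace ((1 * A * B * 1) ^ 2) with (A ^ 2 * B ^ 2) by ring.
    apply bessel_conv; auto.
    + intros t Ht. specialize (H1 O t (le_n _) Ht). simpl in H1. lra.
    + intros N. specialize (H2 O (le_n _) N). simpl derivn in H2. simpl (y ^ 0) in H2.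
      rewrite Rmult_1_r in H2. exact H2.
  - apply (l2_le_ext (fun n => (derivn l (conv (deriv a) b) n + derivn l (conv a (deriv b)) n)%C)).
    { intros n. rewrite derivn_S, (derivn_ext l _ _ (deriv_conv a b)). symmetry. apply derivn_plus. }
    replace (2 ^ S l * A * B * y ^ S l) with (2 * (2 ^ l * (A * y) * B * y ^ l)) by (simpl; ring).
    apply l2_le_plus.
    + apply IHl; auto using geo_deriv.
      * now apply Rmult_le_pos.
      * intros i t Hi Ht. rewrite <- (ev_ext _ _ _ (derivn_S i a)).
        eapply Rle_trans; [apply H1; auto; lia|]. simpl. lra.
    + replace (2 ^ l * (A * y) * B * y ^ l) with (2 ^ l * A * (B * y) * y ^ l) by ring.
      apply IHl; auto using geo_deriv.
      intros i Hi. apply (l2_le_ext _ _ _ (derivn_S i b)).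
      replace (B * y * y ^ i) with (B * y ^ S i) by (simpl; ring). apply H2. lia.
Qed.

(** Bernstein's inequality in mean square: on polynomials of degree below N differentiation
    multiplies each coefficient by less than N. *)
Lemma l2_derivn_finite N i : forall a B, (forall n, (N <= n)%nat -> a n = RtoC 0) ->
  l2_le a B -> l2_le (derivn i a) (B * INR N ^ i).
Proof.
  induction i; intros a B H Ha.
  - simpl. now rewrite Rmult_1_r.
  - apply (l2_le_ext (derivn i (deriv a))).
    { intros n. symmetry. apply derivn_S. }
    replace (B * INR N ^ S i) with (B * INR N * INR N ^ i) by (simpl; ring).
    apply IHi.
    + intros n Hn. unfold deriv. rewrite H by lia. ring.
    + intros m. apply Rle_trans with (INR N ^ 2 * rsum (fun n => Cmod (a (S n)) ^ 2) m).
      * rewrite <- rsum_scal. apply rsum_le. intros n _. unfold deriv.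
        rewrite Cmod_mult, Cmod_R, Rabs_pos_eq, Rpow_mult_distr by apply pos_INR.
        destruct (Nat.le_gt_cases N (S n)) as [Hn|Hn].
        -- rewrite H, Cmod_0 by lia. lra.
        -- apply Rmult_le_compat_r; [apply pow2_ge_0|]. apply pow_incr.
           split; [apply pos_INR|apply le_INR; lia].
      * rewrite Rpow_mult_distr, (Rmult_comm (B ^ 2)).
        apply Rmult_le_compat_l; [apply pow2_ge_0|].
        specialize (Ha (S m)). replace (S m) with (1 + m)%nat in Ha by lia.
        rewrite rsum_split in Ha. simpl rsum at 1 in Ha.
        pose proof (pow2_ge_0 (Cmod (a O))). change (fun k => Cmod (a (1 + k)%nat) ^ 2)
          with (fun k => Cmod (a (S k)) ^ 2) in Ha. lra.
Qed.

(** The coefficient of z^n in the P-th derivative carries the factor (n + 1) ... (n + P). *)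
Lemma derivn_lower P : forall h n, INR (S n) ^ P * Cmod (h (n + P)%nat) <= Cmod (derivn P h n).
Proof.
  induction P; intros h n.
  - rewrite Nat.add_0_r. simpl. lra.
  - rewrite derivn_S. eapply Rle_trans; [|apply IHP].
    unfold deriv. rewrite Cmod_mult, Cmod_R, Rabs_pos_eq by apply pos_INR.
    replace (n + S P)%nat with (S (n + P)) by lia. rewrite <- tech_pow_Rmult.
    assert (INR (S n) <= INR (S (n + P))) by (apply le_INR; lia).
    assert (0 <= INR (S n) ^ P) by (apply pow_le, pos_INR).
    pose proof (Cmod_ge_0 (h (S (n + P)))).
    replace (INR (S n) * INR (S n) ^ P * Cmod (h (S (n + P)))) with
      (INR (S n) ^ P * (INR (S n) * Cmod (h (S (n + P))))) by ring.
    apply Rmult_le_compat_l; auto. now apply Rmult_le_compat_r.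
Qed.

Lemma inverse_square_sum N m : (1 <= N)%nat ->
  rsum (fun i => / INR (N + i) ^ 2) m <= 2 / INR N.
Proof.
  intros HN. assert (H1 : 1 <= INR N) by (apply (le_INR 1); auto).
  enough (H : rsum (fun i => / INR (N + i) ^ 2) m <= 2 * (/ INR N - / INR (N + m))).
  { assert (0 < / INR (N + m)) by (apply Rinv_0_lt_compat, lt_0_INR; lia). lra. }
  induction m.
  - simpl. rewrite Nat.add_0_r. lra.
  - cbn [rsum]. rewrite Nat.add_succ_r, S_INR. set (x := INR (N + m)) in *.
    assert (Hx : 1 <= x) by (unfold x; apply (le_INR 1); lia).
    assert (/ x ^ 2 <= 2 * (/ x - / (x + 1))).
    { replace (2 * (/ x - / (x + 1))) with (2 / (x * (x + 1))) by (field; lra).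
      replace (/ x ^ 2) with (2 / (2 * x ^ 2)) by (field; lra).
      unfold Rdiv. apply Rmult_le_compat_l; [lra|].
      apply Rinv_le_contravar; nra. }
    lra.
Qed.

(** Since s + 1 <= P, the weight k^s is at most N^(1 + s - P) k^P / k for k >= N. Cauchy-Schwarz
    between 1 / k, of norm O(N^(-1/2)) on k >= N, and k^P |h_k|, of norm O(B N^P), gives B N^(s +
    1/2). The factor 2^P is the loss between k and k - P + 1, which 2 P <= N limits to 2 for each
    derivative. *)
Lemma weighted_tail_sum h P N s B : (1 <= N)%nat -> (2 * P <= N)%nat -> 0 <= s -> s + 1 <= INR P ->
  0 < B -> l2_le (derivn P h) (B * INR N ^ P) ->
  forall m, rsum (fun i => Rpower (INR (S i)) s * Cmod (h (N + i)%nat)) m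
    <= 2 ^ P * 2 * B * Rpower (INR N) (s + 1 / 2).
Proof.
  intros HN HPN Hs HsP HB Hl2 m.
  assert (HN0 : 0 < INR N) by (apply lt_0_INR; lia).
  set (g := derivn P h) in *.
  set (NP := Rpower (INR N) (1 + s - INR P)).
  assert (HNP : 0 < NP) by apply exp_pos.
  (* Cauchy-Schwarz is used in the form x G <= mu x^2 / 2 + G^2 / (2 mu); this mu is the ratio of
     the two norms and makes both sums of the same order. *)
  set (mu := B * INR N ^ P * Rpower (INR N) (1 / 2)).
  assert (HNpow : 0 < INR N ^ P) by (now apply pow_lt).
  assert (Hmu : 0 < mu).
  { unfold mu. apply Rmult_lt_0_compat; [now apply Rmult_lt_0_compat|apply exp_pos]. }
  apply Rle_trans with (rsum (fun i => 2 ^ P * NP *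
     (mu / 2 * / INR (N + i) ^ 2 + / (2 * mu) * Cmod (g (N + i - P)%nat) ^ 2)) m).
  - apply rsum_le. intros i _. set (k := (N + i)%nat).
    assert (Hk : 0 < INR k) by (apply lt_0_INR; unfold k; lia).
    assert (HNk : INR N <= INR k) by (apply le_INR; unfold k; lia).
    pose proof (derivn_lower P h (k - P)) as Hd. fold g in Hd.
    replace (k - P + P)%nat with k in Hd by (unfold k; lia).
    set (G := Cmod (g (k - P)%nat)) in *. set (Hh := Cmod (h k)) in *.
    assert (HG : 0 <= G) by apply Cmod_ge_0. assert (HH : 0 <= Hh) by apply Cmod_ge_0.
    assert (H1 : INR k ^ P * Hh <= 2 ^ P * G).
    { assert (H2 : INR k <= 2 * INR (S (k - P))).
      { replace 2 with (INR 2) by (simpl; ring). rewrite <- mult_INR. apply le_INR. unfold k. lia. }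
      apply Rle_trans with ((2 * INR (S (k - P))) ^ P * Hh).
      - apply Rmult_le_compat_r; auto. apply pow_incr. lra.
      - rewrite Rpow_mult_distr, Rmult_assoc. apply Rmult_le_compat_l; auto.
        apply pow_le; lra. }
    assert (H2 : Rpower (INR (S i)) s <= Rpower (INR k) s).
    { apply Rle_Rpower_l; auto. split; [apply lt_0_INR; lia|]. apply le_INR. unfold k; lia. }
    assert (H3 : Rpower (INR k) s <= NP * INR k ^ P / INR k).
    { rewrite <- Rpower_pow by auto.
      replace (Rpower (INR k) s) with
        (Rpower (INR k) (1 + s - INR P) * Rpower (INR k) (INR P) * Rpower (INR k) (- (1))).
      - rewrite Rpower_Ropp, Rpower_1 by auto.
        unfold Rdiv. apply Rmult_le_compat_r; [apply Rlt_le; now apply Rinv_0_lt_compat|].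
        apply Rmult_le_compat_r; [apply Rlt_le, exp_pos|].
        unfold NP. replace (1 + s - INR P) with (- (INR P - s - 1)) by ring.
        rewrite !Rpower_Ropp. apply Rinv_le_contravar; [apply exp_pos|].
        apply Rle_Rpower_l; lra.
      - rewrite <- !Rpower_plus. f_equal. ring. }
    assert (Hkp : 0 < INR k ^ P) by (now apply pow_lt).
    assert (Hik : 0 < / INR k) by (now apply Rinv_0_lt_compat).
    apply Rle_trans with (2 ^ P * NP * (/ INR k * G)).
    + apply Rle_trans with (NP * INR k ^ P / INR k * Hh).
      * apply Rmult_le_compat_r; auto. lra.
      * replace (NP * INR k ^ P / INR k * Hh) with (NP * / INR k * (INR k ^ P * Hh)) by (field; lra).
        replace (2 ^ P * NP * (/ INR k * G)) with (NP * / INR k * (2 ^ P * G)) by ring.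
        apply Rmult_le_compat_l; auto. apply Rmult_le_pos; lra.
    + apply Rmult_le_compat_l.
      * apply Rmult_le_pos; [apply pow_le|]; lra.
      * rewrite <- pow_inv. set (x := / INR k) in *.
        replace (mu / 2 * x ^ 2 + / (2 * mu) * G ^ 2) with
          (x * G + / (2 * mu) * (mu * x - G) ^ 2) by (field; lra).
        assert (0 <= / (2 * mu) * (mu * x - G) ^ 2).
        { apply Rmult_le_pos; [|apply pow2_ge_0]. apply Rlt_le, Rinv_0_lt_compat; lra. }
        lra.
  - rewrite rsum_scal, rsum_plus, !rsum_scal.
    assert (Hg : rsum (fun i => Cmod (g (N + i - P)%nat) ^ 2) m <= (B * INR N ^ P) ^ 2).
    { specialize (Hl2 (N - P + m)%nat). rewrite rsum_split in Hl2.
      rewrite (rsum_ext (fun i => Cmod (g (N + i - P)%nat) ^ 2) (fun k => Cmod (g (N - P + k)%nat) ^ 2)).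
      - assert (0 <= rsum (fun n => Cmod (g n) ^ 2) (N - P)).
        { apply rsum_nonneg. intros; apply pow2_ge_0. }
        lra.
      - intros k _. do 3 f_equal. lia. }
    pose proof (inverse_square_sum N m HN) as Hi.
    apply Rle_trans with (2 ^ P * NP * (mu / 2 * (2 / INR N) + / (2 * mu) * (B * INR N ^ P) ^ 2)).
    + apply Rmult_le_compat_l; [apply Rmult_le_pos; [apply pow_le|]; lra|].
      apply Rplus_le_compat; apply Rmult_le_compat_l; auto; try lra.
      apply Rlt_le, Rinv_0_lt_compat; lra.
    + set (q := Rpower (INR N) (1 / 2)). assert (Hq : 0 < q) by apply exp_pos.
      assert (Hqq : q * q = INR N).
      { unfold q. rewrite <- Rpower_plus. replace (1 / 2 + 1 / 2) with 1 by field. now apply Rpower_1. }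
      assert (Hfin : Rpower (INR N) (s + 1 / 2) = NP * INR N ^ P / q).
      { unfold NP, q. rewrite <- Rpower_pow by auto. unfold Rdiv.
        rewrite <- Rpower_Ropp, <- !Rpower_plus. f_equal. field. }
      rewrite Hfin. unfold mu. fold q. rewrite <- Hqq.
      assert (Hqp : 0 < (q * q) ^ P) by (apply pow_lt; nra).
      set (Q := (q * q) ^ P) in *.
      replace (B * Q * q / 2 * (2 / (q * q)) + / (2 * (B * Q * q)) * (B * Q) ^ 2)
        with (3 / 2 * (B * Q / q)) by (field; lra).
      assert (0 < 2 ^ P * NP * (B * Q / q)).
      { repeat apply Rmult_lt_0_compat; auto; [apply pow_lt; lra|now apply Rinv_0_lt_compat]. }
      unfold Rdiv in *. lra.
Qed.

(** The comparison that makes f stronger than the resolvent: at distance xi^d the latter grows like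
    exp(A v^d), while f decays like exp(- a w^d). *)
Lemma exp_gap v w a A : 1 < v < w -> 0 < a ->
  exists B, 0 < B /\ forall d, exp (A * v ^ d - a * w ^ d) <= B.
Proof.
  intros Hv Ha.
  set (q := w / v). assert (Hq : 1 < q).
  { unfold q. apply Rmult_lt_reg_r with v; [lra|]. unfold Rdiv. rewrite Rmult_assoc, Rinv_l; lra. }
  destruct (Pow_x_infinity q) with (b := A / a) as [d0 Hd0].
  { rewrite Rabs_pos_eq; lra. }
  exists (exp (Rabs A * v ^ d0) + 1). split; [pose proof (exp_pos (Rabs A * v ^ d0)); lra|].
  intros d.
  assert (Hvd : 0 < v ^ d) by (apply pow_lt; lra).
  assert (Hwd : 0 < w ^ d) by (apply pow_lt; lra).
  destruct (Nat.le_gt_cases d d0) as [Hd|Hd].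
  - apply Rle_trans with (exp (Rabs A * v ^ d0)); [|lra].
    apply Rlt_le, exp_increasing. 
    assert (v ^ d <= v ^ d0) by (apply Rle_pow; [lra|auto]).
    pose proof (Rle_abs A). pose proof (Rabs_pos A).
    assert (0 < a * w ^ d) by (now apply Rmult_lt_0_compat). nra.
  - assert (Hle : A * v ^ d - a * w ^ d <= 0).
    { specialize (Hd0 d ltac:(lia)). rewrite Rabs_pos_eq in Hd0 by (apply pow_le; lra).
      replace (w ^ d) with (v ^ d * q ^ d).
      - assert (A <= a * q ^ d).
        { apply Rge_le in Hd0. apply Rmult_le_compat_l with (r := a) in Hd0; [|lra].
          replace (a * (A / a)) with A in Hd0 by (field; lra). lra. }
        nra.
      - rewrite <- Rpow_mult_distr. f_equal. unfold q. field. lra. }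
    apply Rle_trans with (exp 0).
    + destruct Hle as [Hlt|Heq]; [apply Rlt_le; now apply exp_increasing|rewrite Heq; lra].
    + rewrite exp_0. pose proof (exp_pos (Rabs A * v ^ d0)). lra.
Qed.

Lemma pow_exp_gap G w a : 0 < G -> 1 < w -> 0 < a ->
  exists B, 0 < B /\ forall d, G ^ d * exp (- (a * w ^ d)) <= B.
Proof.
  intros HG Hw Ha. set (v := (1 + w) / 2).
  destruct (exp_gap v w a (Rabs (ln G) / (v - 1))) as (B & HB & H); [unfold v; lra|auto|].
  exists B. split; auto. intros d. eapply Rle_trans; [|apply (H d)].
  rewrite <- (exp_ln (G ^ d)) by (now apply pow_lt). rewrite ln_pow by auto.
  rewrite <- exp_plus. 
  assert (Hb : INR d * ln G <= Rabs (ln G) / (v - 1) * v ^ d).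
  { pose proof (bernoulli (v - 1) d ltac:(unfold v; lra)) as Hb.
    replace (1 + (v - 1)) with v in Hb by ring.
    assert (Hv : 0 < v - 1) by (unfold v; lra).
    pose proof (pos_INR d). pose proof (Rabs_pos (ln G)). pose proof (Rle_abs (ln G)).
    apply Rle_trans with (INR d * Rabs (ln G)); [apply Rmult_le_compat_l; auto|].
    replace (INR d * Rabs (ln G)) with (Rabs (ln G) / (v - 1) * (INR d * (v - 1))) by (field; lra).
    apply Rmult_le_compat_l; [apply Rdiv_le_0_compat; lra|lra]. }
  assert (Hle : INR d * ln G + - (a * w ^ d) <= Rabs (ln G) / (v - 1) * v ^ d - a * w ^ d) by lra.
  destruct Hle as [Hlt|Heq]; [apply Rlt_le; now apply exp_increasing|rewrite Heq; lra].
Qed.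

Definition trunc (N : nat) (c : nat -> C) (n : nat) : C :=
  if Nat.ltb n N then c n else RtoC 0.

Lemma geo_trunc N c : geo (trunc N c).
Proof.
  apply (geo_finite _ N). intros n Hn. unfold trunc.
  destruct (Nat.ltb_spec n N); [lia|auto].
Qed.

Lemma ev_shrink a r z : ev (fun n => (a n * RtoC (r ^ n))%C) z = ev a (RtoC r * z)%C.
Proof.
  unfold ev. f_equal; apply Series_ext; intros n; rewrite Cpow_mult_l, <- RtoC_pow; f_equal; ring.
Qed.

Lemma exp_pow_nat x n : exp x ^ n = exp (INR n * x).
Proof.
  induction n; [simpl; now rewrite Rmult_0_l, exp_0|].
  rewrite S_INR, <- tech_pow_Rmult, IHn, <- exp_plus. f_equal. ring.
Qed.

(** 1 / (1 - 1 / N) <= exp(1 / (N - 1)) and N / (N - 1) <= 2, so the inverse is at most e^2 <= 9. It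
    is the price of returning to the circle from radius 1 - 1 / N for coefficients of index below
    N. *)
Lemma half_pow_lower N : (2 <= N)%nat -> / 9 <= (1 - / INR N) ^ N.
Proof.
  intros HN. assert (H2 : 2 <= INR N) by (apply (le_INR 2); auto).
  set (x := / (INR N - 1)). assert (Hx : 0 < x) by (apply Rinv_0_lt_compat; lra).
  replace (1 - / INR N) with (/ (1 + x)) by (unfold x; field; lra).
  rewrite pow_inv. apply Rinv_le_contravar; [apply pow_lt; lra|].
  apply Rle_trans with (exp x ^ N).
  - apply pow_incr. pose proof (exp_ineq1_le x). lra.
  - rewrite exp_pow_nat.
    apply Rle_trans with (exp 2).
    + assert (INR N * x <= 2).
      { unfold x. apply Rmult_le_reg_r with (INR N - 1); [lra|].
        rewrite Rmult_assoc, Rinv_l; lra. }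
      destruct H as [Hlt|Heq]; [apply Rlt_le; now apply exp_increasing|rewrite Heq; lra].
    + replace 2 with (1 + 1) by ring. rewrite exp_plus. pose proof exp_le_3.
      pose proof (exp_pos 1). nra.
Qed.

(** Rounds 1 / N down to a power of xi, with a loss of at most a factor xi. With this J, kappa =
    w^-J is N^-gamma' up to a constant. *)
Lemma geometric_scale xi N : 0 < xi < 1 -> (2 <= N)%nat ->
  exists J, xi ^ J <= / INR N /\ / xi ^ J <= INR N / xi.
Proof.
  intros Hxi HN. assert (H2 : 2 <= INR N) by (apply (le_INR 2); auto).
  destruct (pow_small xi (/ INR N)) as [n Hn]; [lra|apply Rinv_0_lt_compat; lra|].
  specialize (Hn n (le_n _)).
  induction n.
  - simpl in Hn. assert (/ INR N <= 1) by (rewrite <- Rinv_1; apply Rinv_le_contravar; lra). lra.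
  - destruct (Rlt_dec (xi ^ n) (/ INR N)) as [H|H]; [auto|].
    exists (S n). split; [lra|]. apply Rnot_lt_le in H.
    assert (0 < xi ^ n) by (apply pow_lt; lra).
    replace (INR N / xi) with (/ (xi * / INR N)) by (field; lra).
    apply Rinv_le_contravar.
    + apply Rmult_lt_0_compat; [lra|]. apply Rinv_0_lt_compat; lra.
    + simpl. apply Rmult_le_compat_l; lra.
Qed.

Lemma exists_common_bound (Q : nat -> R -> Prop) :
  (forall i x y, Q i x -> x <= y -> Q i y) -> (forall i, exists x, 0 < x /\ Q i x) ->
  forall n, exists x, 0 < x /\ forall i, (i <= n)%nat -> Q i x.
Proof.
  intros Hm H. induction n.
  - destruct (H O) as (x & Hx & Hq). exists x. split; auto.
    intros i Hi. now replace i with O by lia.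
  - destruct IHn as (x & Hx & Hq). destruct (H (S n)) as (y & Hy & Hq').
    exists (Rmax x y). pose proof (Rmax_l x y). pose proof (Rmax_r x y).
    split; [lra|]. intros i Hi. destruct (Nat.eq_dec i (S n)) as [->|Hne].
    + now apply Hm with y.
    + apply Hm with x; auto. apply Hq. lia.
Qed.

Lemma exp_le a b : a <= b -> exp a <= exp b.
Proof.
  intros [H|H]; [apply Rlt_le; now apply exp_increasing|rewrite H; lra].
Qed.

(** * Functions flat on the Cantor set and adapted to the scale 1 / N *)

Section Peak.

Context (xi w : R) (Hxi : 0 < xi < 1 / 2) (Hw : 1 < w) (Hxw : 2 * xi * w < 1).

Let pot (K : nat) : nat -> C := kser (levels xi w K).

Let geo_pot K : geo (pot K).
Proof. apply geo_kser. apply levels_good; auto. Qed.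

(** [pexp] is normalised to 1 at the origin, so the estimates of |f| involve the potential there.
    All denominators are then at least 1, and the upper bound applies with j = 0. *)
Let potential_center_bound M : (forall K j r t, 0 <= r <= 1 -> 0 <= t <= 1 ->
  (forall k th, (k <= K)%nat -> In th (endpoints xi k) ->
     xi ^ S (min j k) <= Cmod (kden (w ^ k * xi ^ k, 1 + xi ^ k, th) (RtoC r * cis (2 * PI * t))%C)) ->
  lsum (fun p => kweight p * / Cmod (kden p (RtoC r * cis (2 * PI * t))%C)) (levels xi w K) <= M * w ^ j) ->
  forall K, Rabs (Re (pot K O)) <= M.
Proof.
  intros HM K. rewrite <- ev_0 by apply geo_pot.
  eapply Rle_trans; [apply re_le_Cmod|].
  replace (RtoC 0) with (RtoC 0 * cis (2 * PI * 0))%C by ring.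
  assert (Hz : Cmod (RtoC 0 * cis (2 * PI * 0))%C <= 1).
  { rewrite Cmult_0_l, Cmod_0. lra. }
  pose proof (kser_bound 0 (levels xi w K) _ (levels_good xi w Hxi Hw K) Hz) as Hb.
  change (derivn 0 ?a) with a in Hb. fold (pot K) in Hb.
  eapply Rle_trans; [apply Hb|].
  simpl (INR (fact 0)). rewrite Rmult_1_l.
  rewrite (lsum_ext _ (fun p => kweight p * / Cmod (kden p (RtoC 0 * cis (2 * PI * 0))%C))).
  2:{ intros p _. now rewrite pow_1. }
  rewrite <- (Rmult_1_r M). change 1 with (w ^ 0). apply HM; try lra.
  intros k th Hk Hth. simpl Nat.min. rewrite pow_1.
  assert (0 < xi ^ k) by (apply pow_lt; lra).
  rewrite kden_polar. cbn [fst snd].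
  replace (RtoC (1 + xi ^ k) - RtoC 0 * cis (2 * PI * (0 - th)))%C with (RtoC (1 + xi ^ k)) by ring.
  rewrite Cmod_R, Rabs_pos_eq; lra.
Qed.

(** f = exp(- kappa (U - U(0))) with kappa = w^-J and xi^J about 1 / N, and c is the sequence of
    coefficients of 1 / f. B is independent of N and K; D and a may depend on N. The i-th derivative
    of f is O(y^i |f|), where y is the inverse distance to the set times 1 + kappa U: at distance
    above 1 / N this y is O(N), and at smaller distance the decay of |f| compensates its growth. *)
Lemma peak_functions (P : nat) : exists B, 0 < B /\ forall N, (2 <= N)%nat ->
  exists f c : nat -> nat -> C,
  (forall K, geo (f K)) /\
  (forall K n, conv (f K) (c K) n = delta n) /\
  (exists D a, 0 < D /\ 0 < a /\ forall K j t, (j <= K)%nat -> near xi j t ->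
     Cmod (ev (f K) (cis (2 * PI * t))) <= D * exp (- (a * w ^ j))) /\
  (forall K n, (n < N)%nat -> Cmod (c K n) <= B) /\
  (forall K, l2_le (derivn P (conv (f K) (trunc N (c K)))) (B * INR N ^ P)).
Proof.
  destruct (potential_upper xi w Hxi Hw Hxw) as (M & HM & Hup).
  pose proof (potential_center_bound M Hup) as Hcenter.
  set (E := exp M). assert (HE : 0 < E) by apply exp_pos.
  assert (HE1 : 1 <= E) by (pose proof (exp_ineq1_le M); unfold E; lra).
  set (Q := fun i x => forall N J, (2 <= N)%nat -> xi ^ J <= / INR N -> / xi ^ J <= INR N / xi ->
    forall K t, 0 <= t <= 1 ->
    Cmod (ev (derivn i (pexp (deriv (fun n => (RtoC (- (/ w ^ J)) * pot K n)%C)))) (cis (2 * PI * t)))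
      <= x * INR N ^ i).
  assert (Hmod : forall kap K z, Cmod z <= 1 ->
    Cmod (ev (pexp (deriv (fun n => (RtoC (- kap) * pot K n)%C))) z)
    = exp (- kap * (Re (ev (pot K) z) - Re (pot K O)))).
  { intros kap K z Hz. rewrite Cmod_pexp; auto using geo_scal.
    rewrite ev_scal, !re_scal_l by auto. f_equal. ring. }
  assert (Hkap : forall J, 0 < / w ^ J <= 1).
  { intros J. assert (1 <= w ^ J) by (apply pow_R1_Rle; lra). split.
    - apply Rinv_0_lt_compat; lra.
    - rewrite <- Rinv_1. apply Rinv_le_contravar; lra. }
  assert (Hfsmall : forall kap K j t, 0 < kap <= 1 -> (j <= K)%nat -> near xi j t ->
    Cmod (ev (pexp (deriv (fun n => (RtoC (- kap) * pot K n)%C))) (cis (2 * PI * t)))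
      <= E * exp (- (kap / 196 * w ^ j))).
  { intros kap K j t Hk Hj Hn. rewrite Hmod by (rewrite Cmod_cis; lra).
    unfold E. rewrite <- exp_plus. apply exp_le.
    pose proof (potential_lower xi w Hxi Hw K j t Hj Hn) as Hl. fold (pot K) in Hl.
    pose proof (Hcenter K) as Hc. apply Rabs_le_between in Hc.
    set (u := Re (ev (pot K) (cis (2 * PI * t)))) in *. set (u0 := Re (pot K O)) in *.
    replace (- kap * (u - u0)) with (kap * u0 - kap * u) by ring.
    assert (kap * u0 <= M) by nra.
    assert (kap * (w ^ j / 196) <= kap * u) by (apply Rmult_le_compat_l; lra).
    replace (kap / 196 * w ^ j) with (kap * (w ^ j / 196)) by field. lra. }
  assert (HQ : forall i, exists x, 0 < x /\ Q i x).
  { intros i.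
    destruct (pow_exp_gap ((w / xi) ^ i) w (/ 196)) as (B1 & HB1 & Hgap); [|auto|lra|].
    { apply pow_lt, Rdiv_lt_0_compat; lra. }
    set (B2 := B1 + 1).
    exists (pexp_const i * ((1 + M) / xi / xi) ^ i * B2 * E).
    pose proof (pexp_const_pos i) as Hpc.
    assert (HMx : 0 < (1 + M) / xi / xi) by (repeat apply Rdiv_lt_0_compat; lra).
    assert (HMxi : 0 < ((1 + M) / xi / xi) ^ i) by (now apply pow_lt).
    split.
    { repeat apply Rmult_lt_0_compat; unfold B2; lra. }
    intros N J HN HJ HJ' K t Ht.
    destruct (near_level xi K t) as (j & Hj & Hnear & Hfar).
    set (z := cis (2 * PI * t)). assert (Hz : Cmod z <= 1) by (unfold z; rewrite Cmod_cis; lra).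
    assert (Hz1 : z = (RtoC 1 * cis (2 * PI * t))%C) by (unfold z; ring).
    assert (Hden : forall k th, (k <= K)%nat -> In th (endpoints xi k) ->
      xi ^ S (min j k) <= Cmod (kden (w ^ k * xi ^ k, 1 + xi ^ k, th) z)).
    { intros k th Hk Hth. now apply (kden_level_lower xi w Hxi Hw K). }
    assert (Hsum : lsum (fun p => kweight p * / Cmod (kden p z)) (levels xi w K) <= M * w ^ j).
    { rewrite Hz1. apply Hup; try lra. rewrite <- Hz1. exact Hden. }
    assert (HN0 : 0 < INR N) by (apply lt_0_INR; lia).
    set (kap := / w ^ J) in *. specialize (Hkap J). fold kap in Hkap.
    set (v := fun n => (RtoC (- kap) * pot K n)%C) in *.
    assert (Hv : geo v) by (now apply geo_scal).
    set (d := / xi ^ S j). assert (Hxj : 0 < xi ^ S j) by (apply pow_lt; lra).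
    assert (Hd : 0 < d) by (now apply Rinv_0_lt_compat).
    assert (Hwj : 0 < w ^ j) by (apply pow_lt; lra).
    assert (HMw : 0 <= kap * M * w ^ j) by (repeat apply Rmult_le_pos; lra).
    (* d bounds every inverse denominator and kap M w^j bounds kappa times the sum of the moduli of
       the kernels; adding 1 makes one y serve the derivatives of all orders, since the second
       quantity enters each of them only once. *)
    set (y := d * (1 + kap * M * w ^ j)).
    assert (Hy : 0 <= y) by (apply Rmult_le_pos; lra).
    pose proof (derivn_pexp_bound v z y Hv Hz Hy) as Hdb.
    assert (Hdv : forall l, Cmod (ev (derivn (S l) v) z) <= INR (fact (S l)) * y ^ S l).
    { intros l.
      replace (ev (derivn (S l) v) z) with (RtoC (- kap) * ev (derivn (S l) (pot K)) z)%C.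
      2:{ unfold v. now rewrite (ev_ext _ _ z (derivn_scal (S l) _ _)), ev_scal by auto using geo_derivn. }
      rewrite Cmod_mult, Cmod_R, Rabs_Ropp, Rabs_pos_eq by lra.
      pose proof (kser_bound (S l) (levels xi w K) z (levels_good xi w Hxi Hw K) Hz) as Hb.
      fold (pot K) in Hb.
      assert (Hf : 0 <= INR (fact (S l))) by apply pos_INR.
      assert (Hls : lsum (fun p => kweight p * (/ Cmod (kden p z)) ^ S (S l)) (levels xi w K)
        <= d ^ S l * (M * w ^ j)).
      { eapply Rle_trans; [|apply Rmult_le_compat_l; [apply pow_le; lra|apply Hsum]].
        rewrite <- lsum_scal. apply lsum_le. intros p Hp.
        pose proof (levels_good xi w Hxi Hw K p Hp) as Hg.
        assert (Hk0 : 0 < Cmod (kden p z)) by (apply Cmod_gt_0; now apply kden_neq_0).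
        assert (Hinv : / Cmod (kden p z) <= d).
        { apply Rinv_le_contravar; auto. apply in_levels in Hp.
          destruct Hp as (k & th & Hk & Hth & ->).
          eapply Rle_trans; [|now apply Hden].
          replace (S j) with (S (min j k) + (j - min j k))%nat by lia. rewrite pow_add.
          assert (0 < xi ^ S (min j k)) by (apply pow_lt; lra).
          assert (xi ^ (j - min j k) <= 1) by (rewrite <- (pow1 (j - min j k)); apply pow_incr; lra).
          assert (0 < xi ^ (j - min j k)) by (apply pow_lt; lra). nra. }
        assert (Hi0 : 0 < / Cmod (kden p z)) by (now apply Rinv_0_lt_compat).
        replace (d ^ S l * (kweight p * / Cmod (kden p z)))
          with (kweight p * (/ Cmod (kden p z) * d ^ S l)) by ring.
        rewrite <- (tech_pow_Rmult _ (S l)). apply Rmult_le_compat_l; [apply Hg|].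
        apply Rmult_le_compat_l; [lra|]. apply pow_incr. lra. }
      apply Rle_trans with (kap * (INR (fact (S l)) * (d ^ S l * (M * w ^ j)))).
      - apply Rmult_le_compat_l; [lra|]. eapply Rle_trans; [apply Hb|].
        apply Rmult_le_compat_l; auto.
      - replace (kap * (INR (fact (S l)) * (d ^ S l * (M * w ^ j))))
          with (INR (fact (S l)) * (d ^ S l * (kap * M * w ^ j))) by ring.
        apply Rmult_le_compat_l; auto. unfold y. rewrite Rpow_mult_distr.
        apply Rmult_le_compat_l; [apply pow_le; lra|].
        rewrite <- tech_pow_Rmult.
        assert (1 <= (1 + kap * M * w ^ j) ^ l) by (apply pow_R1_Rle; lra). nra. }
    specialize (Hdb Hdv i). eapply Rle_trans; [apply Hdb|].
    pose proof (Hfsmall kap K j t Hkap Hj Hnear) as Hfs. fold v in Hfs. fold z in Hfs.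
    assert (Hmain : y ^ i * exp (- (kap / 196 * w ^ j)) <= ((1 + M) / xi / xi * INR N) ^ i * B2).
    { assert (Hexp0 : 0 < exp (- (kap / 196 * w ^ j))) by apply exp_pos.
      assert (HJp : 0 < xi ^ J) by (apply pow_lt; lra).
      assert (Hbase : (1 + M) / xi * / xi ^ J <= (1 + M) / xi / xi * INR N).
      { replace ((1 + M) / xi / xi * INR N) with ((1 + M) / xi * (INR N / xi)) by (field; lra).
        apply Rmult_le_compat_l; auto. apply Rdiv_le_0_compat; lra. }
      assert (Hbase0 : 0 < (1 + M) / xi * / xi ^ J).
      { apply Rmult_lt_0_compat; [apply Rdiv_lt_0_compat; lra|now apply Rinv_0_lt_compat]. }
      destruct (Nat.le_gt_cases J j) as [HJj|HJj].
      (* Closer to the set than the scale 1 / N: with e = j - J, y exceeds the scale by at most (w /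
         xi)^e up to a constant, while kappa w^j = w^e makes |f| at most a multiple of exp(- w^e /
         196). *)
      - replace j with (J + (j - J))%nat in y, d, Hexp0 |- * by lia.
        assert (Hkw : forall e, kap * w ^ (J + e) = w ^ e).
        { intros e. unfold kap. rewrite pow_add. field. apply pow_nonzero. lra. }
        set (e := (j - J)%nat).
        assert (He1 : 1 <= w ^ e) by (apply pow_R1_Rle; lra).
        assert (Hye : y <= ((1 + M) / xi * / xi ^ J) * (w / xi) ^ e).
        { unfold y, d. replace j with (J + e)%nat by (unfold e; lia).
          replace (kap * M * w ^ (J + e)) with (M * (kap * w ^ (J + e))) by ring. rewrite Hkw.
          replace ((1 + M) / xi * / xi ^ J * (w / xi) ^ e) with
            (/ xi ^ S (J + e) * ((1 + M) * w ^ e)).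
          - apply Rmult_le_compat_l; [|nra].
            apply Rlt_le, Rinv_0_lt_compat, pow_lt; lra.
          - unfold Rdiv. rewrite Rpow_mult_distr, pow_inv, <- tech_pow_Rmult, pow_add.
            field. repeat split; try lra; apply pow_nonzero; lra. }
        apply Rle_trans with (((1 + M) / xi * / xi ^ J) ^ i * B2).
        2:{ apply Rmult_le_compat_r; [unfold B2; lra|]. apply pow_incr. lra. }
        apply Rle_trans with ((((1 + M) / xi * / xi ^ J) * (w / xi) ^ e) ^ i
           * exp (- (/ 196 * w ^ e))).
        + apply Rmult_le_compat.
          * now apply pow_le.
          * apply Rlt_le, exp_pos.
          * apply pow_incr. split; auto.
          * apply exp_le. replace j with (J + e)%nat by (unfold e; lia).
            replace (kap / 196 * w ^ (J + e)) with (/ 196 * (kap * w ^ (J + e))) by field.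
            rewrite Hkw. lra.
        + rewrite Rpow_mult_distr, Rmult_assoc. apply Rmult_le_compat_l; [apply pow_le; lra|].
          specialize (Hgap e). rewrite <- pow_mult, Nat.mul_comm, pow_mult. unfold B2. lra.
      (* Farther than the scale 1 / N: kappa w^j <= 1, so the potential is harmless and y is of
         order N by itself. *)
      - assert (Hye : y <= (1 + M) / xi * / xi ^ J).
        { unfold y.
          assert (Hdj : d <= / xi ^ J).
          { unfold d. apply Rinv_le_contravar; auto.
            replace J with (S j + (J - S j))%nat by lia. rewrite pow_add.
            assert (xi ^ (J - S j) <= 1) by (rewrite <- (pow1 (J - S j)); apply pow_incr; lra). nra. }
          assert (Hkw : kap * w ^ j <= 1).
          { unfold kap. assert (w ^ j <= w ^ J) by (apply Rle_pow; [lra|lia]).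
            apply Rmult_le_reg_l with (w ^ J); [lra|].
            rewrite <- Rmult_assoc, Rinv_r; lra. }
          replace ((1 + M) / xi * / xi ^ J) with (/ xi ^ J * ((1 + M) * / xi)) by (field; lra).
          apply Rmult_le_compat; try lra.
          assert (1 <= / xi) by (rewrite <- Rinv_1; apply Rinv_le_contravar; lra).
          assert (kap * M * w ^ j <= M) by nra. nra. }
        apply Rmult_le_compat; try lra.
        + now apply pow_le.
        + apply pow_incr. lra.
        + rewrite <- exp_0 in *. apply Rle_trans with (exp 0).
          * apply exp_le. assert (0 <= kap / 196 * w ^ j) by (apply Rmult_le_pos; lra). lra.
          * rewrite exp_0. unfold B2. lra. }
    apply Rle_trans with (pexp_const i * y ^ i * (E * exp (- (kap / 196 * w ^ j)))).
    - apply Rmult_le_compat_l; auto. apply Rmult_le_pos; [lra|now apply pow_le].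
    - replace (pexp_const i * y ^ i * (E * exp (- (kap / 196 * w ^ j)))) with
        (pexp_const i * E * (y ^ i * exp (- (kap / 196 * w ^ j)))) by ring.
      replace (pexp_const i * ((1 + M) / xi / xi) ^ i * B2 * E * INR N ^ i) with
        (pexp_const i * E * (((1 + M) / xi / xi * INR N) ^ i * B2))
        by (rewrite Rpow_mult_distr; ring).
      apply Rmult_le_compat_l; auto. apply Rmult_le_pos; lra. }
  destruct (exists_common_bound Q) with (n := P) as (A & HA & HQA); auto.
  { intros i x y Hx Hxy N J HN HJ HJ' K t Ht. eapply Rle_trans; [exact (Hx N J HN HJ HJ' K t Ht)|].
    apply Rmult_le_compat_r; auto. apply pow_le, pos_INR. }
  (* One E bounds exp(kappa U) at radius 1 - xi^J, the other one the normalisation at the origin; 9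
     comes from [half_pow_lower]. *)
  set (Bc := 9 * (E * E)). assert (HBc : 0 < Bc) by (unfold Bc; nra).
  exists (Bc + 2 ^ P * A * Bc).
  assert (H2P : 0 < 2 ^ P) by (apply pow_lt; lra).
  assert (HAB : 0 < 2 ^ P * A * Bc) by (apply Rmult_lt_0_compat; [apply Rmult_lt_0_compat|]; auto).
  split; [lra|].
  intros N HN. assert (HN0 : 2 <= INR N) by (apply (le_INR 2); auto).
  destruct (geometric_scale xi N ltac:(lra) HN) as (J & HJ & HJ').
  set (kap := / w ^ J). pose proof (Hkap J) as HkJ. fold kap in HkJ.
  set (v := fun K n => (RtoC (- kap) * pot K n)%C).
  assert (Hv : forall K, geo (v K)) by (intros; now apply geo_scal).
  set (v' := fun K n => (RtoC (-1) * v K n)%C).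
  assert (Hv' : forall K, geo (v' K)) by (intros; now apply geo_scal).
  exists (fun K => pexp (deriv (v K))), (fun K => pexp (deriv (v' K))).
  assert (Hgf : forall K, geo (pexp (deriv (v K)))) by (intros; now apply geo_pexp, geo_deriv).
  assert (Hgc : forall K, geo (pexp (deriv (v' K)))) by (intros; now apply geo_pexp, geo_deriv).
  assert (Hc2 : forall K, l2_le (trunc N (pexp (deriv (v' K)))) Bc).
  { intros K m. set (c := pexp (deriv (v' K))).
    (* At this radius every pole of step k is at distance at least xi^k + xi^J, so the potential is
       O(w^J) = O(1 / kappa) and 1 / f is bounded; and r >= 1 - 1 / N. *)
    set (r := 1 - xi ^ J).
    assert (HxJ : 0 < xi ^ J) by (apply pow_lt; lra).
    assert (HNinv0 : 0 < / INR N) by (apply Rinv_0_lt_compat; lra).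
    assert (HNinv : / INR N <= / 2) by (apply Rinv_le_contravar; lra).
    assert (Hr : 1 - / INR N <= r <= 1) by (unfold r; lra).
    assert (Hbes : forall n, rsum (fun n => Cmod (c n * RtoC (r ^ n))%C ^ 2) n <= (E * E) ^ 2).
    { apply bessel; [apply geo_shrink; [lra|apply Hgc]|nra|].
      intros t Ht. rewrite ev_shrink.
      set (z := (RtoC r * cis (2 * PI * t))%C).
      assert (Hz : Cmod z <= 1).
      { unfold z. rewrite Cmod_mult, Cmod_cis, Cmod_R, Rabs_pos_eq; lra. }
      unfold c. rewrite Cmod_pexp by auto.
      unfold v', v. rewrite !ev_scal by auto using geo_scal.
      unfold E. rewrite <- exp_plus. apply exp_le.
      rewrite !re_scal_l.
      assert (Hre : Re (ev (pot K) z) <= M * w ^ J).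
      { eapply Rle_trans; [apply Rle_abs|]. eapply Rle_trans; [apply re_le_Cmod|].
        pose proof (kser_bound 0 (levels xi w K) z (levels_good xi w Hxi Hw K) Hz) as Hb.
        change (derivn 0 ?a) with a in Hb. fold (pot K) in Hb.
        eapply Rle_trans; [apply Hb|]. simpl (INR (fact 0)). rewrite Rmult_1_l.
        rewrite (lsum_ext _ (fun p => kweight p * / Cmod (kden p z))).
        2:{ intros p _. now rewrite pow_1. }
        apply Hup; try lra. intros k th Hk Hth. fold z.
        assert (Hxk : 0 < xi ^ k) by (apply pow_lt; lra).
        apply Rle_trans with (xi ^ k + xi ^ J).
        - assert (Hmin : xi ^ min J k <= xi ^ k + xi ^ J).
          { destruct (Nat.min_spec J k) as [[_ ->]|[_ ->]]; lra. }
          assert (0 < xi ^ min J k) by (apply pow_lt; lra). simpl. nra.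
        - unfold z. rewrite kden_polar. cbn [fst snd].
          pose proof (Cmod_triangle (RtoC (1 + xi ^ k) - RtoC r * cis (2 * PI * (t - th)))%C
            (RtoC r * cis (2 * PI * (t - th)))%C) as Htr.
          replace (RtoC (1 + xi ^ k) - RtoC r * cis (2 * PI * (t - th)) +
        RtoC r * cis (2 * PI * (t - th)))%C with (RtoC (1 + xi ^ k)) in Htr by ring.
          rewrite (Cmod_mult (RtoC r)), Cmod_cis, !Cmod_R, !Rabs_pos_eq in Htr by lra.
          unfold r in *. lra. }
      pose proof (Hcenter K) as Hc. apply Rabs_le_between in Hc.
      set (u := Re (ev (pot K) z)) in *. set (u0 := Re (pot K O)) in *.
      replace (-1 * (- kap * u) - -1 * (- kap * u0)) with (kap * u + kap * (- u0)) by ring.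
      apply Rplus_le_compat; [|nra].
      apply Rle_trans with (kap * (M * w ^ J)); [apply Rmult_le_compat_l; lra|].
      apply Req_le. unfold kap. field. apply pow_nonzero. lra. }
    apply Rle_trans with (rsum (fun n => Cmod (trunc N c n) ^ 2) N).
    { destruct (Nat.le_gt_cases m N) as [Hm|Hm].
      - pose proof (rsum_split (fun n => Cmod (trunc N c n) ^ 2) m (N - m)) as Hsp.
        replace (m + (N - m))%nat with N in Hsp by lia. rewrite Hsp.
        assert (0 <= rsum (fun k => Cmod (trunc N c (m + k)) ^ 2) (N - m)); [|lra].
        apply rsum_nonneg. intros; apply pow2_ge_0.
      - pose proof (rsum_split (fun n => Cmod (trunc N c n) ^ 2) N (m - N)) as Hsp.
        replace (N + (m - N))%nat with m in Hsp by lia. rewrite Hsp.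
        rewrite (rsum_ext (fun k => Cmod (trunc N c (N + k)) ^ 2) (fun _ => 0)).
        + rewrite rsum_const. lra.
        + intros k _. unfold trunc. destruct (Nat.ltb_spec (N + k) N); [lia|].
          rewrite Cmod_0. ring. }
    apply Rle_trans with (rsum (fun n => 81 * Cmod (c n * RtoC (r ^ n))%C ^ 2) N).
    { apply rsum_le. intros n Hn. unfold trunc. destruct (Nat.ltb_spec n N); [|lia].
      rewrite Cmod_mult, Cmod_R.
      assert (Hrn : / 9 <= r ^ n).
      { eapply Rle_trans; [apply (half_pow_lower N HN)|].
        pose proof (pow_add (1 - / INR N) n (N - n)) as Hsp.
        replace (n + (N - n))%nat with N in Hsp by lia. rewrite Hsp.
        assert (H0 : 0 <= 1 - / INR N) by lra.
        assert ((1 - / INR N) ^ n <= r ^ n) by (apply pow_incr; lra).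
        assert (0 <= (1 - / INR N) ^ n) by (now apply pow_le).
        assert ((1 - / INR N) ^ (N - n) <= 1).
        { apply Rle_trans with (1 ^ (N - n)); [apply pow_incr; lra|rewrite pow1; lra]. }
        apply Rle_trans with ((1 - / INR N) ^ n * 1); [now apply Rmult_le_compat_l|lra]. }
      rewrite Rabs_pos_eq by lra.
      replace (81 * (Cmod (c n) * r ^ n) ^ 2) with ((Cmod (c n) * (9 * r ^ n)) ^ 2) by ring.
      apply pow_incr. pose proof (Cmod_ge_0 (c n)). split; [auto|].
      rewrite <- (Rmult_1_r (Cmod (c n))) at 1. apply Rmult_le_compat_l; lra. }
    rewrite rsum_scal. specialize (Hbes N).
    replace (Bc ^ 2) with (81 * (E * E) ^ 2) by (unfold Bc; ring). lra. }
  split; [auto|]. split; [|split; [|split]].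
  - intros K n. apply pexp_inverse. auto.
  - exists E, (kap / 196). split; [auto|]. split; [lra|].
    intros K j t Hj Hnear. now apply Hfsmall.
  - intros K n Hn. apply Rle_trans with Bc; [|lra].
    apply Rle_sqr; [lra|]. eapply Rle_trans; [|apply (Hc2 K (S n))].
    cbn [rsum]. unfold trunc at 2. destruct (Nat.ltb_spec n N); [|lia].
    assert (0 <= rsum (fun n => Cmod (trunc N (pexp (deriv (v' K))) n) ^ 2) n); [|lra].
    apply rsum_nonneg. intros; apply pow2_ge_0.
  - intros K m.
    assert (Hl2 : l2_le (derivn P (conv (pexp (deriv (v K))) (trunc N (pexp (deriv (v' K))))))
      (2 ^ P * A * Bc * INR N ^ P)).
    { apply l2_derivn_conv; auto using geo_trunc, pos_INR.
      - lra.
      - intros i t Hi Ht. now apply (HQA i Hi N J).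
      - intros i _. apply l2_derivn_finite; auto.
        intros n Hn. unfold trunc. destruct (Nat.ltb_spec n N); [lia|auto]. }
    eapply Rle_trans; [apply Hl2|].
    assert (0 < INR N ^ P) by (apply pow_lt; lra).
    apply pow_incr. split.
    + apply Rmult_le_pos; lra.
    + apply Rmult_le_compat_r; lra.
Qed.

End Peak.

(** * Linear identities in a complex module *)

Inductive vexpr : Type :=
  | VZero : vexpr
  | VAtom : nat -> vexpr
  | VPlus : vexpr -> vexpr -> vexpr
  | VOpp : vexpr -> vexpr
  | VScal : C -> vexpr -> vexpr.

Section Vexpr.

Context {V : ModuleSpace C_AbsRing}.

Fixpoint vden (env : list V) (e : vexpr) : V :=
  match e with
  | VZero => zero
  | VAtom n => nth n env zero
  | VPlus a b => plus (vden env a) (vden env b)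
  | VOpp a => opp (vden env a)
  | VScal c a => @scal C_AbsRing V c (vden env a)
  end.

Fixpoint vcoef (e : vexpr) (n : nat) : C :=
  match e with
  | VZero => RtoC 0
  | VAtom m => if Nat.eqb m n then RtoC 1 else RtoC 0
  | VPlus a b => (vcoef a n + vcoef b n)%C
  | VOpp a => (- vcoef a n)%C
  | VScal c a => (c * vcoef a n)%C
  end.

Fixpoint vlin (env : list V) (f : nat -> C) : V :=
  match env with
  | nil => zero
  | x :: env => plus (@scal C_AbsRing V (f O) x) (vlin env (fun n => f (S n)))
  end.

Lemma vlin_ext env : forall f g, (forall n, (n < length env)%nat -> f n = g n) -> vlin env f = vlin env g.
Proof.
  induction env as [|x env IH]; cbn [vlin]; intros f g H; auto.
  rewrite (H O) by (simpl; lia). f_equal. apply IH. intros n Hn. apply H. simpl. lia.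
Qed.

Lemma vlin_zero env : vlin env (fun _ => RtoC 0) = zero.
Proof.
  induction env as [|x env IH]; cbn [vlin]; auto. rewrite IH, plus_zero_r.
  apply (scal_zero_l (K := C_AbsRing)).
Qed.

Lemma vlin_plus env : forall f g, vlin env (fun n => (f n + g n)%C) = plus (vlin env f) (vlin env g).
Proof.
  induction env as [|x env IH]; cbn [vlin]; intros f g; [now rewrite plus_zero_l|].
  rewrite IH.
  pose proof (scal_distr_r (K := C_AbsRing) (f O) (g O) x) as H.
  change (plus (f O) (g O)) with (f O + g O)%C in H. rewrite H.
  rewrite <- !plus_assoc. f_equal. rewrite !plus_assoc. f_equal. apply plus_comm.
Qed.

Lemma vlin_scal env c : forall f, vlin env (fun n => (c * f n)%C) = @scal C_AbsRing V c (vlin env f).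
Proof.
  induction env as [|x env IH]; cbn [vlin]; intros f; [now rewrite scal_zero_r|].
  rewrite IH.
  pose proof (scal_assoc (K := C_AbsRing) c (f O) x) as H.
  change (mult c (f O)) with (c * f O)%C in H. rewrite <- H. symmetry. apply (scal_distr_l (K := C_AbsRing)).
Qed.

Lemma vlin_atom env : forall m, vlin env (fun n => if Nat.eqb m n then RtoC 1 else RtoC 0) = nth m env zero.
Proof.
  induction env as [|x env IH]; intros [|m]; cbn [vlin nth Nat.eqb]; auto.
  - rewrite vlin_zero, plus_zero_r. apply (scal_one (K := C_AbsRing)).
  - rewrite IH. replace (@scal C_AbsRing V (RtoC 0) x) with (@zero V); [apply plus_zero_l|].
    symmetry. apply (scal_zero_l (K := C_AbsRing)).
Qed.

Lemma opp_scal (x : V) : opp x = @scal C_AbsRing V (- RtoC 1)%C x.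
Proof. symmetry. apply (scal_opp_one (K := C_AbsRing)). Qed.

Lemma vden_vlin env e : vden env e = vlin env (vcoef e).
Proof.
  induction e; cbn [vden vcoef].
  - symmetry. apply vlin_zero.
  - symmetry. apply vlin_atom.
  - now rewrite IHe1, IHe2, <- vlin_plus.
  - rewrite IHe, opp_scal, <- vlin_scal. apply vlin_ext. intros k _. ring.
  - now rewrite IHe, <- vlin_scal.
Qed.

Lemma vexpr_eq env e1 e2 : (forall n, (n < length env)%nat -> vcoef e1 n = vcoef e2 n) ->
  vden env e1 = vden env e2.
Proof. intros H. rewrite !vden_vlin. now apply vlin_ext. Qed.

End Vexpr.

Ltac vmem x l :=
  match l with
  | nil => constr:(false)
  | cons x _ => constr:(true)
  | cons _ ?l => vmem x l
  end.

Ltac vindex x l :=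
  match l with
  | cons x _ => constr:(O)
  | cons _ ?l => let n := vindex x l in constr:(S n)
  end.

Ltac vatoms t l :=
  match t with
  | plus ?a ?b => let l := vatoms a l in vatoms b l
  | minus ?a ?b => let l := vatoms a l in vatoms b l
  | opp ?a => vatoms a l
  | scal _ ?a => vatoms a l
  | zero => l
  | _ => match vmem t l with
         | true => l
         | false => constr:(cons t l)
         end
  end.

Ltac vreify t l :=
  match t with
  | plus ?a ?b => let a := vreify a l in let b := vreify b l in constr:(VPlus a b)
  | minus ?a ?b => let a := vreify a l in let b := vreify b l in constr:(VPlus a (VOpp b))
  | opp ?a => let a := vreify a l in constr:(VOpp a)
  | scal ?c ?a => let a := vreify a l in constr:(VScal c a)
  | zero => constr:(VZero)
  | _ => let n := vindex t l in constr:(VAtom n)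
  end.

(* Decides linear identities: the coefficients of every atom are compared by [ring]. *)
Ltac vring :=
  match goal with
  | |- @eq ?V ?a ?b =>
    let l := vatoms a (@nil V) in
    let l := vatoms b l in
    let ea := vreify a l in
    let eb := vreify b l in
    change (vden l ea = vden l eb);
    apply vexpr_eq;
    let n := fresh "n" in let Hn := fresh "Hn" in
    intros n Hn; cbn [length] in Hn;
    repeat first [exfalso; lia | destruct n as [|n]; [cbn [vcoef Nat.eqb]; ring|]]
  end.

Section Norm.

Context {V : NormedModule C_AbsRing}.

Lemma norm_scal_le (c : C) (x : V) : norm (scal c x) <= Cmod c * norm x.
Proof. apply (norm_scal c x). Qed.

Lemma norm_plus_le (x y : V) : norm (plus x y) <= norm x + norm y.
Proof. apply norm_triangle. Qed.

Lemma norm_minus_le (x y : V) : norm (minus x y) <= norm x + norm y.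
Proof. unfold minus. rewrite <- (norm_opp y). apply norm_triangle. Qed.

Lemma norm_nonneg (x : V) : 0 <= norm x.
Proof. apply norm_ge_0. Qed.

Lemma is_linear_minus (A : V -> V) (HA : is_linear A) x y : A (minus x y) = minus (A x) (A y).
Proof.
  unfold minus. rewrite (linear_plus A HA), !(opp_scal (V := V)), (linear_scal A HA). reflexivity.
Qed.

Lemma linear_bound (A : V -> V) (HA : is_linear A) :
  exists M, 1 <= M /\ forall x, norm (A x) <= M * norm x.
Proof.
  destruct (linear_norm A HA) as (M & HM & H). exists (M + 1). split; [lra|].
  intros x. specialize (H x). pose proof (norm_nonneg x). lra.
Qed.

End Norm.

(** * Growth of the resolvent near the unit circle *)

Lemma Rpower_div a b g : 0 < a -> 0 < b -> Rpower (a / b) g = Rpower a g * Rpower b (- g).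
Proof.
  intros Ha Hb. unfold Rdiv. rewrite <- Rpower_mult_distr; [|lra|apply Rinv_0_lt_compat; lra].
  f_equal. unfold Rpower. rewrite ln_Rinv by lra. f_equal. ring.
Qed.

(** Source of the exponent gamma = beta / (1 - beta): B k^beta is below k x / 2 once k^(1 - beta) >=
    2 B / x, and before that it is below its value at this threshold. *)
Lemma sub_exponential_bound beta B x n : 0 < beta < 1 -> 0 < B -> 0 < x <= 1 ->
  B * Rpower (INR (S n)) beta <= B * Rpower (2 * B) (beta / (1 - beta)) * Rpower x (- (beta / (1 - beta)))
    + INR (S n) * (x / 2).
Proof.
  intros Hb HB Hx. set (gam := beta / (1 - beta)).
  assert (Hg : 0 < gam) by (apply Rdiv_lt_0_compat; lra).
  rewrite Rmult_assoc, <- Rpower_div by lra.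
  set (X := 2 * B / x). assert (HX : 0 < X) by (apply Rdiv_lt_0_compat; lra).
  assert (HXg : 0 < B * Rpower X gam) by (apply Rmult_lt_0_compat; [lra|apply exp_pos]).
  set (k := INR (S n)). assert (Hk : 0 < k) by (apply lt_0_INR; lia).
  destruct (Rle_dec k (Rpower X (/ (1 - beta)))) as [H|H].
  - assert (H1 : Rpower k beta <= Rpower X gam).
    { unfold gam, Rdiv. rewrite (Rmult_comm beta), <- Rpower_mult.
      apply Rle_Rpower_l; lra. }
    assert (0 <= k * (x / 2)) by (apply Rmult_le_pos; lra).
    assert (B * Rpower k beta <= B * Rpower X gam) by (apply Rmult_le_compat_l; lra). lra.
  - apply Rnot_le_lt in H.
    assert (H1 : X <= Rpower k (1 - beta)).
    { apply Rle_trans with (Rpower (Rpower X (/ (1 - beta))) (1 - beta)).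
      - rewrite Rpower_mult, Rinv_l, Rpower_1 by lra. lra.
      - apply Rle_Rpower_l; [lra|]. split; [apply exp_pos|lra]. }
    assert (H2 : Rpower k beta * Rpower k (1 - beta) = k).
    { rewrite <- Rpower_plus. replace (beta + (1 - beta)) with 1 by ring. now apply Rpower_1. }
    assert (HP : 0 < Rpower k beta) by apply exp_pos.
    assert (H3 : Rpower k beta * X <= k).
    { rewrite <- H2 at 2. apply Rmult_le_compat_l; lra. }
    assert (H4 : B * Rpower k beta = Rpower k beta * X * (x / 2)) by (unfold X; field; lra).
    rewrite H4. assert (Rpower k beta * X * (x / 2) <= k * (x / 2)) by (apply Rmult_le_compat_r; lra).
    lra.
Qed.

Lemma inverse_le_exp_Rpower g x : 0 < g -> 0 < x -> / x <= exp (/ g * Rpower x (- g)).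
Proof.
  intros Hg Hx.
  assert (H1 : Rpower x (- g) = exp (- g * ln x)) by reflexivity.
  replace (/ x) with (exp (- ln x)) by (rewrite exp_Ropp, exp_ln; auto).
  apply exp_le. pose proof (exp_ineq1_le (- g * ln x)) as H. rewrite <- H1 in H.
  apply Rmult_le_reg_l with g; auto. rewrite <- Rmult_assoc, Rinv_r by lra. lra.
Qed.

Lemma Rpower_neg_ge_1 x g : 0 < x <= 1 -> 0 <= g -> 1 <= Rpower x (- g).
Proof.
  intros Hx Hg. unfold Rpower. rewrite <- exp_0 at 1. apply exp_le.
  assert (ln x <= 0). { rewrite <- ln_1. apply ln_le; lra. } nra.
Qed.

Lemma const_le_exp_Rpower K x g : 0 < K -> 0 < x <= 1 -> 0 <= g ->
  K <= exp (Rabs (ln K) * Rpower x (- g)).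
Proof.
  intros HK Hx Hg. rewrite <- (exp_ln K HK) at 1. apply exp_le.
  pose proof (Rpower_neg_ge_1 x g Hx Hg). pose proof (Rle_abs (ln K)). pose proof (Rabs_pos (ln K)). nra.
Qed.

Lemma Rpower_neg_decr x y g : 0 < x <= y -> 0 <= g -> Rpower y (- g) <= Rpower x (- g).
Proof.
  intros Hx Hg. rewrite !Rpower_Ropp. apply Rinv_le_contravar; [apply exp_pos|].
  now apply Rle_Rpower_l.
Qed.

Section Resolvent.

Context {V : NormedModule C_AbsRing}.

(* Solving [y = d + q A y] by the Neumann series, with sub-exponential powers of [A]. *)
Lemma neumann_bound (A : V -> V) (M B beta : R) : is_linear A -> 0 < beta < 1 -> 0 < B -> 1 <= M ->
  (forall n x, (1 <= n)%nat -> norm (Nat.iter n A x) <= M * exp (B * Rpower (INR n) beta) * norm x) ->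
  exists c, 0 < c /\ forall (q : C) (y d : V), Cmod q < 1 -> y = plus d (scal q (A y)) ->
    norm y <= exp (c * Rpower (1 - Cmod q) (- (beta / (1 - beta)))) * norm d.
Proof.
  intros HA Hb HB HM Hpow. set (gam := beta / (1 - beta)).
  assert (Hg : 0 < gam) by (apply Rdiv_lt_0_compat; lra).
  set (b := B * Rpower (2 * B) gam). assert (Hbb : 0 < b) by (apply Rmult_lt_0_compat; [lra|apply exp_pos]).
  exists (b + / gam + Rabs (ln (3 * M))).
  split. { pose proof (Rabs_pos (ln (3 * M))). assert (0 < / gam) by (now apply Rinv_0_lt_compat). lra. }
  intros q y d Hq Hy.
  set (x := 1 - Cmod q). assert (Hx : 0 < x <= 1) by (unfold x; pose proof (Cmod_ge_0 q); lra).
  set (Z := Rpower x (- gam)). assert (HZ : 1 <= Z) by (apply Rpower_neg_ge_1; lra).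
  set (K := M * exp (b * Z)). assert (HK : 0 < K) by (apply Rmult_lt_0_compat; [lra|apply exp_pos]).
  (* Half of the decay |q|^n <= exp(- n x) pays for the growth of the powers through
     [sub_exponential_bound]; the other half is p^n and gets summed. *)
  set (p := exp (- (x / 2))). assert (Hp0 : 0 < p) by apply exp_pos.
  assert (Hp : p <= / (1 + x / 2)).
  { unfold p. rewrite exp_Ropp. apply Rinv_le_contravar; [lra|]. apply exp_ineq1_le. }
  assert (Hp1 : p < 1).
  { eapply Rle_lt_trans; [apply Hp|]. rewrite <- Rinv_1. apply Rinv_lt_contravar; lra. }
  assert (Hterm : forall n v, Cmod q ^ n * norm (Nat.iter n A v) <= K * p ^ n * norm v).
  { intros [|n] v.
    - simpl. assert (1 <= K).
      { unfold K. assert (1 <= exp (b * Z)) by (pose proof (exp_ineq1_le (b * Z)); nra). nra. }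
      pose proof (norm_nonneg v). nra.
    - pose proof (norm_nonneg v) as Hv.
      assert (Hqn : Cmod q ^ S n <= exp (- (INR (S n) * x))).
      { replace (exp (- (INR (S n) * x))) with (exp (- x) ^ S n) by (rewrite exp_pow_nat; f_equal; ring).
        apply pow_incr. split; [apply Cmod_ge_0|]. pose proof (exp_ineq1_le (- x)). unfold x in *. lra. }
      specialize (Hpow (S n) v ltac:(lia)).
      pose proof (sub_exponential_bound beta B x n Hb HB Hx) as Hs. fold gam in Hs. fold b in Hs. fold Z in Hs.
      apply Rle_trans with (exp (- (INR (S n) * x)) * (M * exp (B * Rpower (INR (S n)) beta) * norm v)).
      + apply Rmult_le_compat; auto; [apply pow_le, Cmod_ge_0|apply norm_nonneg].
      + unfold K, p. rewrite exp_pow_nat.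
        replace (exp (- (INR (S n) * x)) * (M * exp (B * Rpower (INR (S n)) beta) * norm v)) with
          (M * exp (B * Rpower (INR (S n)) beta - INR (S n) * x) * norm v).
        * replace (M * exp (b * Z) * exp (INR (S n) * - (x / 2)) * norm v) with
            (M * exp (b * Z + INR (S n) * - (x / 2)) * norm v) by (rewrite exp_plus; ring).
          apply Rmult_le_compat_r; auto. apply Rmult_le_compat_l; [lra|]. apply exp_le. lra.
        * unfold Rminus. rewrite exp_plus. ring. }
  assert (Hit : forall n, norm y <= rsum (fun n => K * p ^ n * norm d) n + K * p ^ n * norm y).
  { assert (Hit : forall n, norm y <= rsum (fun n => K * p ^ n * norm d) n + Cmod q ^ n * norm (Nat.iter n A y)).
    { induction n; [simpl; lra|]. eapply Rle_trans; [apply IHn|]. cbn [rsum].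
      assert (Hlin : Nat.iter n A y = plus (Nat.iter n A d) (scal q (Nat.iter (S n) A y))).
      { assert (HAn : forall u v, Nat.iter n A (plus u v) = plus (Nat.iter n A u) (Nat.iter n A v)).
        { clear -HA. induction n; intros u v; simpl; auto. now rewrite IHn, (linear_plus A HA). }
        assert (HAs : forall u, Nat.iter n A (scal q u) = scal q (Nat.iter n A u)).
        { clear -HA. induction n; intros u; simpl; auto. now rewrite IHn, (linear_scal A HA). }
        rewrite Hy at 1. rewrite HAn, HAs. do 2 f_equal. symmetry. apply Nat.iter_succ_r. }
      rewrite Hlin at 1.
      assert (norm (plus (Nat.iter n A d) (scal q (Nat.iter (S n) A y))) <=
        norm (Nat.iter n A d) + Cmod q * norm (Nat.iter (S n) A y)).
      { eapply Rle_trans; [apply norm_plus_le|]. apply Rplus_le_compat_l, norm_scal_le. }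
      assert (Hq0 : 0 <= Cmod q ^ n) by (apply pow_le, Cmod_ge_0).
      pose proof (Hterm n d). rewrite <- tech_pow_Rmult.
      apply Rle_trans with (rsum (fun n => K * p ^ n * norm d) n + Cmod q ^ n *
        (norm (Nat.iter n A d) + Cmod q * norm (Nat.iter (S n) A y))).
      - apply Rplus_le_compat_l, Rmult_le_compat_l; auto.
      - lra. }
    intros n. eapply Rle_trans; [apply (Hit n)|]. apply Rplus_le_compat_l, Hterm. }
  pose proof (norm_nonneg y) as Hy0. pose proof (norm_nonneg d) as Hd0.
  assert (Hlim : norm y <= K * norm d * (3 / x)).
  { apply (le_epsilon_mult _ _ (K * norm y)). intros e He.
    destruct (pow_small p e) as [n Hn]; [lra|auto|]. specialize (Hn n (le_n _)).
    eapply Rle_trans; [apply (Hit n)|]. apply Rplus_le_compat.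
    - rewrite (rsum_ext _ (fun n => K * norm d * p ^ n)) by (intros; ring).
      rewrite rsum_scal, rsum_geom by lra.
      apply Rmult_le_compat_l; [apply Rmult_le_pos; lra|].
      assert (Hpn : 0 < p ^ n) by (now apply pow_lt).
      apply Rle_trans with (/ (1 - p)).
      + unfold Rdiv. rewrite <- (Rmult_1_l (/ (1 - p))) at 2. apply Rmult_le_compat_r; [|lra].
        apply Rlt_le, Rinv_0_lt_compat; lra.
      + replace (3 / x) with (/ (x / 3)) by (field; lra).
        apply Rinv_le_contravar; [lra|].
        assert (/ (1 + x / 2) <= 1 - x / 3).
        { apply Rmult_le_reg_r with (1 + x / 2); [lra|]. rewrite Rinv_l by lra. nra. }
        lra.
    - replace (K * norm y * e) with (K * e * norm y) by ring.
      apply Rmult_le_compat_r; auto. apply Rmult_le_compat_l; lra. }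
  eapply Rle_trans; [apply Hlim|].
  replace (K * norm d * (3 / x)) with (exp (b * Z) * / x * (3 * M) * norm d) by (unfold K; field; lra).
  apply Rmult_le_compat_r; auto.
  rewrite !Rmult_plus_distr_r, !exp_plus.
  pose proof (inverse_le_exp_Rpower gam x Hg (proj1 Hx)) as H1. fold Z in H1.
  pose proof (const_le_exp_Rpower (3 * M) x gam ltac:(lra) Hx ltac:(lra)) as H2. fold Z in H2.
  assert (0 < exp (b * Z)) by apply exp_pos.
  assert (0 < / x) by (now apply Rinv_0_lt_compat).
  apply Rmult_le_compat; auto; try lra.
  - apply Rmult_le_pos; lra.
  - apply Rmult_le_compat_l; lra.
Qed.

(* [bdd_below T z B]: the resolvent of [T] at [z] is bounded by [B] wherever it exists. *)
Definition bdd_below (T : V -> V) (z : C) (B : R) : Prop :=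
  forall y, norm y <= B * norm (minus (T y) (scal z y)).

Lemma bdd_below_weaken T z B B' : B <= B' -> bdd_below T z B -> bdd_below T z B'.
Proof.
  intros H Hb y. eapply Rle_trans; [apply Hb|]. apply Rmult_le_compat_r; auto. apply norm_nonneg.
Qed.

Lemma bdd_below_near T z z' B : 0 < B -> bdd_below T z B -> Cmod (z' - z)%C <= / (2 * B) ->
  bdd_below T z' (2 * B).
Proof.
  intros HB H Hz y. specialize (H y).
  assert (He : minus (T y) (scal z y) = plus (minus (T y) (scal z' y)) (scal (z' - z)%C y)).
  { vring. }
  rewrite He in H.
  assert (Hn : norm (plus (minus (T y) (scal z' y)) (scal (z' - z)%C y))
    <= norm (minus (T y) (scal z' y)) + / (2 * B) * norm y).
  { eapply Rle_trans; [apply norm_plus_le|]. apply Rplus_le_compat_l.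
    eapply Rle_trans; [apply norm_scal_le|]. apply Rmult_le_compat_r; auto. apply norm_nonneg. }
  assert (H2 : norm y <= B * (norm (minus (T y) (scal z' y)) + / (2 * B) * norm y)).
  { eapply Rle_trans; [apply H|]. apply Rmult_le_compat_l; lra. }
  replace (B * (norm (minus (T y) (scal z' y)) + / (2 * B) * norm y))
    with (B * norm (minus (T y) (scal z' y)) + norm y / 2) in H2 by (field; lra).
  lra.
Qed.

(** With d = (T - z) y, one has y = S d + z S y, used inside the circle, and y = - d / z + T y / z,
    used outside: both are Neumann equations. The restriction |z| <= 2 makes 1 - 1 / |z| comparable
    to |z| - 1. *)
Lemma resolvent_direct_bound (T S : V -> V) (M B beta : R) :
  is_linear T -> is_linear S -> (forall x, S (T x) = x) -> (forall x, T (S x) = x) ->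
  0 < beta < 1 -> 0 < B -> 1 <= M ->
  (forall n x, (1 <= n)%nat -> norm (Nat.iter n T x) <= M * exp (B * Rpower (INR n) beta) * norm x) ->
  (forall n x, (1 <= n)%nat -> norm (Nat.iter n S x) <= M * exp (B * Rpower (INR n) beta) * norm x) ->
  exists c, 0 < c /\ forall z, Cmod z <= 2 -> Cmod z <> 1 ->
    bdd_below T z (exp (c * Rpower (Rabs (Cmod z - 1)) (- (beta / (1 - beta))))).
Proof.
  intros HT HS HST HTS Hb HB HM HpT HpS.
  set (gam := beta / (1 - beta)).
  assert (Hg : 0 < gam) by (apply Rdiv_lt_0_compat; lra).
  destruct (neumann_bound T M B beta HT Hb HB HM HpT) as (c1 & Hc1 & H1).
  destruct (neumann_bound S M B beta HS Hb HB HM HpS) as (c2 & Hc2 & H2).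
  fold gam in H1, H2.
  destruct (linear_bound S HS) as (K & HK & HSK).
  set (t := Rpower 2 gam). assert (Ht : 0 < t) by apply exp_pos.
  exists (c1 * t + c2 + Rabs (ln K)). pose proof (Rabs_pos (ln K)) as Hl.
  assert (Hct : 0 < c1 * t) by (now apply Rmult_lt_0_compat).
  split; [lra|]. intros z Hz2 Hz1 y.
  set (d := minus (T y) (scal z y)). pose proof (norm_nonneg d) as Hd.
  pose proof (Cmod_ge_0 z) as Hz0.
  destruct (Rlt_dec (Cmod z) 1) as [Hlt|Hge].
  - rewrite (Rabs_left (Cmod z - 1)) by lra. replace (- (Cmod z - 1)) with (1 - Cmod z) by ring.
    set (Z := Rpower (1 - Cmod z) (- gam)).
    assert (HZ : 1 <= Z) by (apply Rpower_neg_ge_1; lra).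
    assert (Hy : y = plus (S d) (scal z (S y))).
    { unfold d. rewrite (is_linear_minus S HS), (linear_scal S HS), HST. vring. }
    specialize (H2 z y (S d) Hlt Hy). fold Z in H2.
    eapply Rle_trans; [apply H2|].
    apply Rle_trans with (exp (c2 * Z) * K * norm d).
    + rewrite Rmult_assoc. apply Rmult_le_compat_l; [apply Rlt_le, exp_pos|apply HSK].
    + apply Rmult_le_compat_r; auto.
      pose proof (const_le_exp_Rpower K (1 - Cmod z) gam ltac:(lra) ltac:(lra) ltac:(lra)) as HKe. fold Z in HKe.
      apply Rle_trans with (exp (c2 * Z) * exp (Rabs (ln K) * Z)).
      * apply Rmult_le_compat_l; [apply Rlt_le, exp_pos|auto].
      * rewrite <- exp_plus. apply exp_le. nra.
  - assert (Hgt : 1 < Cmod z) by lra. clear Hge.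
    rewrite (Rabs_pos_eq (Cmod z - 1)) by lra. set (Z := Rpower (Cmod z - 1) (- gam)).
    assert (HZ : 1 <= Z) by (apply Rpower_neg_ge_1; lra).
    assert (Hzn : z <> RtoC 0) by (intros ->; rewrite Cmod_0 in Hgt; lra).
    set (q := (/ z)%C). assert (Hqm : Cmod q = / Cmod z) by (unfold q; now rewrite Cmod_inv).
    assert (Hy : y = plus (scal (- q)%C d) (scal q (T y))).
    { unfold d. assert (Hqz : (q * z)%C = RtoC 1) by (unfold q; field; auto).
      transitivity (scal (q * z)%C y).
      - rewrite Hqz. symmetry. apply (scal_one (K := C_AbsRing)).
      - vring. }
    assert (Hq1 : Cmod q < 1).
    { rewrite Hqm, <- Rinv_1. apply Rinv_lt_contravar; lra. }
    specialize (H1 q y (scal (- q)%C d) Hq1 Hy).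
    assert (Hds : norm (scal (- q)%C d) <= norm d).
    { eapply Rle_trans; [apply norm_scal_le|]. rewrite Cmod_opp. pose proof (Cmod_ge_0 q). nra. }
    assert (HZ' : Rpower (1 - Cmod q) (- gam) <= t * Z).
    { apply Rle_trans with (Rpower ((Cmod z - 1) / 2) (- gam)).
      - apply Rpower_neg_decr; [|lra]. split; [lra|]. rewrite Hqm.
        replace (1 - / Cmod z) with ((Cmod z - 1) / Cmod z) by (field; lra).
        unfold Rdiv. apply Rmult_le_compat_l; [lra|]. apply Rinv_le_contravar; lra.
      - rewrite Rpower_div by lra. rewrite Ropp_involutive. unfold t, Z. lra. }
    eapply Rle_trans; [apply H1|].
    apply Rmult_le_compat; auto using norm_nonneg.
    + apply Rlt_le, exp_pos.
    + apply exp_le. apply Rle_trans with (c1 * (t * Z)); [apply Rmult_le_compat_l; lra|]. nra.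
Qed.

(** * Compactness *)

Definition far (E : C -> Prop) (lam : R) (z : C) : Prop :=
  Cmod z <= 2 /\ forall e, E e -> lam <= Cmod (z - e)%C.

(** Compactness of the square [-2, 2]^2 with a gauge: a point of E gets the radius lam / 4, too
    small to reach a point of [far], and any other point gets a radius on which its lower bound
    persists. The minimal radius d of the covering then bounds the resolvent. *)
Lemma resolvent_compact_bound (T : V -> V) (E : C -> Prop) lam : 0 < lam ->
  (forall z, ~ E z -> exists B, 0 < B /\ bdd_below T z B) ->
  exists B, 0 < B /\ forall z, far E lam z -> bdd_below T z B.
Proof.
  intros Hlam Hres.
  assert (Hdelta : forall u v : R, exists d : posreal,
    (E (u, v) /\ pos d = lam / 4) \/ bdd_below T (u, v) (/ (4 * d))).
  { intros u v. destruct (classic (E (u, v))) as [HE|HE].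
    - assert (H : 0 < lam / 4) by lra. exists (mkposreal _ H). left. auto.
    - destruct (Hres _ HE) as (B & HB & H).
      assert (Hd : 0 < / (4 * B)) by (apply Rinv_0_lt_compat; lra).
      exists (mkposreal _ Hd). right. simpl.
      replace (/ (4 * / (4 * B))) with B by (field; lra). exact H. }
  set (delta := fun u v => proj1_sig (constructive_indefinite_description _ (Hdelta u v))).
  assert (Hd : forall u v, (E (u, v) /\ pos (delta u v) = lam / 4) \/ bdd_below T (u, v) (/ (4 * delta u v))).
  { intros u v. exact (proj2_sig (constructive_indefinite_description _ (Hdelta u v))). }
  destruct (compactness_value_2d (-2) 2 (-2) 2 delta) as (d & Hcomp).
  pose proof (cond_pos d) as Hd0.
  exists (/ (2 * d)). split; [apply Rinv_0_lt_compat; lra|].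
  intros [x y] [Hz Hfar]. apply NNPP. intros Hcontra.
  assert (Hx : -2 <= x <= 2).
  { pose proof (re_le_Cmod (x, y)) as H. simpl in H. apply Rabs_le_between. lra. }
  assert (Hy : -2 <= y <= 2).
  { pose proof (im_le_Cmod (x, y)) as H. simpl in H. apply Rabs_le_between. lra. }
  apply (Hcomp x y Hx Hy). intros (u & v & _ & _ & Hu & Hv & Hle). apply Hcontra.
  assert (Hclose : Cmod ((x, y) - (u, v))%C <= 2 * delta u v).
  { eapply Rle_trans; [apply Cmod_le_Re_Im|]. simpl. unfold Rminus in *. lra. }
  destruct (Hd u v) as [[HE Heq]|Hb].
  - specialize (Hfar _ HE). lra.
  - assert (Hp : 0 < delta u v) by apply cond_pos.
    apply (bdd_below_weaken T _ (2 * / (4 * delta u v))).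
    + replace (2 * / (4 * delta u v)) with (/ (2 * delta u v)) by (field; lra).
      apply Rinv_le_contravar; lra.
    + apply (bdd_below_near T (u, v)); auto.
      * apply Rinv_0_lt_compat; lra.
      * replace (/ (2 * / (4 * delta u v))) with (2 * delta u v) by (field; lra). exact Hclose.
Qed.

End Resolvent.

(** * Mean value inequality for vector valued functions *)

Section MeanValue.

Context {V : NormedModule C_AbsRing}.

Fixpoint vsum (f : nat -> V) (n : nat) : V :=
  match n with O => zero | S n => plus (vsum f n) (f n) end.

Lemma vsum_ext f g n : (forall k, (k < n)%nat -> f k = g k) -> vsum f n = vsum g n.
Proof. induction n; simpl; intros H; auto. rewrite IHn, H; auto. Qed.

Lemma vsum_minus f g n : vsum (fun k => minus (f k) (g k)) n = minus (vsum f n) (vsum g n).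
Proof. induction n; simpl; [vring|]. rewrite IHn. vring. Qed.

Lemma vsum_scal (c : C) f n : vsum (fun k => scal c (f k)) n = scal c (vsum f n).
Proof. induction n; simpl; [vring|]. rewrite IHn. vring. Qed.

Lemma vsum_plus f g n : vsum (fun k => plus (f k) (g k)) n = plus (vsum f n) (vsum g n).
Proof. induction n; simpl; [vring|]. rewrite IHn. vring. Qed.

Lemma vsum_const (x : V) n : vsum (fun _ => x) n = scal (RtoC (INR n)) x.
Proof.
  induction n; cbn [vsum].
  - simpl INR. vring.
  - rewrite IHn, S_INR, RtoC_plus. vring.
Qed.

Lemma vsum_telescope f n : vsum (fun k => minus (f (S k)) (f k)) n = minus (f n) (f O).
Proof. induction n; simpl; [vring|]. rewrite IHn. vring. Qed.

Lemma norm_vsum f n : norm (vsum f n) <= rsum (fun k => norm (f k)) n.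
Proof.
  induction n; simpl; [rewrite norm_zero; lra|].
  eapply Rle_trans; [apply norm_plus_le|]. lra.
Qed.

Lemma norm_scal_ge (c : C) (x : V) : c <> RtoC 0 -> Cmod c * norm x <= norm (scal c x).
Proof.
  intros Hc. assert (Hm : 0 < Cmod c) by now apply Cmod_gt_0.
  apply Rmult_le_reg_l with (/ Cmod c); [now apply Rinv_0_lt_compat|].
  rewrite <- Rmult_assoc, Rinv_l, Rmult_1_l, <- Cmod_inv by (auto; lra).
  replace x with (scal (/ c)%C (scal c x)) at 1; [apply norm_scal_le|].
  transitivity (scal (/ c * c)%C x); [vring|].
  rewrite Cinv_l by auto. apply (scal_one (K := C_AbsRing)).
Qed.

(** Quantitative complex differentiability on a disc: h' is the derivative of h with a uniform
    remainder of second order, which is all that averaging over finitely many points requires. *)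
Definition expands (h h' : C -> V) (w : C) (rho L : R) : Prop :=
  forall z z', Cmod (z - w)%C <= rho -> Cmod (z' - w)%C <= rho ->
    norm (h z) <= L /\ norm (h' z) <= L /\
    norm (minus (minus (h z') (h z)) (scal (z' - z)%C (h' z))) <= L * Cmod (z' - z)%C ^ 2.

(* Cauchy's mean value property without integrals: [h] is averaged over the [m]-th roots of
   unity on concentric circles; going around a circle the increments of [h] cancel, which
   makes the average of the radial derivative of order 1/m. *)
Lemma expands_mean_value h h' w rho L b : 0 < rho -> 0 <= L -> expands h h' w rho L ->
  (forall z, Cmod (z - w)%C = rho -> norm (h z) <= b) -> norm (h w) <= b.
Proof.
  intros Hrho HL Hexp HS.
  apply (le_epsilon_mult _ _ (rho * L + 10 * L * rho ^ 2)). intros e He.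
  destruct (INR_unbounded (/ e)) as [m0 Hm0].
  set (m := (m0 + 2)%nat).
  assert (Hm2 : 2 <= INR m) by (apply (le_INR 2); unfold m; lia).
  assert (Hme : / e <= INR m).
  { assert (INR m0 <= INR m) by (apply le_INR; unfold m; lia). lra. }
  set (pt := fun (r : R) k => (w + RtoC r * root m k)%C).
  assert (Hroot : forall k, Cmod (root m k) = 1) by (intros; unfold root; apply Cmod_cis).
  assert (Hpt : forall r k, 0 <= r -> Cmod (pt r k - w)%C = r).
  { intros r k Hr. unfold pt.
    replace (w + RtoC r * root m k - w)%C with (RtoC r * root m k)%C by ring.
    rewrite Cmod_mult, Hroot, Cmod_R, Rabs_pos_eq; lra. }
  set (A := fun r => vsum (fun k => h (pt r k)) m).
  set (A' := fun r => vsum (fun k => scal (root m k) (h' (pt r k))) m).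
  set (o := (root m 1 - RtoC 1)%C).
  assert (Ho : o <> RtoC 0).
  { unfold o, root. intros Hc.
    apply (cis_neq_1 (INR 1 / INR m)).
    - simpl INR. rewrite Rabs_pos_eq by (apply Rdiv_le_0_compat; lra). split.
      + apply Rdiv_lt_0_compat; lra.
      + apply Rmult_lt_reg_r with (INR m); [lra|]. unfold Rdiv. rewrite Rmult_assoc, Rinv_l; lra.
    - replace (cis (2 * PI * (INR 1 / INR m))) with
        (cis (2 * PI * (INR 1 / INR m)) - RtoC 1 + RtoC 1)%C by ring.
      rewrite Hc. ring. }
  assert (Hosmall : INR m * Cmod o <= 8).
  { unfold o. rewrite <- cis_0. unfold root.
    pose proof (Cmod_cis_minus (2 * PI * (INR 1 / INR m)) 0) as H.
    pose proof PI_4. pose proof PI_RGT_0.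
    assert (Hx : 0 <= INR 1 / INR m) by (apply Rdiv_le_0_compat; simpl; lra).
    rewrite Rminus_0_r, Rabs_pos_eq in H by (apply Rmult_le_pos; lra).
    apply Rle_trans with (INR m * (2 * PI * (INR 1 / INR m))); [apply Rmult_le_compat_l; lra|].
    apply Rle_trans with (2 * PI); [apply Req_le; simpl; field; lra|lra]. }
  assert (Hrot : forall k, root m (k + 1) = (root m 1 * root m k)%C).
  { intros k. unfold root. rewrite <- cis_plus. f_equal. rewrite plus_INR. field. lra. }
  (* The trivial bound for A' is m L. The increments around the circle cancel up to m remainders of
     size L (r |o|)^2; division by r |o|, with m |o| <= 8, leaves a bound independent of m. *)
  assert (HA' : forall r, 0 < r <= rho -> INR m * norm (A' r) <= INR m * (8 * L * r)).
  { intros r Hr.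
    assert (Hz : vsum (fun k => minus (h (pt r (k + 1)%nat)) (h (pt r k))) m = zero).
    { rewrite (vsum_ext _ (fun k => minus (h (pt r (S k))) (h (pt r k)))).
      - rewrite (vsum_telescope (fun k => h (pt r k)) m).
        replace (pt r m) with (pt r O); [vring|].
        unfold pt. do 2 f_equal. unfold root. simpl (INR 0).
        replace (INR m / INR m) with (INR 1) by (simpl; field; lra).
        rewrite cis_2PI_nat.
        replace (2 * PI * (0 / INR m)) with 0 by (field; lra). apply cis_0.
      - intros k _. do 3 f_equal. lia. }
    set (rem := fun k => minus (minus (h (pt r (k + 1)%nat)) (h (pt r k)))
      (scal ((pt r (k + 1)%nat) - pt r k)%C (h' (pt r k)))).
    assert (Hrem : forall k, norm (rem k) <= L * (r * Cmod o) ^ 2).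
    { intros k. unfold rem.
      assert (Hdist : ((pt r (k + 1)%nat) - pt r k)%C = (RtoC r * o * root m k)%C).
      { unfold pt, o. rewrite Hrot. ring. }
      destruct (Hexp (pt r k) (pt r (k + 1)%nat)) as (_ & _ & H).
      { rewrite Hpt; lra. } { rewrite Hpt; lra. }
      eapply Rle_trans; [apply H|]. rewrite Hdist, !Cmod_mult, Hroot, Cmod_R, Rabs_pos_eq by lra.
      rewrite Rmult_1_r. lra. }
    assert (Hs : vsum rem m = scal (- (RtoC r * o))%C (A' r)).
    { unfold rem. rewrite vsum_minus, Hz. unfold A'. rewrite <- vsum_scal.
      rewrite (vsum_ext (fun k => scal ((pt r (k + 1)%nat) - pt r k)%C (h' (pt r k)))
        (fun k => scal (RtoC r * o)%C (scal (root m k) (h' (pt r k))))).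
      - rewrite !vsum_scal. vring.
      - intros k _. replace ((pt r (k + 1)%nat) - pt r k)%C with (RtoC r * o * root m k)%C
          by (unfold pt, o; rewrite Hrot; ring). vring. }
    assert (Hro : 0 < r * Cmod o) by (apply Rmult_lt_0_compat; [lra|now apply Cmod_gt_0]).
    assert (Hle : r * Cmod o * norm (A' r) <= INR m * (L * (r * Cmod o) ^ 2)).
    { apply Rle_trans with (norm (vsum rem m)).
      - rewrite Hs. replace (r * Cmod o) with (Cmod (- (RtoC r * o))%C).
        + apply norm_scal_ge. intros Hc. apply Cmod_gt_0 in Ho.
          apply (f_equal Cmod) in Hc. rewrite Cmod_opp, Cmod_mult, Cmod_R, Rabs_pos_eq, Cmod_0 in Hc by lra. lra.
        + rewrite Cmod_opp, Cmod_mult, Cmod_R, Rabs_pos_eq; lra.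
      - eapply Rle_trans; [apply norm_vsum|]. rewrite <- rsum_const.
        apply rsum_le. intros; apply Hrem. }
    assert (Hn : norm (A' r) <= L * r * (INR m * Cmod o)).
    { apply Rmult_le_reg_l with (r * Cmod o); auto.
      eapply Rle_trans; [apply Hle|]. apply Req_le. ring. }
    apply Rmult_le_compat_l; [lra|]. eapply Rle_trans; [apply Hn|].
    assert (0 <= L * r) by (apply Rmult_le_pos; lra). nra. }
  set (dl := rho / INR m). assert (Hdl : 0 < dl) by (apply Rdiv_lt_0_compat; lra).
  assert (Hstep : forall r, 0 <= r -> r + dl <= rho ->
    norm (minus (A (r + dl)) (A r)) <= dl * norm (A' r) + INR m * (L * dl ^ 2)).
  { intros r Hr Hrd.
    set (rem := fun k => minus (minus (h (pt (r + dl) k)) (h (pt r k)))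
      (scal (pt (r + dl)%R k - pt r k)%C (h' (pt r k)))).
    assert (Hdist : forall k, (pt (r + dl)%R k - pt r k)%C = (RtoC dl * root m k)%C).
    { intros k. unfold pt. rewrite RtoC_plus. ring. }
    assert (Hrem : forall k, norm (rem k) <= L * dl ^ 2).
    { intros k. destruct (Hexp (pt r k) (pt (r + dl) k)) as (_ & _ & H).
      { rewrite Hpt; lra. } { rewrite Hpt; lra. }
      eapply Rle_trans; [apply H|]. rewrite Hdist, Cmod_mult, Hroot, Cmod_R, Rabs_pos_eq by lra.
      rewrite Rmult_1_r. lra. }
    replace (minus (A (r + dl)) (A r)) with (plus (scal (RtoC dl) (A' r)) (vsum rem m)).
    - eapply Rle_trans; [apply norm_plus_le|]. apply Rplus_le_compat.
      + eapply Rle_trans; [apply norm_scal_le|]. rewrite Cmod_R, Rabs_pos_eq; lra.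
      + eapply Rle_trans; [apply norm_vsum|]. rewrite <- rsum_const. apply rsum_le. intros; apply Hrem.
    - unfold rem, A, A'. rewrite !vsum_minus, <- vsum_scal.
      rewrite (vsum_ext (fun k => scal (pt (r + dl)%R k - pt r k)%C (h' (pt r k)))
        (fun k => scal (RtoC dl) (scal (root m k) (h' (pt r k))))).
      + vring.
      + intros k _. rewrite Hdist. vring. }
  (* The first radial step starts at r = 0, where nothing cancels; it takes the trivial bound m L
     over a length rho / m. The sum over all steps stays bounded, so the average over m points moves
     by O(1 / m). *)
  assert (Hind : forall i, (i < m)%nat ->
    norm (minus (A (INR (i + 1) * dl)) (A 0)) <= rho * L + L * rho ^ 2 + INR i * (9 * L * rho ^ 2 / INR m)).
  { induction i; intros Hi.
    - simpl (0 + 1)%nat. simpl (INR 0). rewrite Rmult_0_l, Rplus_0_r.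
      replace (INR 1 * dl) with (0 + dl) by (simpl; ring).
      assert (Hdr : dl <= rho).
      { unfold dl, Rdiv. rewrite <- (Rmult_1_r rho) at 2. apply Rmult_le_compat_l; [lra|].
        rewrite <- Rinv_1. apply Rinv_le_contravar; lra. }
      eapply Rle_trans; [apply (Hstep 0); lra|].
      assert (HA0 : norm (A' 0) <= INR m * L).
      { unfold A'. eapply Rle_trans; [apply norm_vsum|]. rewrite <- rsum_const. apply rsum_le.
        intros k _. eapply Rle_trans; [apply norm_scal_le|]. rewrite Hroot, Rmult_1_l.
        destruct (Hexp (pt 0 k) (pt 0 k)) as (_ & H & _); auto; rewrite Hpt; lra. }
      assert (H1 : dl * norm (A' 0) <= rho * L).
      { apply Rle_trans with (dl * (INR m * L)); [apply Rmult_le_compat_l; lra|].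
        apply Req_le. unfold dl. field. lra. }
      assert (H2 : INR m * (L * dl ^ 2) <= L * rho ^ 2).
      { replace (INR m * (L * dl ^ 2)) with (L * (rho * dl)) by (unfold dl; field; lra).
        apply Rmult_le_compat_l; auto. simpl. nra. }
      lra.
    - specialize (IHi ltac:(lia)).
      set (r := INR (i + 1) * dl) in *.
      assert (Hr0 : 0 < r) by (apply Rmult_lt_0_compat; [apply lt_0_INR; lia|auto]).
      assert (Hr1 : r + dl <= rho).
      { unfold r. replace (INR (i + 1) * dl + dl) with (INR (S (i + 1)) * dl) by (rewrite S_INR; ring).
        apply Rle_trans with (INR m * dl); [apply Rmult_le_compat_r; [lra|apply le_INR; lia]|].
        apply Req_le. unfold dl. field. lra. }
      replace (INR (S i + 1) * dl) with (r + dl)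
        by (unfold r; replace (S i + 1)%nat with (S (i + 1)) by lia; rewrite S_INR; ring).
      replace (minus (A (r + dl)) (A 0)) with (plus (minus (A (r + dl)) (A r)) (minus (A r) (A 0))) by vring.
      eapply Rle_trans; [apply norm_plus_le|].
      pose proof (Hstep r ltac:(lra) Hr1) as Hst.
      assert (HAr : norm (A' r) <= 8 * L * r).
      { apply Rmult_le_reg_l with (INR m); [lra|]. apply HA'. lra. }
      assert (H1 : dl * norm (A' r) + INR m * (L * dl ^ 2) <= 9 * L * rho ^ 2 / INR m).
      { replace (9 * L * rho ^ 2 / INR m) with (dl * (8 * L * rho) + INR m * (L * dl ^ 2))
          by (unfold dl; field; lra).
        apply Rplus_le_compat_r, Rmult_le_compat_l; [lra|].
        eapply Rle_trans; [apply HAr|]. apply Rmult_le_compat_l; lra. }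
      rewrite S_INR. lra. }
  specialize (Hind (m - 1)%nat ltac:(unfold m; lia)).
  replace (m - 1 + 1)%nat with m in Hind by (unfold m; lia).
  replace (INR m * dl) with rho in Hind by (unfold dl; field; lra).
  assert (Hrem : INR (m - 1) * (9 * L * rho ^ 2 / INR m) <= 9 * L * rho ^ 2).
  { assert (INR (m - 1) <= INR m) by (apply le_INR; lia).
    assert (0 <= 9 * L * rho ^ 2 / INR m).
    { apply Rdiv_le_0_compat; [|lra]. apply Rmult_le_pos; [lra|apply pow2_ge_0]. }
    apply Rle_trans with (INR m * (9 * L * rho ^ 2 / INR m)); [apply Rmult_le_compat_r; auto|].
    apply Req_le. field. lra. }
  assert (HArho : norm (A rho) <= INR m * b).
  { unfold A. eapply Rle_trans; [apply norm_vsum|]. rewrite <- rsum_const. apply rsum_le.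
    intros k _. apply HS. apply Hpt. lra. }
  assert (HA0 : INR m * norm (h w) <= norm (A 0)).
  { unfold A. rewrite (vsum_ext _ (fun _ => h w)).
    - rewrite vsum_const. replace (INR m) with (Cmod (RtoC (INR m))) at 1.
      + apply norm_scal_ge. intros Hc. apply RtoC_inj in Hc. lra.
      + rewrite Cmod_R, Rabs_pos_eq; lra.
    - intros k _. f_equal. unfold pt. ring. }
  assert (HA0' : norm (A 0) <= norm (A rho) + norm (minus (A rho) (A 0))).
  { replace (A 0) with (minus (A rho) (minus (A rho) (A 0))) at 1 by vring. apply norm_minus_le. }
  apply Rmult_le_reg_l with (INR m); [lra|].
  rewrite Rmult_plus_distr_l.
  assert (Hmee : 1 <= INR m * e).
  { apply Rmult_le_reg_l with (/ e); [now apply Rinv_0_lt_compat|].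
    replace (/ e * (INR m * e)) with (INR m) by (field; lra). lra. }
  assert (Hc0 : 0 <= rho * L + 10 * L * rho ^ 2).
  { assert (0 <= rho * L) by (apply Rmult_le_pos; lra).
    assert (0 <= L * rho ^ 2) by (apply Rmult_le_pos; [lra|apply pow2_ge_0]). lra. }
  replace (INR m * ((rho * L + 10 * L * rho ^ 2) * e)) with
    ((rho * L + 10 * L * rho ^ 2) * (INR m * e)) by ring.
  assert (rho * L + 10 * L * rho ^ 2 <= (rho * L + 10 * L * rho ^ 2) * (INR m * e)).
  { rewrite <- (Rmult_1_r (rho * L + 10 * L * rho ^ 2)) at 1. now apply Rmult_le_compat_l. }
  lra.
Qed.

Lemma expands_mult_quadratic h h' w rho L c : 0 <= rho -> 0 <= L -> expands h h' w rho L ->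
  exists g' L', 0 <= L' /\ expands
    (fun z => scal (RtoC 1 + c * (z - w) ^ 2)%C (h z)) g' w rho L'.
Proof.
  intros Hrho HL Hexp.
  set (phi := fun z => (RtoC 1 + c * (z - w) ^ 2)%C).
  set (phi' := fun z => (RtoC 2 * c * (z - w))%C).
  set (k := Cmod c). assert (Hk : 0 <= k) by apply Cmod_ge_0.
  set (F := 1 + k * rho ^ 2 + 2 * k * rho + k).
  assert (Hkr : 0 <= k * rho) by (now apply Rmult_le_pos).
  assert (Hkr2 : 0 <= k * rho ^ 2) by (apply Rmult_le_pos; [lra|apply pow2_ge_0]).
  assert (HF : 0 <= F) by (unfold F; lra).
  exists (fun z => plus (scal (phi' z) (h z)) (scal (phi z) (h' z))), (3 * F * L).
  split; [repeat apply Rmult_le_pos; lra|].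
  assert (Hphi : forall z, Cmod (z - w)%C <= rho -> Cmod (phi z) <= F).
  { intros z Hz. unfold phi. eapply Rle_trans; [apply Cmod_triangle|].
    rewrite Cmod_1, Cmod_mult, Cmod_pow. fold k.
    assert (Cmod (z - w)%C ^ 2 <= rho ^ 2) by (apply pow_incr; split; [apply Cmod_ge_0|auto]).
    assert (k * Cmod (z - w)%C ^ 2 <= k * rho ^ 2) by (apply Rmult_le_compat_l; auto).
    unfold F; lra. }
  assert (Hphi' : forall z, Cmod (z - w)%C <= rho -> Cmod (phi' z) <= F).
  { intros z Hz. unfold phi'. rewrite !Cmod_mult, Cmod_R, Rabs_pos_eq by lra. fold k.
    assert (2 * k * Cmod (z - w)%C <= 2 * k * rho) by (apply Rmult_le_compat_l; lra).
    unfold F; lra. }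
  intros z z' Hz Hz'. destruct (Hexp z z' Hz Hz') as (H1 & H2 & H3).
  pose proof (Hphi z Hz) as P1. pose proof (Hphi' z Hz) as P2. pose proof (Hphi z' Hz') as P3.
  pose proof (Hphi' z' Hz') as P4.
  pose proof (norm_nonneg (h z)) as N1. pose proof (norm_nonneg (h' z)) as N2.
  assert (HFL : 0 <= F * L) by (now apply Rmult_le_pos).
  assert (Hmul : forall (a : C) (x : V), Cmod a <= F -> norm x <= L -> norm (scal a x) <= F * L).
  { intros a x Ha Hx. eapply Rle_trans; [apply norm_scal_le|].
    apply Rmult_le_compat; auto using Cmod_ge_0, norm_nonneg. }
  split; [|split].
  - eapply Rle_trans; [apply Hmul; eauto|]. lra.
  - eapply Rle_trans; [apply norm_plus_le|].
    pose proof (Hmul _ _ P2 H1). pose proof (Hmul _ _ P1 H2). lra.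
  - fold (phi z) (phi z'). set (d := (z' - z)%C) in *.
    set (rem := minus (minus (h z') (h z)) (scal d (h' z))) in *.
    set (s := (c * (z' - w + (z - w)))%C).
    assert (Hs : Cmod s <= F).
    { unfold s. rewrite Cmod_mult. fold k.
      assert (Cmod (z' - w + (z - w))%C <= 2 * rho).
      { eapply Rle_trans; [apply Cmod_triangle|]. lra. }
      assert (k * Cmod (z' - w + (z - w))%C <= k * (2 * rho)) by (apply Rmult_le_compat_l; auto).
      unfold F; lra. }
    assert (He : minus (minus (scal (phi z') (h z')) (scal (phi z) (h z)))
       (scal d (plus (scal (phi' z) (h z)) (scal (phi z) (h' z))))
      = plus (plus (scal (phi z') rem) (scal (d * d)%C (scal c (h z)))) (scal (d * d)%C (scal s (h' z)))).
    { unfold rem, phi, phi', s, d. vring. }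
    change (norm (minus (minus (scal (phi z') (h z')) (scal (phi z) (h z)))
       (scal d (plus (scal (phi' z) (h z)) (scal (phi z) (h' z))))) <= 3 * F * L * Cmod d ^ 2).
    rewrite He.
    assert (Hd2 : Cmod (d * d)%C = Cmod d ^ 2) by (rewrite Cmod_mult; ring).
    assert (Hdd : 0 <= Cmod d ^ 2) by apply pow2_ge_0.
    assert (T1 : norm (scal (phi z') rem) <= F * L * Cmod d ^ 2).
    { eapply Rle_trans; [apply norm_scal_le|]. rewrite Rmult_assoc.
      apply Rmult_le_compat; auto using Cmod_ge_0, norm_nonneg. }
    assert (T2 : forall (a : C) (x : V), Cmod a <= F -> norm x <= L ->
       norm (scal (d * d)%C (scal a x)) <= F * L * Cmod d ^ 2).
    { intros a x Ha Hx. eapply Rle_trans; [apply norm_scal_le|]. rewrite Hd2, Rmult_comm.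
      apply Rmult_le_compat_r; auto. }
    assert (Hc : Cmod c <= F) by (fold k; unfold F; lra).
    pose proof (T2 c (h z) Hc H1) as T2a. pose proof (T2 s (h' z) Hs H2) as T2b.
    apply Rle_trans with ((F * L * Cmod d ^ 2 + F * L * Cmod d ^ 2) + F * L * Cmod d ^ 2); [|lra].
    eapply Rle_trans; [apply norm_plus_le|]. apply Rplus_le_compat; [|exact T2b].
    eapply Rle_trans; [apply norm_plus_le|]. apply Rplus_le_compat; [exact T1|exact T2a].
Qed.

Lemma expands_mult_quadratic_pow w rho c M : 0 <= rho -> forall h h' L, 0 <= L -> expands h h' w rho L ->
  exists g' L', 0 <= L' /\ expands
    (fun z => scal ((RtoC 1 + c * (z - w) ^ 2) ^ M)%C (h z)) g' w rho L'.
Proof.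
  intros Hrho. induction M; intros h h' L HL Hexp.
  - exists h', L. split; auto. intros z z' Hz Hz'. destruct (Hexp z z' Hz Hz') as (H1 & H2 & H3).
    assert (Hone : forall x : V, scal ((RtoC 1 + c * (z - w) ^ 2) ^ 0)%C x = x).
    { intros x. apply (scal_one (K := C_AbsRing)). }
    assert (Hone' : forall x : V, scal ((RtoC 1 + c * (z' - w) ^ 2) ^ 0)%C x = x).
    { intros x. apply (scal_one (K := C_AbsRing)). }
    cbv beta. rewrite Hone, Hone'. auto.
  - destruct (expands_mult_quadratic h h' w rho L c Hrho HL Hexp) as (g1 & L1 & HL1 & H1).
    destruct (IHM _ _ _ HL1 H1) as (g2 & L2 & HL2 & H2).
    exists g2, L2. split; auto. intros z z' Hz Hz'.
    assert (Hone : forall (z : C) (x : V), scal ((RtoC 1 + c * (z - w) ^ 2) ^ (S M))%C x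
      = scal ((RtoC 1 + c * (z - w) ^ 2) ^ M)%C
          (scal (RtoC 1 + c * (z - w) ^ 2)%C x)).
    { intros y x. rewrite Cpow_S. vring. }
    cbv beta. rewrite !Hone. now apply H2.
Qed.

End MeanValue.

(** * The resolvent off the spectrum *)

Section Levinson.

Context {V : NormedModule C_AbsRing} (T : V -> V) (HT : is_linear T) (E : C -> Prop) (R0 : C -> V -> V).
Hypothesis HR0 : forall z, ~ E z -> forall x,
  minus (T (R0 z x)) (scal z (R0 z x)) = x /\ R0 z (minus (T x) (scal z x)) = x.

Hypothesis HRb : forall z, ~ E z -> exists B, 0 < B /\ bdd_below T z B.

Lemma far_not_in lam z : 0 < lam -> far E lam z -> ~ E z.
Proof.
  intros Hl [_ H] HE. specialize (H z HE).
  replace (z - z)%C with (RtoC 0) in H by ring. rewrite Cmod_0 in H. lra.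
Qed.

Lemma resolvent_norm z B x : ~ E z -> bdd_below T z B -> norm (R0 z x) <= B * norm x.
Proof.
  intros HE H. eapply Rle_trans; [apply H|]. destruct (HR0 z HE x) as [-> _]. lra.
Qed.

Lemma resolvent_identity z z' B x : ~ E z -> ~ E z' -> bdd_below T z' B ->
  minus (R0 z' x) (R0 z x) = scal (z' - z)%C (R0 z' (R0 z x)).
Proof.
  intros Hz Hz' HB.
  destruct (HR0 z Hz x) as [H1 _]. destruct (HR0 z' Hz' x) as [H2 _].
  destruct (HR0 z' Hz' (R0 z x)) as [H3 _].
  set (a := R0 z x) in *. set (b := R0 z' x) in *. set (c := R0 z' a) in *.
  set (d := minus (minus b a) (scal (z' - z)%C c)).
  assert (Hd : minus (T d) (scal z' d) = zero).
  { unfold d. rewrite !(is_linear_minus T HT), (linear_scal T HT).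
    transitivity (minus (minus (minus (T b) (scal z' b)) (minus (T a) (scal z a)))
      (minus (scal (z' - z)%C (minus (T c) (scal z' c))) (scal (z' - z)%C a))).
    - vring.
    - rewrite H1, H2, H3. vring. }
  assert (Hd0 : d = zero).
  { apply norm_eq_zero. apply Rle_antisym; [|apply norm_nonneg].
    assert (Hn : norm (minus (T d) (scal z' d)) = 0) by (rewrite Hd; exact norm_zero).
    specialize (HB d). rewrite Hn in HB. lra. }
  replace (minus b a) with (plus d (scal (z' - z)%C c)) by (unfold d; vring).
  rewrite Hd0. vring.
Qed.

(** The resolvent identity used twice gives the remainder exactly, as (z' - z)^2 R(z') R(z)^2 x. *)
Lemma resolvent_expands w rho B x : 0 <= B ->
  (forall z, Cmod (z - w)%C <= rho -> ~ E z /\ bdd_below T z B) ->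
  expands (fun z => R0 z x) (fun z => R0 z (R0 z x)) w rho ((B + B ^ 2 + B ^ 3) * norm x).
Proof.
  intros HB H z z' Hz Hz'.
  destruct (H z Hz) as [HE Hb]. destruct (H z' Hz') as [HE' Hb'].
  pose proof (norm_nonneg x) as Hx.
  assert (HB2 : 0 <= B ^ 2) by apply pow2_ge_0.
  assert (HB3 : 0 <= B ^ 3) by (apply pow_le; auto).
  assert (N1 : forall v, norm (R0 z v) <= B * norm v) by (intros; now apply resolvent_norm).
  assert (N2 : forall v, norm (R0 z' v) <= B * norm v) by (intros; now apply resolvent_norm).
  assert (N3 : norm (R0 z (R0 z x)) <= B ^ 2 * norm x).
  { eapply Rle_trans; [apply N1|]. simpl. rewrite Rmult_1_r, Rmult_assoc. apply Rmult_le_compat_l; auto. }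
  assert (0 <= B * norm x) by (now apply Rmult_le_pos).
  assert (0 <= B ^ 2 * norm x) by (now apply Rmult_le_pos).
  assert (0 <= B ^ 3 * norm x) by (now apply Rmult_le_pos).
  split; [|split].
  - eapply Rle_trans; [apply N1|]. lra.
  - eapply Rle_trans; [apply N3|]. lra.
  - set (d := (z' - z)%C).
    assert (He : minus (minus (R0 z' x) (R0 z x)) (scal d (R0 z (R0 z x)))
      = scal (d * d)%C (R0 z' (R0 z (R0 z x)))).
    { rewrite (resolvent_identity z z' B x HE HE' Hb').
      transitivity (scal d (minus (R0 z' (R0 z x)) (R0 z (R0 z x)))); [unfold d; vring|].
      rewrite (resolvent_identity z z' B (R0 z x) HE HE' Hb'). unfold d. vring. }
    rewrite He. eapply Rle_trans; [apply norm_scal_le|].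
    rewrite Cmod_mult. replace (Cmod d * Cmod d) with (Cmod d ^ 2) by ring.
    rewrite Rmult_comm. apply Rmult_le_compat_r; [apply pow2_ge_0|].
    eapply Rle_trans; [apply N2|].
    apply Rle_trans with (B * (B ^ 2 * norm x)); [apply Rmult_le_compat_l; auto|].
    simpl in *. lra.
Qed.

Context (c gam : R) (Hc : 0 < c) (Hgam : 0 < gam).
Hypothesis Hdirect : forall z, Cmod z <= 2 -> Cmod z <> 1 ->
  bdd_below T z (exp (c * Rpower (Rabs (Cmod z - 1)) (- gam))).

Lemma direct_far_from_circle d z : 0 < d -> Cmod z <= 2 -> d <= Rabs (Cmod z - 1) ->
  bdd_below T z (exp (c * Rpower d (- gam))).
Proof.
  intros Hd Hz H. apply (bdd_below_weaken T z (exp (c * Rpower (Rabs (Cmod z - 1)) (- gam)))).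
  - apply exp_le. apply Rmult_le_compat_l; [lra|]. apply Rpower_neg_decr; lra.
  - apply Hdirect; auto. intros H1. rewrite H1, Rminus_diag, Rabs_R0 in H. lra.
Qed.

(** On the unit circle 1 + s^2 = 2 s Re s. In [levinson_step] Re s is the radial component of the
    displacement, so the multiplier is small exactly in the directions tangent to the unit
    circle. *)
Lemma Cmod_1_plus_sqr s : Cmod s = 1 -> Cmod (RtoC 1 + s ^ 2)%C = 2 * Rabs (Re s).
Proof.
  intros Hs.
  assert (H : (RtoC 1 + s ^ 2)%C = (s * RtoC (2 * Re s))%C).
  { assert (Hss : Re s ^ 2 + Im s ^ 2 = 1) by (rewrite <- Cmod2_alt, Hs; ring).
    destruct s as [a b]. simpl in Hss. apply Cplx_eq; simpl; nra. }
  rewrite H, Cmod_mult, Hs, Cmod_R, Rabs_mult, (Rabs_pos_eq 2) by lra. ring.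
Qed.

(* On the circle of radius [rho] about a point [w] close to the unit circle, the polynomial
   [(1 + s^2)^M], with [s] the rotated and rescaled variable, is small near the two points where
   that circle crosses the unit circle, and elsewhere the resolvent is bounded directly. *)
Lemma levinson_step u rho lam B M : 0 < u <= 1 -> 0 < rho <= u / 4 -> 0 < lam - rho -> 0 <= B ->
  (forall z, far E (lam - rho) z -> bdd_below T z B) ->
  forall w, far E lam w -> bdd_below T w
    (Rmax (2 ^ M * exp (c * Rpower (rho * u / 12) (- gam))) (u ^ M * B)).
Proof.
  intros Hu Hrho Hlam HB HBd w Hw.
  set (D := exp (c * Rpower (rho * u / 12) (- gam))).
  assert (HD : 0 < D) by apply exp_pos.
  assert (Hru : 0 < rho * u) by (apply Rmult_lt_0_compat; lra).
  set (W := Cmod w). assert (HW0 : 0 <= W) by apply Cmod_ge_0.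
  assert (HW2 : W <= 2) by apply Hw.
  (* When w itself is off the unit circle by this amount, the direct bound applies at w. *)
  destruct (Rlt_dec (rho * u / 4) (Rabs (W ^ 2 - 1))) as [Hoff|Hon].
  - assert (HD1 : bdd_below T w D).
    { apply direct_far_from_circle; [lra|apply Hw|].
      fold W. replace (W ^ 2 - 1) with ((W - 1) * (W + 1)) in Hoff by ring.
      rewrite Rabs_mult, (Rabs_pos_eq (W + 1)) in Hoff by lra.
      pose proof (Rabs_pos (W - 1)). nra. }
    apply (bdd_below_weaken T w D); auto.
    eapply Rle_trans; [|apply Rmax_l].
    assert (1 <= 2 ^ M) by (apply pow_R1_Rle; lra). nra.
  - apply Rnot_lt_le in Hon. apply Rabs_le_between in Hon.
    assert (HW : 3 / 4 <= W <= 5 / 4) by (split; nra).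
    set (X := Rmax (2 ^ M * D) (u ^ M * B)).
    set (tau := (w * RtoC (/ W))%C).
    assert (Htau : Cmod tau = 1).
    { unfold tau. rewrite Cmod_mult, Cmod_R, Rabs_pos_eq; [fold W; field; lra|].
      apply Rlt_le, Rinv_0_lt_compat; lra. }
    assert (Htc : (tau * Cconj tau)%C = RtoC 1).
    { rewrite <- Cmod2_conj, Htau. f_equal. ring. }
    assert (Hwt : w = (RtoC W * tau)%C).
    { unfold tau. rewrite RtoC_inv by lra. field. intros H. apply RtoC_inj in H. lra. }
    set (k := (Cconj tau * RtoC (/ rho))%C).
    intros y. set (x := minus (T y) (scal w y)).
    assert (HEw : ~ E w) by (apply (far_not_in lam); [lra|auto]).
    assert (Hy : y = R0 w x) by (unfold x; symmetry; apply (HR0 w HEw y)).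
    assert (Hdisc : forall z, Cmod (z - w)%C <= rho -> far E (lam - rho) z).
    { intros z Hz. split.
      - pose proof (Cmod_le_minus z w) as H. fold W in H. lra.
      - intros e He. destruct Hw as [_ Hw]. specialize (Hw e He).
        pose proof (Cmod_triangle (z - e)%C (w - z)%C) as H.
        replace (z - e + (w - z))%C with (w - e)%C in H by ring.
        rewrite (Cmod_minus_sym w z) in H. lra. }
    pose proof (resolvent_expands w rho B x HB) as Hexp.
    assert (Hexp' : expands (fun z => R0 z x) (fun z => R0 z (R0 z x)) w rho ((B + B ^ 2 + B ^ 3) * norm x)).
    { apply Hexp. intros z Hz. split; [apply (far_not_in (lam - rho)); auto|auto]. }
    assert (HL : 0 <= (B + B ^ 2 + B ^ 3) * norm x).
    { apply Rmult_le_pos; [|apply norm_nonneg].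
      assert (0 <= B ^ 2) by (now apply pow_le). assert (0 <= B ^ 3) by (now apply pow_le). lra. }
    destruct (expands_mult_quadratic_pow w rho (k ^ 2)%C M ltac:(lra) _ _ _ HL Hexp') as (g' & L' & HL' & Hg).
    set (h := fun z => scal ((RtoC 1 + k ^ 2 * (z - w) ^ 2) ^ M)%C (R0 z x)) in *.
    assert (Hhw : h w = y).
    { unfold h. rewrite <- Hy.
      replace (RtoC 1 + k ^ 2 * (w - w) ^ 2)%C with (RtoC 1) by (simpl; ring).
      rewrite Cpow_1_l. apply (scal_one (K := C_AbsRing)). }
    rewrite <- Hhw at 1. apply (expands_mean_value h g' w rho L'); auto; [lra|].
    intros z Hz. unfold h.
    set (s := (k * (z - w))%C).
    assert (Hs : Cmod s = 1).
    { unfold s, k. rewrite !Cmod_mult, Cmod_conj, Htau, Hz, Cmod_R, Rabs_pos_eq; [field; lra|].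
      apply Rlt_le, Rinv_0_lt_compat; lra. }
    replace (k ^ 2 * (z - w) ^ 2)%C with (s ^ 2)%C by (unfold s; rewrite Cpow_mult_l; reflexivity).
    eapply Rle_trans; [apply norm_scal_le|].
    rewrite Cmod_pow, Cmod_1_plus_sqr by auto.
    pose proof (re_le_Cmod s) as Hre. rewrite Hs in Hre. pose proof (Rabs_pos (Re s)) as Hre0.
    assert (Hzfar : far E (lam - rho) z) by (apply Hdisc; lra).
    assert (HEz : ~ E z) by (now apply (far_not_in (lam - rho))).
    pose proof (norm_nonneg x) as Hx0.
    destruct (Rle_dec (2 * Rabs (Re s)) u) as [Hsm|Hlg].
    + assert (H1 : norm (R0 z x) <= B * norm x) by (apply resolvent_norm; auto).
      apply Rle_trans with (u ^ M * (B * norm x)).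
      * apply Rmult_le_compat; auto using norm_nonneg; [apply pow_le; lra|]. apply pow_incr. lra.
      * rewrite <- Rmult_assoc. apply Rmult_le_compat_r; auto. apply Rmax_r.
    + apply Rnot_le_lt in Hlg.
      assert (Hdz : rho * u / 12 <= Rabs (Cmod z - 1)).
      { assert (Hz2 : Cmod z ^ 2 = W ^ 2 + 2 * W * rho * Re s + rho ^ 2).
        { replace z with (tau * (RtoC W + RtoC rho * s))%C.
          - rewrite Cmod_mult, Htau, Rmult_1_l, Cmod2_alt.
            assert (Hss : Re s ^ 2 + Im s ^ 2 = 1) by (rewrite <- Cmod2_alt, Hs; ring).
            destruct s as [a b]. simpl in *. nra.
          - unfold s, k. rewrite RtoC_inv by lra.
            replace (tau * (RtoC W + RtoC rho *
        (Cconj tau * / RtoC rho * (z - w))))%C with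
              (RtoC W * tau + tau * Cconj tau * (z - w))%C.
            + rewrite <- Hwt, Htc. ring.
            + field. intros H. apply RtoC_inj in H. lra. }
        assert (Hz0 : 0 <= Cmod z <= 2) by (split; [apply Cmod_ge_0|apply Hzfar]).
        set (Y := Cmod z) in *.
        (* In |z|^2 - 1 = (W^2 - 1) + 2 W rho Re s + rho^2 the middle term has modulus at least 3
           rho u / 4, the other two at most rho u / 4 each. *)
        assert (HY : rho * u / 4 <= Rabs (Y ^ 2 - 1)).
        { assert (HWr : 3 / 4 * rho * u <= 2 * W * rho * Rabs (Re s)).
          { replace (2 * W * rho * Rabs (Re s)) with (W * rho * (2 * Rabs (Re s))) by ring.
            apply Rmult_le_compat; try lra.
            apply Rmult_le_compat_r; lra. }
          assert (Hr2 : rho ^ 2 <= rho * u / 4) by nra.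
          assert (0 <= rho ^ 2) by apply pow2_ge_0.
          rewrite Hz2. unfold Rabs in *. destruct (Rcase_abs (Re s)).
          - destruct Rcase_abs; lra.
          - destruct Rcase_abs; lra. }
        replace (Y ^ 2 - 1) with ((Y - 1) * (Y + 1)) in HY by ring.
        rewrite Rabs_mult, (Rabs_pos_eq (Y + 1)) in HY by lra.
        pose proof (Rabs_pos (Y - 1)). nra. }
      assert (H1 : norm (R0 z x) <= D * norm x).
      { apply resolvent_norm; auto. apply direct_far_from_circle; [lra|apply Hzfar|auto]. }
      apply Rle_trans with (2 ^ M * (D * norm x)).
      * apply Rmult_le_compat; auto using norm_nonneg; [apply pow_le; lra|]. apply pow_incr. lra.
      * rewrite <- Rmult_assoc. apply Rmult_le_compat_r; auto. apply Rmax_l.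
Qed.

Lemma far_weaken lam lam' z : lam <= lam' -> far E lam' z -> far E lam z.
Proof. intros H [H1 H2]. split; auto. intros e He. specialize (H2 e He). lra. Qed.

(* Local form of the Levinson log-log theorem, iterating [levinson_step] along radii shrinking
   geometrically; the a priori bound from compactness is absorbed in the limit. *)
Lemma levinson : exists A, 0 < A /\ forall lam, 0 < lam <= 1 ->
  forall z, far E lam z -> bdd_below T z (exp (A * Rpower lam (- gam))).
Proof.
  set (g := Rpower 2 gam).
  assert (Hg : 1 < g).
  { unfold g. rewrite <- (Rpower_O 2) by lra. apply Rpower_lt; lra. }
  (* Halving the radius multiplies the exponent by g = 2^gam; u is chosen so small that u^M, with M
     proportional to the exponent, makes up for this factor. *)
  set (u := exp (- (3 * g))).
  assert (Hu : 0 < u <= 1).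
  { split; [apply exp_pos|]. rewrite <- exp_0. apply exp_le. lra. }
  (* At stage i the radius is rho = lam u 2^-i / 4, so rho u / 12 = (u^2 / 48) lam 2^-i is the
     distance in the direct bound, and C2 is the resulting constant. A >= 2 K + C2 pays for 2^M
     times the direct bound, A <= 3 K for the loss covered by u^M. *)
  set (C2 := c * Rpower (u ^ 2 / 48) (- gam)).
  assert (HC2 : 0 < C2) by (apply Rmult_lt_0_compat; [auto|apply exp_pos]).
  set (K := C2 + 1). set (A := 2 * K + C2). assert (HA : 0 < A) by (unfold A, K; lra).
  exists A. split; auto. intros lam Hlam.
  set (Lam := Rpower lam (- gam)). assert (HLam : 1 <= Lam) by (apply Rpower_neg_ge_1; lra).
  (* These distances decrease from lam but stay above lam / 2, so a single compactness bound serves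
     at every stage and is below exp(A Lam g^J) for large J. The claim then descends from J to 0. *)
  set (lami := fun i : nat => lam / 2 + lam / 2 * (/ 2) ^ i).
  set (P := fun i => forall z, far E (lami i) z -> bdd_below T z (exp (A * Lam * g ^ i))).
  assert (Hstep : forall i, P (S i) -> P i).
  { intros i HP. set (gi := g ^ i). assert (Hgi : 1 <= gi) by (apply pow_R1_Rle; lra).
    set (hi := (/ 2) ^ i). assert (Hhi : 0 < hi) by (apply pow_lt; lra).
    assert (Hhi1 : hi <= 1) by (unfold hi; apply Rle_trans with (1 ^ i); [apply pow_incr; lra|rewrite pow1; lra]).
    set (rho := lam * u * hi / 4).
    assert (Hlh : 0 < lam * hi) by (apply Rmult_lt_0_compat; lra).
    assert (Hrho : 0 < rho <= u / 4).
    { unfold rho. split; [assert (0 < lam * u * hi) by (repeat apply Rmult_lt_0_compat; lra); lra|].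
      assert (lam * u * hi <= u); [|lra].
      replace (lam * u * hi) with (u * (lam * hi)) by ring.
      rewrite <- (Rmult_1_r u) at 2. apply Rmult_le_compat_l; [lra|]. nra. }
    assert (Hrl : rho <= lam * hi / 4).
    { unfold rho. replace (lam * u * hi) with (u * (lam * hi)) by ring. nra. }
    set (x := K * Lam * gi).
    assert (Hx : 1 <= x).
    { unfold x. assert (1 <= K) by (unfold K; lra). assert (1 <= K * Lam) by nra. nra. }
    destruct (nfloor_ex x) as [n Hn]; [lra|].
    set (M := S n). assert (HM : x <= INR M <= 2 * x) by (unfold M; rewrite S_INR; lra).
    assert (Hlami : lami i - rho >= lami (S i)).
    { unfold lami. simpl. fold hi. lra. }
    assert (Hlami0 : 0 < lami (S i)).
    { unfold lami. assert (0 < (/ 2) ^ S i) by (apply pow_lt; lra). nra. }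
    intros z Hz.
    eapply bdd_below_weaken; [|apply (levinson_step u rho (lami i) (exp (A * Lam * g ^ S i)) M); auto].
    - apply Rmax_lub.
      + apply Rle_trans with (exp (INR M) * exp (C2 * Lam * gi)).
        * apply Rmult_le_compat; [apply pow_le; lra|apply Rlt_le, exp_pos| |].
          -- rewrite <- (Rmult_1_r (INR M)), <- exp_pow_nat. apply pow_incr.
             pose proof (exp_ineq1_le 1). lra.
          -- apply exp_le. apply Req_le. unfold C2. rewrite !Rmult_assoc. f_equal.
             replace (rho * u / 12) with ((u ^ 2 / 48) * (lam * hi)) by (unfold rho; field).
             assert (0 < u ^ 2 / 48) by (assert (0 < u ^ 2) by (apply pow_lt; lra); lra).
             rewrite <- !Rpower_mult_distr by lra. f_equal. fold Lam. f_equal.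
             unfold hi, gi, g. rewrite <- !Rpower_pow by (lra || apply exp_pos).
             rewrite !Rpower_mult. unfold Rpower. rewrite ln_Rinv by lra. f_equal. ring.
        * rewrite <- exp_plus. apply exp_le. fold gi.
          replace (A * Lam * gi) with (2 * x + C2 * Lam * gi) by (unfold A, x; ring). lra.
      + unfold u. rewrite exp_pow_nat, <- exp_plus. apply exp_le.
        rewrite <- tech_pow_Rmult. fold gi.
        assert (H1 : A * Lam * gi * (g - 1) <= 3 * g * x).
        { apply Rle_trans with (3 * x * (g - 1)).
          - apply Rmult_le_compat_r; [lra|]. unfold x.
            replace (3 * (K * Lam * gi)) with (3 * K * (Lam * gi)) by ring. rewrite Rmult_assoc.
            apply Rmult_le_compat_r; [nra|]. unfold A, K. lra.
          - nra. }
        assert (H2 : 3 * g * x <= 3 * g * INR M) by (apply Rmult_le_compat_l; lra).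
        replace (A * Lam * (g * gi)) with (A * Lam * gi * (g - 1) + A * Lam * gi) by ring. lra.
    - lra.
    - apply Rlt_le, exp_pos.
    - intros z' Hz'. apply HP. apply (far_weaken _ (lami i - rho)); [lra|auto]. }
  destruct (resolvent_compact_bound T E (lam / 2)) as (B & HB & HBd); [lra|auto|].
  destruct (Pow_x_infinity g) with (b := ln B / (A * Lam)) as [J HJ].
  { rewrite Rabs_pos_eq; lra. }
  assert (HALam : 0 < A * Lam) by (apply Rmult_lt_0_compat; lra).
  assert (HPJ : P J).
  { intros z Hz. apply (bdd_below_weaken T z B).
    - rewrite <- (exp_ln B HB) at 1. apply exp_le.
      specialize (HJ J (le_n _)). rewrite Rabs_pos_eq in HJ by (apply pow_le; lra).
      apply Rge_le, (Rmult_le_compat_l (A * Lam)) in HJ; [|lra].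
      replace (A * Lam * (ln B / (A * Lam))) with (ln B) in HJ by (field; lra). exact HJ.
    - apply HBd. apply (far_weaken _ (lami J)); auto. unfold lami.
      assert (0 < (/ 2) ^ J) by (apply pow_lt; lra). nra. }
  assert (HP0 : P O).
  { clear HJ. induction J; auto. }
  intros z Hz. specialize (HP0 z). unfold lami in HP0.
  replace (lam / 2 + lam / 2 * (/ 2) ^ 0) with lam in HP0 by (simpl; field).
  specialize (HP0 Hz). simpl (g ^ 0) in HP0. rewrite Rmult_1_r in HP0. exact HP0.
Qed.

End Levinson.

(** * Functional calculus on the circle *)

Section Calculus.

Context {V : NormedModule C_AbsRing} (T S : V -> V) (HT : is_linear T) (HS : is_linear S).
Hypothesis (HST : forall x, S (T x) = x) (HTS : forall x, T (S x) = x).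

Lemma linear_at_zero (A : V -> V) : is_linear A -> A zero = zero.
Proof.
  intros HA. transitivity (A (scal (RtoC 0) zero)).
  - f_equal. vring.
  - rewrite (linear_scal A HA). vring.
Qed.

Lemma iter_linear (A : V -> V) n : is_linear A -> is_linear (Nat.iter n A).
Proof.
  intros HA. induction n; simpl.
  - apply is_linear_id.
  - apply (is_linear_comp (Nat.iter n A) A); auto.
Qed.

Lemma vsum_linear (A : V -> V) f n : is_linear A -> A (vsum f n) = vsum (fun k => A (f k)) n.
Proof.
  intros HA. induction n; simpl.
  - apply (linear_at_zero A HA).
  - now rewrite (linear_plus A HA), IHn.
Qed.

Lemma vsum_swap (f : nat -> nat -> V) n m :
  vsum (fun i => vsum (fun j => f i j) m) n = vsum (fun j => vsum (fun i => f i j) n) m.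
Proof.
  induction n; simpl.
  - induction m; simpl; auto. rewrite <- IHm. vring.
  - rewrite IHn, <- vsum_plus. reflexivity.
Qed.

Lemma vsum_scal_csum (c : nat -> C) (v : V) n : vsum (fun k => scal (c k) v) n = scal (csum c n) v.
Proof. induction n; simpl; [vring|]. rewrite IHn. vring. Qed.

Lemma vsum_split (f : nat -> V) n m : vsum f (n + m) = plus (vsum f n) (vsum (fun k => f (n + k)%nat) m).
Proof.
  induction m; simpl.
  - rewrite Nat.add_0_r. vring.
  - rewrite Nat.add_succ_r. simpl. rewrite IHm. vring.
Qed.

Lemma vsum_zero (f : nat -> V) n : (forall k, (k < n)%nat -> f k = zero) -> vsum f n = zero.
Proof.
  induction n; simpl; intros H; auto. rewrite IHn, H by auto. vring.
Qed.

(* The terms [r^|n| om^(-n) T^n x] for [-l <= n <= l]. *)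
Definition poisson (r : R) (om : C) (l : nat) (x : V) : V :=
  plus (vsum (fun n => scal ((RtoC r * Cconj om) ^ n)%C (Nat.iter n T x)) (1 + l))
       (vsum (fun n => scal ((RtoC r * om) ^ (1 + n))%C (Nat.iter (1 + n) S x)) l).

(** Operator form of the Poisson kernel: (1 - b S)(1 - a T) applied to the two-sided sum telescopes
    to (1 - r^2) x and four boundary terms, which will tend to 0 with l. The factor 1 - r^2 is the
    gain over estimating the two resolvents separately. *)
Lemma poisson_factor r om l x : Cmod om = 1 ->
  let a := (RtoC r * Cconj om)%C in let b := (RtoC r * om)%C in
  let y := poisson r om l x in let y1 := minus y (scal a (T y)) in
  minus y1 (scal b (S y1)) =
  plus (scal (RtoC 1 - RtoC r * RtoC r)%C x)
    (plus (plus (scal (- a ^ (1 + l))%C (Nat.iter (1 + l) T x))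
                (scal (RtoC r * RtoC r * a ^ l)%C (Nat.iter l T x)))
          (plus (scal (- b ^ (1 + l))%C (Nat.iter (1 + l) S x))
                (scal (RtoC r * RtoC r * b ^ l)%C (Nat.iter l S x)))).
Proof.
  intros Hom a b y y1.
  assert (Hab : (a * b)%C = (RtoC r * RtoC r)%C).
  { unfold a, b. assert (H : (om * Cconj om)%C = RtoC 1) by (rewrite <- Cmod2_conj, Hom; f_equal; ring).
    replace (RtoC r * Cconj om * (RtoC r * om))%C
      with (RtoC r * RtoC r * (om * Cconj om))%C by ring.
    rewrite H. ring. }
  set (P1 := vsum (fun n => scal (a ^ n)%C (Nat.iter n T x)) (1 + l)).
  set (P2 := vsum (fun n => scal (b ^ (1 + n))%C (Nat.iter (1 + n) S x)) l).
  assert (Hy : y = plus P1 P2) by reflexivity.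
  assert (H1 : minus P1 (scal a (T P1)) = minus x (scal (a ^ (1 + l))%C (Nat.iter (1 + l) T x))).
  { unfold P1. clear -HT. induction l; simpl.
    - rewrite !(linear_plus T HT), !(linear_scal T HT). replace (T zero) with (@zero V); [vring|].
      symmetry. apply (linear_at_zero T HT).
    - simpl in IHl. rewrite (linear_plus T HT), (linear_scal T HT).
      match type of IHl with minus ?u _ = _ => set (U := u) in * end.
      transitivity (plus (minus U (scal a (T U)))
        (minus (scal (a * a ^ l)%C (T (Nat.iter l T x)))
               (scal a (scal (a * a ^ l)%C (T (T (Nat.iter l T x))))))); [vring|].
      rewrite IHl. vring. }
  assert (H2 : minus P2 (scal b (S P2)) = minus (scal b (S x)) (scal (b ^ (1 + l))%C (Nat.iter (1 + l) S x))).
  { unfold P2. clear -HS. induction l; simpl.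
    - replace (S zero) with (@zero V); [vring|]. symmetry. apply (linear_at_zero S HS).
    - simpl in IHl. rewrite (linear_plus S HS), (linear_scal S HS).
      match type of IHl with minus ?u _ = _ => set (U := u) in * end.
      transitivity (plus (minus U (scal b (S U)))
        (minus (scal (b * b ^ l)%C (S (Nat.iter l S x)))
               (scal b (scal (b * b ^ l)%C (S (S (Nat.iter l S x))))))); [vring|].
      rewrite IHl. vring. }
  unfold y1. rewrite Hy.
  rewrite !(linear_plus T HT), !(is_linear_minus S HS), !(linear_plus S HS), !(linear_scal S HS), !(linear_plus S HS), !HST.
  (* The factors [1 - a T] and [1 - b S] commute: each is first applied to the sum it telescopes. *)
  transitivity (plus (minus (minus P1 (scal a (T P1))) (scal b (S (minus P1 (scal a (T P1))))))
     (minus (minus P2 (scal b (S P2))) (scal a (T (minus P2 (scal b (S P2))))))).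
  - rewrite !(is_linear_minus S HS), !(linear_scal S HS), !(is_linear_minus T HT), !(linear_scal T HT), !HST, !HTS.
    vring.
  - rewrite H1, H2. simpl.
    rewrite !(is_linear_minus S HS), !(linear_scal S HS), !(is_linear_minus T HT), !(linear_scal T HT), !HST, !HTS.
    rewrite <- Hab. vring.
Qed.

(** 1 - a T = - a (T - om / r) and T (1 - b S) = T - r om, so both factors of [poisson_factor] are
    inverted by resolvents, one on each side of the circle. The 2 bounds 1 / r and K bounds T. *)
Lemma poisson_bound r om l x K B1 B2 : Cmod om = 1 -> 1 / 2 <= r < 1 -> 0 <= K -> 0 <= B1 -> 0 <= B2 ->
  (forall v, norm (T v) <= K * norm v) ->
  bdd_below T (RtoC (/ r) * om)%C B1 -> bdd_below T (RtoC r * om)%C B2 ->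
  norm (poisson r om l x) <= 2 * K * B1 * B2 *
    ((1 - r * r) * norm x + (r ^ (1 + l) * norm (Nat.iter (1 + l) T x) + r ^ l * norm (Nat.iter l T x)
      + (r ^ (1 + l) * norm (Nat.iter (1 + l) S x) + r ^ l * norm (Nat.iter l S x)))).
Proof.
  intros Hom Hr HK HB1 HB2 HTK Hb1 Hb2.
  pose proof (poisson_factor r om l x Hom) as Hf. cbv zeta in Hf.
  set (a := (RtoC r * Cconj om)%C) in *. set (b := (RtoC r * om)%C) in *.
  set (y := poisson r om l x) in *. set (y1 := minus y (scal a (T y))) in *.
  assert (Ha : Cmod a = r) by (unfold a; rewrite Cmod_mult, Cmod_conj, Hom, Cmod_R, Rabs_pos_eq; lra).
  assert (Hb : Cmod b = r) by (unfold b; rewrite Cmod_mult, Hom, Cmod_R, Rabs_pos_eq; lra).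
  assert (Hoc : (om * Cconj om)%C = RtoC 1) by (rewrite <- Cmod2_conj, Hom; f_equal; ring).
  assert (H1 : norm y <= 2 * B1 * norm y1).
  { eapply Rle_trans; [apply Hb1|].
    assert (He : minus (T y) (scal (RtoC (/ r) * om)%C y) = scal (- (RtoC (/ r) * om))%C y1).
    { unfold y1.
      assert (Hc : (RtoC (/ r) * om * a)%C = RtoC 1).
      { unfold a. replace (RtoC (/ r) * om * (RtoC r * Cconj om))%C
          with (RtoC (/ r) * RtoC r * (om * Cconj om))%C by ring.
        rewrite Hoc, <- RtoC_mult, Rinv_l by lra. ring. }
      transitivity (minus (scal (RtoC (/ r) * om * a)%C (T y)) (scal (RtoC (/ r) * om)%C y)).
      - rewrite Hc. vring.
      - vring. }
    rewrite He. replace (2 * B1 * norm y1) with (B1 * (2 * norm y1)) by ring.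
    apply Rmult_le_compat_l; auto. eapply Rle_trans; [apply norm_scal_le|].
    apply Rmult_le_compat_r; [apply norm_nonneg|].
    rewrite Cmod_opp, Cmod_mult, Hom, Cmod_R, Rabs_pos_eq.
    - rewrite Rmult_1_r. replace 2 with (/ (1 / 2)) by field. apply Rinv_le_contravar; lra.
    - apply Rlt_le, Rinv_0_lt_compat; lra. }
  set (rhs := minus y1 (scal b (S y1))) in *.
  assert (H2 : norm y1 <= B2 * (K * norm rhs)).
  { eapply Rle_trans; [apply Hb2|]. apply Rmult_le_compat_l; auto.
    replace (minus (T y1) (scal b y1)) with (T rhs); [apply HTK|].
    unfold rhs. now rewrite (is_linear_minus T HT), (linear_scal T HT), HTS. }
  assert (Hr0 : forall n, 0 <= r ^ n) by (intros; apply pow_le; lra).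
  assert (Hn : norm rhs <= (1 - r * r) * norm x + (r ^ (1 + l) * norm (Nat.iter (1 + l) T x) + r ^ l * norm (Nat.iter l T x)
      + (r ^ (1 + l) * norm (Nat.iter (1 + l) S x) + r ^ l * norm (Nat.iter l S x)))).
  { rewrite Hf.
    assert (Hrr : r * r <= 1) by nra.
    assert (Hs : forall (cf : C) (v : V) q, Cmod cf <= q -> norm (scal cf v) <= q * norm v).
    { intros cf v q Hq. eapply Rle_trans; [apply norm_scal_le|]. apply Rmult_le_compat_r; auto. apply norm_nonneg. }
    assert (Hrl : forall cf, Cmod cf = r -> Cmod (RtoC r * RtoC r * cf ^ l)%C <= r ^ l).
    { intros cf Hcf. rewrite !Cmod_mult, Cmod_pow, Hcf, Cmod_R, Rabs_pos_eq by lra.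
      rewrite <- (Rmult_1_l (r ^ l)) at 2. apply Rmult_le_compat_r; auto. }
    eapply Rle_trans; [apply norm_plus_le|]. apply Rplus_le_compat.
    { apply Hs. rewrite <- RtoC_mult, <- RtoC_minus, Cmod_R, Rabs_pos_eq; lra. }
    eapply Rle_trans; [apply norm_plus_le|]. apply Rplus_le_compat.
    - eapply Rle_trans; [apply norm_plus_le|]. apply Rplus_le_compat; apply Hs; auto.
      rewrite Cmod_opp, Cmod_pow, Ha. lra.
    - eapply Rle_trans; [apply norm_plus_le|]. apply Rplus_le_compat; apply Hs; auto.
      rewrite Cmod_opp, Cmod_pow, Hb. lra. }
  assert (HBK : 0 <= B2 * K) by (now apply Rmult_le_pos).
  apply Rle_trans with (2 * B1 * (B2 * (K * norm rhs))).
  - eapply Rle_trans; [apply H1|]. apply Rmult_le_compat_l; lra.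
  - replace (2 * B1 * (B2 * (K * norm rhs))) with (2 * K * B1 * B2 * norm rhs) by ring.
    apply Rmult_le_compat_l; auto. repeat apply Rmult_le_pos; lra.
Qed.

(* [m] exceeds every difference of two frequencies, so that there is no aliasing. *)
Lemma poisson_average (p : nat -> C) M l r x : (M <= l)%nat -> let m := (l + M + 1)%nat in
  vsum (fun k => scal (csum (fun j => (p j * root m k ^ j)%C) M) (poisson r (root m k) l x)) m
  = scal (RtoC (INR m)) (vsum (fun n => scal (p n * RtoC (r ^ n))%C (Nat.iter n T x)) M).
Proof.
  intros HMl m.
  set (pv := fun k => csum (fun j => (p j * root m k ^ j)%C) M).
  assert (Hpos : forall n, (n < m)%nat ->
    csum (fun k => (pv k * (RtoC r * Cconj (root m k)) ^ n)%C) m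
    = if Nat.ltb n M then (RtoC (INR m) * (p n * RtoC (r ^ n)))%C else RtoC 0).
  { intros n Hn. unfold pv.
    rewrite (csum_ext _ (fun k => csum (fun j => (p j * RtoC (r ^ n) *
        (root m k ^ j * Cconj (root m k ^ n)%C))%C) M)).
    2:{ intros k _. rewrite Cmult_comm, <- csum_scal. apply csum_ext. intros j _.
        rewrite Cpow_mult_l, <- RtoC_pow, Cpow_conj. ring. }
    rewrite csum_swap.
    rewrite (csum_ext _ (fun j => (p j * RtoC (r ^ n) *
        (if Nat.eq_dec j n then RtoC (INR m) else RtoC 0))%C)).
    2:{ intros j Hj. rewrite csum_scal, root_orthogonal; auto. unfold m; lia. }
    destruct (Nat.ltb_spec n M).
    - rewrite (csum_single _ M n); auto.
      + destruct (Nat.eq_dec n n); [ring|lia].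
      + intros k Hk Hne. destruct (Nat.eq_dec k n); [lia|ring].
    - apply csum_zero. intros k Hk. destruct (Nat.eq_dec k n); [lia|ring]. }
  assert (Hneg : forall n, (n < l)%nat ->
    csum (fun k => (pv k * (RtoC r * root m k) ^ (1 + n))%C) m = RtoC 0).
  { intros n Hn. unfold pv.
    rewrite (csum_ext _ (fun k => csum (fun j => (p j * RtoC (r ^ (1 + n)) *
        (root m k ^ (j + (1 + n)) * Cconj (root m k ^ 0)%C))%C) M)).
    2:{ intros k _. rewrite Cmult_comm, <- csum_scal. apply csum_ext. intros j _.
        rewrite Cpow_mult_l, <- RtoC_pow, (Cpow_add_r (root m k) j (1 + n)).
        replace (Cconj (root m k ^ 0)%C) with (RtoC 1) by (unfold Cconj; simpl; unfold RtoC; f_equal; ring). ring. }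
    rewrite csum_swap. apply csum_zero. intros j Hj.
    rewrite csum_scal, root_orthogonal by (unfold m; lia).
    destruct (Nat.eq_dec (j + (1 + n)) 0); [lia|ring]. }
  transitivity (plus
    (vsum (fun n => scal (csum (fun k => (pv k * (RtoC r * Cconj (root m k)) ^ n)%C) m) (Nat.iter n T x)) (1 + l))
    (vsum (fun n => scal (csum (fun k => (pv k * (RtoC r * root m k) ^ (1 + n))%C) m) (Nat.iter (1 + n) S x)) l)).
  - rewrite (vsum_ext (fun n => scal (csum (fun k => (pv k * (RtoC r * Cconj (root m k)) ^ n)%C) m) (Nat.iter n T x))
      (fun n => vsum (fun k => scal (pv k * (RtoC r * Cconj (root m k)) ^ n)%C (Nat.iter n T x)) m))
      by (intros; now rewrite vsum_scal_csum).
    rewrite (vsum_ext (fun n => scal (csum (fun k => (pv k * (RtoC r * root m k) ^ (1 + n))%C) m) (Nat.iter (1 + n) S x))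
      (fun n => vsum (fun k => scal (pv k * (RtoC r * root m k) ^ (1 + n))%C (Nat.iter (1 + n) S x)) m))
      by (intros; now rewrite vsum_scal_csum).
    rewrite (vsum_swap _ (1 + l) m), (vsum_swap _ l m), <- vsum_plus.
    apply vsum_ext. intros k _. unfold poisson. fold (pv k).
    transitivity (plus (scal (pv k) (vsum (fun n => scal ((RtoC r * Cconj (root m k)) ^ n)%C (Nat.iter n T x)) (1 + l)))
      (scal (pv k) (vsum (fun n => scal ((RtoC r * root m k) ^ (1 + n))%C (Nat.iter (1 + n) S x)) l))); [vring|].
    rewrite <- !vsum_scal. f_equal; apply vsum_ext; intros n _; vring.
  - rewrite (vsum_zero (fun n => scal (csum (fun k => (pv k * (RtoC r * root m k) ^ (1 + n))%C) m) (Nat.iter (1 + n) S x))).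
    2:{ intros n Hn. rewrite Hneg by auto. vring. }
    replace (1 + l)%nat with (M + (1 + l - M))%nat by lia. rewrite vsum_split.
    rewrite (vsum_zero (fun k => scal (csum (fun k0 => (pv k0 * (RtoC r * Cconj (root m k0)) ^ (M + k))%C) m) (Nat.iter (M + k) T x))).
    2:{ intros n Hn. rewrite Hpos by (unfold m; lia). destruct (Nat.ltb_spec (M + n) M); [lia|]. vring. }
    rewrite <- vsum_scal.
    rewrite (vsum_ext _ (fun n => scal (RtoC (INR m)) (scal (p n * RtoC (r ^ n))%C (Nat.iter n T x)))).
    + vring.
    + intros n Hn. rewrite Hpos by (unfold m; lia). destruct (Nat.ltb_spec n M); [|lia]. vring.
Qed.

Lemma norm_scal_R (q : R) (v : V) : 0 <= q -> norm (scal (RtoC q) v) = q * norm v.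
Proof.
  intros Hq. apply Rle_antisym.
  - eapply Rle_trans; [apply norm_scal_le|]. rewrite Cmod_R, Rabs_pos_eq; lra.
  - destruct Hq as [Hq|<-].
    + rewrite <- (Rabs_pos_eq q) at 1 by lra. rewrite <- Cmod_R. apply norm_scal_ge.
      intros H. apply RtoC_inj in H. lra.
    + rewrite Rmult_0_l. apply norm_nonneg.
Qed.

Lemma polynomial_calculus_bound (p : nat -> C) M r K s : 1 / 2 <= r < 1 -> 0 <= K ->
  (forall v, norm (T v) <= K * norm v) ->
  (forall e, 0 < e -> exists l0, forall l x, (l0 <= l)%nat ->
     r ^ l * norm (Nat.iter l T x) <= e * norm x /\ r ^ l * norm (Nat.iter l S x) <= e * norm x) ->
  (forall t, 0 <= t <= 1 -> exists B1 B2, 0 <= B1 /\ 0 <= B2 /\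
     bdd_below T (RtoC (/ r) * cis (2 * PI * t))%C B1 /\
     bdd_below T (RtoC r * cis (2 * PI * t))%C B2 /\
     Cmod (csum (fun j => (p j * cis (2 * PI * t) ^ j)%C) M) * (2 * K * B1 * B2) * (1 - r * r) <= s) ->
  forall x, norm (vsum (fun n => scal (p n * RtoC (r ^ n))%C (Nat.iter n T x)) M) <= s * norm x.
Proof.
  intros Hr HK HTK Hdec Hsup x. pose proof (norm_nonneg x) as Hx.
  assert (Hq : 0 < 1 - r * r) by nra.
  apply (le_epsilon_mult _ _ (s * norm x * / (1 - r * r) * 4)). intros e He.
  destruct (Hdec e He) as (l0 & Hl0).
  set (l := (l0 + M)%nat). set (m := (l + M + 1)%nat).
  assert (Hm : 0 < INR m) by (apply lt_0_INR; unfold m; lia).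
  apply Rmult_le_reg_l with (INR m); auto.
  rewrite <- norm_scal_R by lra. 
  pose proof (poisson_average p M l r x ltac:(unfold l; lia)) as Ha. cbv zeta in Ha. fold m in Ha.
  rewrite <- Ha.
  eapply Rle_trans; [apply norm_vsum|]. rewrite <- rsum_const. apply rsum_le. intros k Hk.
  destruct (root_unit m k Hk) as (t & Ht & Hroot). rewrite Hroot.
  destruct (Hsup t Ht) as (B1 & B2 & HB1 & HB2 & Hb1 & Hb2 & Hs).
  set (P := csum (fun j => (p j * cis (2 * PI * t) ^ j)%C) M) in *.
  pose proof (Cmod_ge_0 P) as HP.
  eapply Rle_trans; [apply norm_scal_le|].
  assert (HBB : 0 <= 2 * K * B1 * B2) by (repeat apply Rmult_le_pos; lra).
  pose proof (poisson_bound r (cis (2 * PI * t)) l x K B1 B2 (Cmod_cis _) Hr HK HB1 HB2 HTK Hb1 Hb2) as Hpb.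
  destruct (Hl0 l x ltac:(unfold l; lia)) as [E1 E2].
  destruct (Hl0 (1 + l)%nat x ltac:(unfold l; lia)) as [E3 E4].
  apply Rle_trans with (Cmod P * (2 * K * B1 * B2 * ((1 - r * r) * norm x + 4 * (e * norm x)))).
  - apply Rmult_le_compat_l; auto. eapply Rle_trans; [apply Hpb|]. apply Rmult_le_compat_l; auto. lra.
  - set (G := 2 * K * B1 * B2) in *.
    replace (Cmod P * (G * ((1 - r * r) * norm x + 4 * (e * norm x)))) with
      (Cmod P * G * (1 - r * r) * (norm x + norm x * / (1 - r * r) * 4 * e)) by (field; lra).
    replace (s * norm x + s * norm x * / (1 - r * r) * 4 * e) with
      (s * (norm x + norm x * / (1 - r * r) * 4 * e)) by ring.
    apply Rmult_le_compat_r; auto.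
    assert (0 <= norm x * / (1 - r * r) * 4 * e); [|lra].
    repeat apply Rmult_le_pos; try lra. apply Rlt_le, Rinv_0_lt_compat; lra.
Qed.

Lemma sub_exponential_decay (A : V -> V) (M B beta r : R) : 0 < beta < 1 -> 0 < B -> 0 < M -> 0 < r < 1 ->
  (forall n x, (1 <= n)%nat -> norm (Nat.iter n A x) <= M * exp (B * Rpower (INR n) beta) * norm x) ->
  forall e, 0 < e -> exists l0, forall l x, (l0 <= l)%nat -> r ^ l * norm (Nat.iter l A x) <= e * norm x.
Proof.
  intros Hb HB HM Hr H e He.
  set (x := 1 - r). set (K := M * exp (B * Rpower (2 * B) (beta / (1 - beta)) * Rpower x (- (beta / (1 - beta))))).
  assert (HK : 0 < K) by (apply Rmult_lt_0_compat; [auto|apply exp_pos]).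
  set (p := exp (- (x / 2))).
  assert (Hp : 0 <= p < 1).
  { unfold p. split; [apply Rlt_le, exp_pos|]. rewrite <- exp_0. apply exp_increasing. unfold x. lra. }
  destruct (pow_small p (e / K) Hp) as [n0 Hn0]; [now apply Rdiv_lt_0_compat|].
  exists (1 + n0)%nat. intros [|l] v Hl; [lia|].
  specialize (Hn0 (1 + l)%nat ltac:(lia)). pose proof (norm_nonneg v) as Hv.
  specialize (H (1 + l)%nat v ltac:(lia)).
  pose proof (sub_exponential_bound beta B x l Hb HB ltac:(unfold x; lra)) as Hs.
  change (1 + l)%nat with (Datatypes.S l) in *.
  set (n := Datatypes.S l) in *.
  assert (Hrn : r ^ n <= exp (- (INR n * x))).
  { replace (exp (- (INR n * x))) with (exp (- x) ^ n) by (rewrite exp_pow_nat; f_equal; ring).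
    apply pow_incr. split; [lra|]. pose proof (exp_ineq1_le (- x)). unfold x in *. lra. }
  apply Rle_trans with (exp (- (INR n * x)) * (M * exp (B * Rpower (INR n) beta) * norm v)).
  - apply Rmult_le_compat; auto; [apply pow_le; lra|apply norm_nonneg].
  - apply Rle_trans with (K * p ^ n * norm v).
    + unfold K, p. rewrite exp_pow_nat.
      replace (exp (- (INR n * x)) * (M * exp (B * Rpower (INR n) beta) * norm v)) with
        (M * exp (B * Rpower (INR n) beta - INR n * x) * norm v) by (unfold Rminus; rewrite exp_plus; ring).
      rewrite (Rmult_assoc M _ (exp (INR n * _))), <- exp_plus.
      apply Rmult_le_compat_r; auto. apply Rmult_le_compat_l; [lra|]. apply exp_le. lra.
    + apply Rmult_le_compat_r; auto.
      apply Rmult_lt_compat_l with (r := K) in Hn0; auto.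
      replace (K * (e / K)) with e in Hn0 by (field; lra). lra.
Qed.

Lemma vsum_triangle (F : nat -> nat -> V) M :
  vsum (fun k => vsum (fun j => F j (k - j)%nat) (1 + k)) M = vsum (fun j => vsum (F j) (M - j)) M.
Proof.
  induction M; [reflexivity|].
  change (vsum ?f (Datatypes.S M)) with (plus (vsum f M) (f M)). cbv beta. rewrite IHM.
  rewrite (vsum_ext (fun j => vsum (F j) (Datatypes.S M - j)) (fun j => plus (vsum (F j) (M - j)) (F j (M - j)%nat))).
  - rewrite vsum_plus. change (1 + M)%nat with (Datatypes.S M).
    change (vsum ?f (Datatypes.S M)) with (plus (vsum f M) (f M)). cbv beta.
    replace (Datatypes.S M - M)%nat with 1%nat by lia. rewrite Nat.sub_diag.
    change (vsum (F M) 1) with (plus zero (F M O)). vring.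
  - intros k Hk. replace (Datatypes.S M - k)%nat with (Datatypes.S (M - k)) by lia. reflexivity.
Qed.

(** Multiplicativity of the calculus on partial sums: truncating the product at M truncates f at M -
    j. When b has degree below N, all partial sums of f with a nonzero coefficient are longer than M
    - N. *)
Lemma vsum_conv (f b : nat -> C) r M x :
  vsum (fun k => scal (conv f b k * RtoC (r ^ k))%C (Nat.iter k T x)) M
  = vsum (fun j => scal (b j * RtoC (r ^ j))%C (Nat.iter j T
      (vsum (fun n => scal (f n * RtoC (r ^ n))%C (Nat.iter n T x)) (M - j)))) M.
Proof.
  rewrite (vsum_ext _ (fun k => vsum (fun j => scal (b j * (f (k - j)%nat) * RtoC (r ^ (j + (k - j))))%C
     (Nat.iter (j + (k - j)) T x)) (1 + k))).
  - rewrite (vsum_triangle (fun j n => scal (b j * f n * RtoC (r ^ (j + n)))%C (Nat.iter (j + n) T x))).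
    apply vsum_ext. intros j _. rewrite vsum_linear by (now apply iter_linear).
    rewrite <- vsum_scal. apply vsum_ext. intros n _.
    rewrite (linear_scal _ (iter_linear T j HT)), <- Nat.iter_add, pow_add, RtoC_mult. vring.
  - intros k _. unfold conv. rewrite csum_rev.
    transitivity (scal (csum (fun j => (b j * (f (k - j)%nat) * RtoC (r ^ k))%C) (1 + k)) (Nat.iter k T x)).
    + f_equal. rewrite Cmult_comm, <- csum_scal. apply csum_ext. intros j Hj.
      replace (Datatypes.S k - 1 - j)%nat with (k - j)%nat by lia.
      replace (k - (k - j))%nat with j by lia. ring.
    + rewrite <- vsum_scal_csum. apply vsum_ext. intros j Hj.
      replace (j + (k - j))%nat with k by lia. reflexivity.
Qed.

End Calculus.

(** * Operator norms and pointwise bounds *)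

Section OpNorm.

Context {V : CompleteNormedModule C_AbsRing}.

Lemma op_norm_lub (A : V -> V) M : 0 <= M -> (forall x, norm (A x) <= M * norm x) ->
  0 <= op_norm A <= M /\ forall x, norm x <= 1 -> norm (A x) <= op_norm A.
Proof.
  intros HM H. unfold op_norm.
  set (E := fun r => exists x : V, norm x <= 1 /\ r = norm (A x)).
  destruct (Lub_Rbar_correct E) as [Hub Hleast].
  assert (HMub : is_ub_Rbar E M).
  { intros r (x & Hx & ->). simpl. pose proof (H x). pose proof (norm_nonneg x). nra. }
  specialize (Hleast _ HMub).
  assert (HE0 : E (norm (A zero))).
  { exists zero. split; auto.
    apply Rle_trans with 0; [right; exact (@norm_zero C_AbsRing V)|lra]. }
  pose proof (Hub _ HE0) as H0. pose proof (norm_nonneg (A zero)) as Hn0.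
  destruct (Lub_Rbar E) as [l| |]; simpl in *; try easy.
  split; [lra|]. intros x Hx. apply (Hub (norm (A x))). now exists x.
Qed.

Lemma op_norm_bound (A : V -> V) (HA : is_linear A) x : norm (A x) <= op_norm A * norm x.
Proof.
  destruct (linear_bound A HA) as (M & HM & H).
  destruct (op_norm_lub A M ltac:(lra) H) as [_ Hop].
  pose proof (norm_nonneg x) as [Hx|Hx].
  - set (y := scal (RtoC (/ norm x)) x).
    assert (Hinv : 0 < / norm x) by (now apply Rinv_0_lt_compat).
    assert (Hy : norm y <= 1).
    { apply Rle_trans with (/ norm x * norm x); [apply Req_le; exact (norm_scal_R (V := V) (/ norm x) x (Rlt_le _ _ Hinv))|]. rewrite Rinv_l; lra. }
    assert (HAy : A y = scal (RtoC (/ norm x)) (A x)) by apply (linear_scal A HA).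
    specialize (Hop y Hy). rewrite HAy in Hop.
    apply (Rle_trans _ _ _ (Req_le _ _ (eq_sym (norm_scal_R (V := V) (/ norm x) (A x) (Rlt_le _ _ Hinv))))) in Hop.
    apply Rmult_le_reg_l with (/ norm x); auto.
    replace (/ norm x * (op_norm A * norm x)) with (op_norm A) by (field; lra). exact Hop.
  - symmetry in Hx. pose proof (H x) as Hx'. rewrite Hx in *. lra.
Qed.

(** The finitely many initial powers are bounded one by one, and u >= 1 lets the constant absorb
    them. *)
Lemma growth_all_n (A : V -> V) (u : nat -> R) : is_linear A -> (forall n, 1 <= u n) ->
  (exists M, eventually (fun n => Rabs (op_norm (op_pow A n)) <= M * u n)) ->
  exists M, 1 <= M /\ forall n x, norm (Nat.iter n A x) <= M * u n * norm x.
Proof.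
  intros HA Hu (M & n0 & HM).
  set (Q := fun n m => forall x, norm (Nat.iter n A x) <= m * norm x).
  destruct (exists_common_bound Q) with (n := n0) as (M0 & HM0 & HQ).
  - intros i a b Ha Hab x. eapply Rle_trans; [apply Ha|]. apply Rmult_le_compat_r; auto. apply norm_nonneg.
  - intros i. destruct (linear_bound _ (iter_linear A i HA)) as (m & Hm & H). exists m. split; [lra|exact H].
  - exists (Rmax (M0 + 1) M). pose proof (Rmax_l (M0 + 1) M). pose proof (Rmax_r (M0 + 1) M).
    split; [lra|]. intros n x. pose proof (norm_nonneg x). specialize (Hu n).
    set (X := Rmax (M0 + 1) M) in *. assert (HXu : X <= X * u n) by nra.
    destruct (Nat.le_gt_cases n n0) as [Hn|Hn].
    + eapply Rle_trans; [apply (HQ n Hn)|]. apply Rmult_le_compat_r; auto. lra.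
    + eapply Rle_trans; [apply (op_norm_bound _ (iter_linear A n HA))|].
      apply Rmult_le_compat_r; auto. specialize (HM n ltac:(lia)).
      apply Rle_trans with (Rabs (op_norm (op_pow A n))); [exact (Rle_abs (op_norm (op_pow A n)))|].
      assert (M * u n <= X * u n) by (apply Rmult_le_compat_r; lra). lra.
Qed.

End OpNorm.

(** * Exponents *)

Lemma b_exponent_bounds xi : 0 < xi < 1 / 2 -> 0 < b_exponent xi < 1.
Proof.
  intros Hxi. unfold b_exponent.
  assert (HL : ln 2 < ln (1 / xi)).
  { apply ln_increasing; [lra|]. apply Rmult_lt_reg_r with xi; [lra|].
    unfold Rdiv. rewrite Rmult_1_l, Rinv_l; lra. }
  assert (H2 : 0 < ln 2) by (rewrite <- ln_1; apply ln_increasing; lra).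
  split; [apply Rdiv_lt_0_compat; lra|].
  apply Rmult_lt_reg_r with (2 * ln (1 / xi) - ln 2); [lra|].
  unfold Rdiv. rewrite Rmult_assoc, Rinv_l; lra.
Qed.

(* [beta < b(xi)] says exactly that [gamma = beta / (1 - beta)] is smaller than one minus the
   dimension [ln 2 / ln (1 / xi)] of the Cantor set. *)
Lemma b_exponent_dimension xi beta : 0 < xi < 1 / 2 -> 0 < beta < b_exponent xi ->
  1 < Rpower xi (- (beta / (1 - beta))) < / (2 * xi).
Proof.
  intros Hxi [Hb0 Hb]. pose proof (b_exponent_bounds xi Hxi) as Hbb.
  assert (Hb1 : beta < 1) by lra.
  set (gam := beta / (1 - beta)).
  assert (Hg : 0 < gam) by (apply Rdiv_lt_0_compat; lra).
  set (L := ln (1 / xi)).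
  assert (HLx : ln xi = - L).
  { unfold L, Rdiv. rewrite Rmult_1_l, ln_Rinv by lra. ring. }
  assert (HL : ln 2 < L).
  { apply ln_increasing; [lra|]. apply Rmult_lt_reg_r with xi; [lra|].
    unfold Rdiv. rewrite Rmult_1_l, Rinv_l; lra. }
  assert (H2 : 0 < ln 2) by (rewrite <- ln_1; apply ln_increasing; lra).
  assert (Hgl : gam * L < L - ln 2).
  { unfold b_exponent in Hb. fold L in Hb.
    assert (H : beta * (2 * L - ln 2) < L - ln 2).
    { apply Rmult_lt_compat_r with (r := 2 * L - ln 2) in Hb; [|lra].
      replace ((L - ln 2) / (2 * L - ln 2) * (2 * L - ln 2)) with (L - ln 2) in Hb by (field; lra). exact Hb. }
    apply Rmult_lt_reg_r with (1 - beta); [lra|].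
    replace (gam * L * (1 - beta)) with (beta * L) by (unfold gam; field; lra). lra. }
  unfold Rpower. rewrite HLx. replace (- gam * - L) with (gam * L) by ring. split.
  - rewrite <- exp_0. apply exp_increasing. apply Rmult_lt_0_compat; lra.
  - replace (/ (2 * xi)) with (exp (L - ln 2)).
    + now apply exp_increasing.
    + unfold Rminus. rewrite exp_plus, exp_Ropp, exp_ln by lra. unfold L.
      rewrite exp_ln by (apply Rdiv_lt_0_compat; lra). field. lra.
Qed.

Lemma Rpower_le_exp_Rpower s beta n : 0 <= s -> 0 < beta -> (1 <= n)%nat ->
  Rpower (INR (S n)) s <= exp (s / beta * Rpower 2 beta * Rpower (INR n) beta).
Proof.
  intros Hs Hb Hn. assert (Hn1 : 1 <= INR n) by (apply (le_INR 1); auto).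
  unfold Rpower at 1. apply exp_le.
  assert (Hln : ln (INR (S n)) <= / beta * Rpower (INR (S n)) beta).
  { pose proof (exp_ineq1_le (beta * ln (INR (S n)))) as H.
    apply Rmult_le_reg_l with beta; auto. rewrite <- Rmult_assoc, Rinv_r, Rmult_1_l by lra.
    unfold Rpower. lra. }
  assert (H2 : Rpower (INR (S n)) beta <= Rpower 2 beta * Rpower (INR n) beta).
  { rewrite Rpower_mult_distr by lra. apply Rle_Rpower_l; [lra|].
    split; [apply lt_0_INR; lia|]. rewrite S_INR. lra. }
  assert (Hib : 0 < / beta) by (now apply Rinv_0_lt_compat).
  apply Rle_trans with (s * (/ beta * (Rpower 2 beta * Rpower (INR n) beta))).
  - apply Rmult_le_compat_l; auto. eapply Rle_trans; [apply Hln|]. apply Rmult_le_compat_l; lra.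
  - apply Req_le. field. lra.
Qed.

(** * Distance to the Cantor set *)

Lemma perfect_symmetric_digits xi e : perfect_symmetric_set xi e <->
  exists eps, digits eps /\ e = cis (2 * PI * digit_sum xi eps).
Proof.
  unfold perfect_symmetric_set, digits, digit_sum. split; intros (eps & H1 & ->); exists eps; split; auto; f_equal; ring.
Qed.

(** For j < K the distance 5 xi^(j + 1) on the circle survives a radial displacement by 2 xi^K; for
    j = K the displacement itself keeps the point away from the set. *)
Lemma far_radial xi K j t r : 0 < xi < 1 / 2 -> (j <= K)%nat -> (j = K \/ ~ near xi (S j) t) ->
  Rabs (r - 1) <= 2 * xi ^ K -> xi ^ K <= Rabs (r - 1) -> 0 <= r <= 2 ->
  far (perfect_symmetric_set xi) (xi ^ S j) (RtoC r * cis (2 * PI * t))%C.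
Proof.
  intros Hxi Hj Hn Hr1 Hr2 Hr. split.
  - rewrite Cmod_mult, Cmod_cis, Cmod_R, Rabs_pos_eq; lra.
  - intros e He. apply perfect_symmetric_digits in He. destruct He as (eps & Heps & ->).
    assert (Hxj : 0 < xi ^ S j) by (apply pow_lt; lra).
    set (z := cis (2 * PI * t)). set (e := cis (2 * PI * digit_sum xi eps)).
    destruct (Nat.eq_dec j K) as [->|Hne].
    + apply Rle_trans with (Rabs (r - 1)).
      * assert (0 < xi ^ K) by (apply pow_lt; lra). simpl. nra.
      * assert (H : Cmod (RtoC r * z)%C = r).
        { unfold z. rewrite Cmod_mult, Cmod_cis, Cmod_R, Rabs_pos_eq; lra. }
        pose proof (Cmod_le_minus (RtoC r * z)%C e) as H1.
        pose proof (Cmod_le_minus e (RtoC r * z)%C) as H2.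
        rewrite (Cmod_minus_sym e) in H2. unfold e in H1 at 1, H2 at 1. rewrite Cmod_cis in H1, H2.
        apply Rabs_le. lra.
    + destruct Hn as [Hn|Hn]; [lia|].
      pose proof (not_near_far xi Hxi j t Hn eps Heps) as Hf. fold z e in Hf.
      assert (HK : xi ^ K <= xi ^ S j).
      { replace K with (S j + (K - S j))%nat by lia. rewrite pow_add.
        assert (xi ^ (K - S j) <= 1) by (apply Rle_trans with (1 ^ (K - S j)); [apply pow_incr; lra|rewrite pow1; lra]).
        nra. }
      pose proof (Cmod_triangle (RtoC r * z - e)%C (RtoC (1 - r) * z)%C) as Ht.
      replace (RtoC r * z - e + RtoC (1 - r) * z)%C with (z - e)%C in Ht
        by (rewrite RtoC_minus; ring).
      rewrite (Cmod_mult (RtoC (1 - r))), Cmod_R, Rabs_minus_sym in Ht.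
      unfold z in Ht at 3. rewrite Cmod_cis in Ht. lra.
Qed.

Lemma conv_trunc_low f c N k : (forall n, conv f c n = delta n) -> (k < N)%nat ->
  conv f (trunc N c) k = delta k.
Proof.
  intros H Hk. rewrite <- H. unfold conv. apply csum_ext. intros i Hi. unfold trunc.
  destruct (Nat.ltb_spec (k - i) N); [reflexivity|lia].
Qed.

(** * Bound for the negative powers *)

Section Core.

Context {V : NormedModule C_AbsRing} (T S : V -> V) (HT : is_linear T) (HS : is_linear S).
Hypothesis (HST : forall x, S (T x) = x) (HTS : forall x, T (S x) = x).
Context (xi : R) (Hxi : 0 < xi < 1 / 2) (R0 : C -> V -> V).
Let E := perfect_symmetric_set xi.
Hypothesis HR0 : forall z, ~ E z -> forall x,
  minus (T (R0 z x)) (scal z (R0 z x)) = x /\ R0 z (minus (T x) (scal z x)) = x.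
Hypothesis HRb : forall z, ~ E z -> exists B, 0 < B /\ bdd_below T z B.

Section Flat.

Context (M B beta : R) (Hbeta : 0 < beta < 1) (HB : 0 < B) (HM : 1 <= M).
Hypothesis HpT : forall n x, (1 <= n)%nat ->
  norm (Nat.iter n T x) <= M * exp (B * Rpower (INR n) beta) * norm x.
Hypothesis HpS : forall n x, (1 <= n)%nat ->
  norm (Nat.iter n S x) <= M * exp (B * Rpower (INR n) beta) * norm x.

(* A family decaying on the circle faster than the resolvent grows is in the limit annihilated by
   the functional calculus: the jump of the resolvent across the circle carries a factor [1 - r^2]. *)
Lemma flat_family_vanishes w (f : nat -> nat -> C) D a :
  Rpower xi (- (beta / (1 - beta))) < w -> 1 < Rpower xi (- (beta / (1 - beta))) ->
  0 < D -> 0 < a -> (forall K, geo (f K)) ->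
  (forall K j t, (j <= K)%nat -> near xi j t ->
     Cmod (ev (f K) (cis (2 * PI * t))) <= D * exp (- (a * w ^ j))) ->
  forall eta, 0 < eta -> exists K m0, (1 <= K)%nat /\ forall m x, (m0 <= m)%nat ->
    norm (vsum (fun n => scal (f K n * RtoC ((1 - xi ^ K) ^ n))%C (Nat.iter n T x)) m) <= eta * norm x.
Proof.
  intros Hvw Hv1 HD Ha Hgeo Hflat eta Heta.
  set (gam := beta / (1 - beta)) in *.
  assert (Hgam : 0 < gam) by (apply Rdiv_lt_0_compat; lra).
  set (v := Rpower xi (- gam)) in *.
  destruct (resolvent_direct_bound T S M B beta HT HS HST HTS Hbeta HB HM HpT HpS) as (c & Hc & Hdirect).
  fold gam in Hdirect.
  destruct (levinson T HT E R0 HR0 HRb c gam Hc Hgam Hdirect) as (A & HA & Hlev).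
  destruct (linear_bound T HT) as (KT & HKT & HTK).
  destruct (exp_gap v w a (2 * A * v)) as (G & HG & Hgap); [lra|auto|].
  (* The values of f contribute at most 2 KT D G (1 - r^2) with 1 - r^2 <= 2 xi^K, which this choice
     makes less than eta / 2. *)
  destruct (pow_small xi (eta / (8 * KT * D * G))) as [K0 HK0]; [lra| |].
  { apply Rdiv_lt_0_compat; auto. repeat apply Rmult_lt_0_compat; lra. }
  set (K := (1 + K0)%nat). specialize (HK0 K ltac:(unfold K; lia)).
  assert (HxK : 0 < xi ^ K) by (apply pow_lt; lra).
  assert (HxK2 : xi ^ K <= 1 / 2).
  { unfold K. simpl. assert (xi ^ K0 <= 1) by (apply Rle_trans with (1 ^ K0); [apply pow_incr; lra|rewrite pow1; lra]).
    assert (0 < xi ^ K0) by (apply pow_lt; lra). nra. }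
  set (r := 1 - xi ^ K). assert (Hr : 1 / 2 <= r < 1) by (unfold r; lra).
  (* The resolvent product at the worst level j = K. The error of truncating the series of f must be
     small against it, so m0 is chosen after K. *)
  set (big := 2 * KT * exp (2 * A * v * v ^ K)).
  assert (Hbig : 0 < big) by (apply Rmult_lt_0_compat; [lra|apply exp_pos]).
  destruct (ev_unif_limit (f K) (Hgeo K) (eta / (2 * big))) as [m0 Hm0]; [apply Rdiv_lt_0_compat; lra|].
  exists K, m0. split; [unfold K; lia|]. intros m x Hm. fold r.
  apply (polynomial_calculus_bound T S HT HS HST HTS (f K) m r KT eta); auto; [lra| |].
  - intros e He.
    destruct (sub_exponential_decay T M B beta r Hbeta HB ltac:(lra) ltac:(lra) HpT e He) as [l1 Hl1].
    destruct (sub_exponential_decay S M B beta r Hbeta HB ltac:(lra) ltac:(lra) HpS e He) as [l2 Hl2].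
    exists (l1 + l2)%nat. intros l y Hl. split; [apply Hl1; lia|apply Hl2; lia].
  - intros t Ht. destruct (near_level xi K t) as (j & Hj & Hnear & Hfar).
    assert (Hvj : 0 < v ^ j) by (apply pow_lt; lra).
    assert (Hxj : 0 < xi ^ Datatypes.S j) by (apply pow_lt; lra).
    assert (Hxj1 : xi ^ Datatypes.S j <= 1).
    { apply Rle_trans with (1 ^ Datatypes.S j); [apply pow_incr; lra|rewrite pow1; lra]. }
    assert (Hvpow : Rpower (xi ^ Datatypes.S j) (- gam) = v * v ^ j).
    { rewrite tech_pow_Rmult. unfold v. rewrite <- !Rpower_pow by (lra || apply exp_pos).
      rewrite !Rpower_mult. f_equal. ring. }
    set (B1 := exp (A * (v * v ^ j))). assert (HB1 : 0 < B1) by apply exp_pos.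
    assert (Hinv : xi ^ K <= / r - 1 <= 2 * xi ^ K).
    { replace (/ r - 1) with (xi ^ K * / r) by (unfold r; field; unfold r in Hr; lra).
      assert (1 <= / r) by (rewrite <- Rinv_1; apply Rinv_le_contravar; lra).
      assert (/ r <= 2) by (replace 2 with (/ (1 / 2)) by field; apply Rinv_le_contravar; lra).
      nra. }
    exists B1, B1. split; [lra|]. split; [lra|]. split; [|split].
    + unfold B1. rewrite <- Hvpow. apply Hlev; [lra|].
      apply (far_radial xi K j t (/ r)); auto; try (rewrite Rabs_pos_eq; lra).
      assert (0 < / r) by (apply Rinv_0_lt_compat; lra). lra.
    + unfold B1. rewrite <- Hvpow. apply Hlev; [lra|].
      apply (far_radial xi K j t r); auto; try (rewrite Rabs_left; unfold r; lra). lra.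
    + set (P := csum (fun n => (f K n * cis (2 * PI * t) ^ n)%C) m).
      assert (HBB : B1 * B1 = exp (2 * A * v * v ^ j)).
      { unfold B1. rewrite <- exp_plus. f_equal. ring. }
      assert (HP : Cmod P <= D * exp (- (a * w ^ j)) + eta / (2 * big)).
      { pose proof (Hm0 m (cis (2 * PI * t)) Hm ltac:(rewrite Cmod_cis; lra)) as H1. fold P in H1.
        rewrite Cmod_minus_sym in H1. pose proof (Cmod_le_minus P (ev (f K) (cis (2 * PI * t)))).
        pose proof (Hflat K j t Hj Hnear). lra. }
      replace (2 * KT * B1 * B1) with (2 * KT * exp (2 * A * v * v ^ j)) by (rewrite <- HBB; ring).
      set (Q := exp (2 * A * v * v ^ j)). assert (HQ : 0 < Q) by apply exp_pos.
      assert (HQbig : 2 * KT * Q <= big).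
      { unfold big, Q. apply Rmult_le_compat_l; [lra|]. apply exp_le.
        apply Rmult_le_compat_l; [repeat apply Rmult_le_pos; lra|]. apply Rle_pow; [lra|auto]. }
      assert (Hexp : exp (- (a * w ^ j)) * Q <= G).
      { unfold Q. rewrite <- exp_plus. specialize (Hgap j).
        replace (- (a * w ^ j) + 2 * A * v * v ^ j) with (2 * A * v * v ^ j - a * w ^ j) by ring. exact Hgap. }
      assert (Hrr : 0 < 1 - r * r <= 2 * xi ^ K) by (unfold r in *; nra).
      assert (Hxi1 : xi ^ K <= 1) by lra.
      apply Rle_trans with ((D * exp (- (a * w ^ j)) + eta / (2 * big)) * (2 * KT * Q) * (1 - r * r)).
      { apply Rmult_le_compat_r; [lra|]. apply Rmult_le_compat_r; auto. apply Rmult_le_pos; lra. }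
      replace ((D * exp (- (a * w ^ j)) + eta / (2 * big)) * (2 * KT * Q) * (1 - r * r)) with
        (2 * KT * D * (exp (- (a * w ^ j)) * Q) * (1 - r * r) + eta / (2 * big) * (2 * KT * Q) * (1 - r * r)) by ring.
      assert (Hpart1 : 2 * KT * D * (exp (- (a * w ^ j)) * Q) * (1 - r * r) <= eta / 2).
      { apply Rle_trans with (2 * KT * D * G * (2 * xi ^ K)).
        - apply Rmult_le_compat; try lra.
          + apply Rmult_le_pos; [apply Rmult_le_pos; lra|].
            apply Rmult_le_pos; [apply Rlt_le, exp_pos|lra].
          + apply Rmult_le_compat_l; [apply Rmult_le_pos; lra|auto].
        - apply Rmult_lt_compat_l with (r := 8 * KT * D * G) in HK0.
          + replace (8 * KT * D * G * (eta / (8 * KT * D * G))) with eta in HK0 by (field; lra). lra.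
          + repeat apply Rmult_lt_0_compat; lra. }
      assert (Hpart2 : eta / (2 * big) * (2 * KT * Q) * (1 - r * r) <= eta / 2).
      { apply Rle_trans with (eta / (2 * big) * big * 1).
        - apply Rmult_le_compat; try lra.
          + apply Rmult_le_pos; [apply Rlt_le, Rdiv_lt_0_compat; lra|]. apply Rmult_le_pos; lra.
          + apply Rmult_le_compat_l; auto. apply Rlt_le, Rdiv_lt_0_compat; lra.
        - apply Req_le. field. lra. }
      lra.
Qed.

End Flat.

Lemma iter_inverse n x : Nat.iter n S (Nat.iter n T x) = x.
Proof.
  induction n; auto. rewrite Nat.iter_succ_r. simpl. now rewrite HST.
Qed.

Lemma iter_cancel n k x : Nat.iter n S (Nat.iter (n + k) T x) = Nat.iter k T x.
Proof. rewrite Nat.iter_add. apply iter_inverse. Qed.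

Lemma iter_bounded (A : V -> V) : is_linear A -> forall n, exists b, 0 < b /\ forall i x, (i <= n)%nat ->
  norm (Nat.iter i A x) <= b * norm x.
Proof.
  intros HA n.
  destruct (exists_common_bound (fun i b => forall x, norm (Nat.iter i A x) <= b * norm x)) with (n := n)
    as (b & Hb & H).
  - intros i b b' H Hle x. eapply Rle_trans; [apply H|]. apply Rmult_le_compat_r; auto. apply norm_nonneg.
  - intros i. destruct (linear_bound _ (iter_linear A i HA)) as (b & Hb & H). exists b. split; [lra|auto].
  - exists b. split; auto.
Qed.

(** The relation f(T) = 0 is only available as smallness of the partial sums of f(r T). The partial
    sum of h(r T) x is x plus a tail starting at T^N, since h = 1 + O(z^N), and by [vsum_conv] it is
    small; applying S^N expresses S^N x by nonnegative powers T^i, weighted by h_(N + i), up to an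
    error that tends to 0 with eta. *)
Lemma negative_power_bound (s beta M1 M2 : R) : 0 <= s -> 0 < beta < b_exponent xi -> 1 <= M1 -> 1 <= M2 ->
  (forall n x, norm (Nat.iter n T x) <= M1 * Rpower (INR (Datatypes.S n)) s * norm x) ->
  (forall n x, (1 <= n)%nat -> norm (Nat.iter n S x) <= M2 * exp (Rpower (INR n) beta) * norm x) ->
  exists c N0, 0 < c /\ forall N x, (N0 <= N)%nat ->
    norm (Nat.iter N S x) <= c * Rpower (INR N) (s + 1 / 2) * norm x.
Proof.
  intros Hs Hb HM1 HM2 HpT HpS.
  pose proof (b_exponent_bounds xi Hxi) as Hbb.
  destruct (b_exponent_dimension xi beta Hxi Hb) as [Hv1 Hv2].
  set (v := Rpower xi (- (beta / (1 - beta)))) in *.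
  (* Any w strictly between these bounds would do: w > v makes f decay faster than the resolvent
     grows, and 2 xi w < 1 makes the potential converge away from the set. *)
  set (w := (v + / (2 * xi)) / 2).
  assert (Hw : 1 < w) by (unfold w; lra).
  assert (Hxw : 2 * xi * w < 1).
  { apply Rlt_le_trans with (2 * xi * / (2 * xi)).
    - apply Rmult_lt_compat_l; [lra|]. unfold w; lra.
    - rewrite Rinv_r; lra. }
  (* One pair of constants for both signs: the first term of B dominates the polynomial growth of
     the powers of T, the 1 the growth of the powers of S. *)
  set (B := s / beta * Rpower 2 beta + 1). set (M := M1 + M2).
  assert (Hsb : 0 <= s / beta * Rpower 2 beta).
  { apply Rmult_le_pos; [apply Rdiv_le_0_compat; lra|apply Rlt_le, exp_pos]. }
  assert (HB : 0 < B) by (unfold B; lra).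
  assert (HpT' : forall n x, (1 <= n)%nat -> norm (Nat.iter n T x) <= M * exp (B * Rpower (INR n) beta) * norm x).
  { intros n x Hn. eapply Rle_trans; [apply HpT|]. apply Rmult_le_compat_r; [apply norm_nonneg|].
    apply Rmult_le_compat; [lra|apply Rlt_le, exp_pos|unfold M; lra|].
    eapply Rle_trans; [apply (Rpower_le_exp_Rpower s beta n); auto; lra|].
    apply exp_le. apply Rmult_le_compat_r; [apply Rlt_le, exp_pos|unfold B; lra]. }
  assert (HpS' : forall n x, (1 <= n)%nat -> norm (Nat.iter n S x) <= M * exp (B * Rpower (INR n) beta) * norm x).
  { intros n x Hn. eapply Rle_trans; [now apply HpS|]. apply Rmult_le_compat_r; [apply norm_nonneg|].
    apply Rmult_le_compat; [lra|apply Rlt_le, exp_pos|unfold M; lra|].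
    apply exp_le. rewrite <- (Rmult_1_l (Rpower (INR n) beta)) at 1.
    apply Rmult_le_compat_r; [apply Rlt_le, exp_pos|unfold B; lra]. }
  destruct (INR_unbounded (s + 1)) as [P HP].
  destruct (peak_functions xi w Hxi Hw Hxw P) as (B0 & HB0 & Hpeak).
  set (cst := 2 ^ P * 2 * B0). assert (Hcst : 0 < cst).
  { unfold cst. repeat apply Rmult_lt_0_compat; try lra. apply pow_lt; lra. }
  exists (M1 * cst), (2 + 2 * P)%nat. split; [apply Rmult_lt_0_compat; lra|].
  intros N x HN.
  destruct (Hpeak N ltac:(lia)) as (f & c & Hgeo & Hinv & (D & a & HD & Ha & Hflat) & Hcb & Hl2).
  destruct (iter_bounded T HT N) as (bT & HbT & HTN).
  destruct (iter_bounded S HS N) as (bS & HbS & HSN).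
  pose proof (norm_nonneg x) as Hx.
  (* N is fixed while eta tends to 0, so the crude bounds bS and bT for the powers up to N are
     harmless here. *)
  apply (le_epsilon_mult _ _ (INR N * (B0 * bS * bT) * norm x)). intros eta Heta.
  destruct (flat_family_vanishes M B beta ltac:(lra) HB ltac:(unfold M; lra) HpT' HpS' w f D a
    ltac:(fold v; unfold w; lra) Hv1 HD Ha Hgeo Hflat eta Heta) as (K & m0 & HK & Hsmall).
  set (r := 1 - xi ^ K) in *.
  assert (Hr : 0 <= r <= 1).
  { assert (0 < xi ^ K) by (apply pow_lt; lra).
    assert (xi ^ K <= 1) by (apply Rle_trans with (1 ^ K); [apply pow_incr; lra|rewrite pow1; lra]).
    unfold r; lra. }
  assert (Hrn : forall n, 0 <= r ^ n <= 1).
  { intros n. split; [apply pow_le; lra|]. apply Rle_trans with (1 ^ n); [apply pow_incr; lra|rewrite pow1; lra]. }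
  set (b := trunc N (c K)). set (h := conv (f K) b).
  set (Phi := fun m => vsum (fun n => scal (f K n * RtoC (r ^ n))%C (Nat.iter n T x)) m).
  set (u := fun k => scal (h k * RtoC (r ^ k))%C (Nat.iter k T x)).
  set (m := m0).
  pose proof (vsum_conv T HT (f K) b r (N + m) x) as Hconv.
  fold h in Hconv. change (vsum u (N + m) = vsum (fun j => scal (b j * RtoC (r ^ j))%C
    (Nat.iter j T (Phi (N + m - j)%nat))) (N + m)) in Hconv.
  rewrite !vsum_split in Hconv.
  assert (Hhead : vsum u N = x).
  { destruct N as [|N']; [lia|].
    assert (H0 : forall n, (n < Datatypes.S N')%nat -> h n = delta n).
    { intros n Hn. apply conv_trunc_low; auto. }
    clear Hconv. revert H0. generalize N' at 1 2. intros N1 H0. induction N1.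
    - simpl. unfold u. rewrite H0 by lia. simpl. vring.
    - change (vsum u (Datatypes.S (Datatypes.S N1))) with (plus (vsum u (Datatypes.S N1)) (u (Datatypes.S N1))).
      rewrite IHN1 by (intros; apply H0; lia). unfold u. rewrite (H0 (Datatypes.S N1)) by lia.
      unfold delta. vring. }
  assert (Htail : vsum (fun k => scal ((b (N + k)%nat) * RtoC (r ^ (N + k)))%C
    (Nat.iter (N + k) T (Phi (N + m - (N + k))%nat))) m = zero).
  { apply vsum_zero. intros k _. unfold b, trunc. destruct (Nat.ltb_spec (N + k) N); [lia|]. vring. }
  rewrite Hhead, Htail in Hconv.
  pose proof (iter_linear S N HS) as HSNlin.
  apply (f_equal (Nat.iter N S)) in Hconv.
  rewrite !(linear_plus _ HSNlin), (linear_at_zero _ HSNlin), !(vsum_linear _ _ _ HSNlin) in Hconv.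
  set (main := vsum (fun j => Nat.iter N S (scal (b j * RtoC (r ^ j))%C (Nat.iter j T (Phi (N + m - j)%nat)))) N) in *.
  set (tail := vsum (fun k => Nat.iter N S (u (N + k)%nat)) m) in *.
  assert (HeqS : Nat.iter N S x = minus main tail).
  { transitivity (minus (plus (Nat.iter N S x) tail) tail); [vring|]. rewrite Hconv. vring. }
  rewrite HeqS. eapply Rle_trans; [apply norm_minus_le|].
  assert (Hmain : norm main <= INR N * (B0 * bS * bT) * norm x * eta).
  { unfold main. eapply Rle_trans; [apply norm_vsum|].
    replace (INR N * (B0 * bS * bT) * norm x * eta) with (rsum (fun _ => B0 * bS * bT * (eta * norm x)) N)
      by (rewrite rsum_const; ring).
    apply rsum_le. intros j Hj.
    rewrite (linear_scal _ HSNlin). eapply Rle_trans; [apply norm_scal_le|].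
    rewrite Cmod_mult, Cmod_R, Rabs_pos_eq by apply Hrn.
    assert (Hbj : Cmod (b j) <= B0).
    { unfold b, trunc. destruct (Nat.ltb_spec j N); [now apply Hcb|lia]. }
    assert (HPhi : norm (Phi (N + m - j)%nat) <= eta * norm x) by (apply Hsmall; unfold m; lia).
    assert (H1 : norm (Nat.iter N S (Nat.iter j T (Phi (N + m - j)%nat))) <= bS * (bT * (eta * norm x))).
    { eapply Rle_trans; [apply HSN; auto|]. apply Rmult_le_compat_l; [lra|].
      eapply Rle_trans; [apply HTN; lia|]. apply Rmult_le_compat_l; [lra|auto]. }
    pose proof (Cmod_ge_0 (b j)). specialize (Hrn j).
    apply Rle_trans with (B0 * (bS * (bT * (eta * norm x)))); [|lra].
    apply Rmult_le_compat; auto using norm_nonneg.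
    - apply Rmult_le_pos; lra.
    - apply Rle_trans with (Cmod (b j) * 1); [apply Rmult_le_compat_l; lra|lra]. }
  assert (Htailb : norm tail <= M1 * cst * Rpower (INR N) (s + 1 / 2) * norm x).
  { unfold tail. eapply Rle_trans; [apply norm_vsum|].
    apply Rle_trans with (rsum (fun i => M1 * norm x * (Rpower (INR (Datatypes.S i)) s * Cmod (h (N + i)%nat))) m).
    - apply rsum_le. intros i _. unfold u.
      rewrite (linear_scal _ HSNlin), iter_cancel. eapply Rle_trans; [apply norm_scal_le|].
      rewrite Cmod_mult, Cmod_R, Rabs_pos_eq by apply Hrn.
      pose proof (Cmod_ge_0 (h (N + i)%nat)) as Hh. specialize (Hrn (N + i)%nat).
      replace (M1 * norm x * (Rpower (INR (Datatypes.S i)) s * Cmod (h (N + i)%nat))) with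
        (Cmod (h (N + i)%nat) * 1 * (M1 * Rpower (INR (Datatypes.S i)) s * norm x)) by ring.
      apply Rmult_le_compat; auto using norm_nonneg.
      + apply Rmult_le_pos; lra.
      + apply Rmult_le_compat_l; lra.
    - rewrite rsum_scal.
      replace (M1 * cst * Rpower (INR N) (s + 1 / 2) * norm x) with
        (M1 * norm x * (cst * Rpower (INR N) (s + 1 / 2))) by ring.
      apply Rmult_le_compat_l; [apply Rmult_le_pos; lra|].
      apply weighted_tail_sum; auto; try lia; try lra. apply Hl2. }
  lra.
Qed.

End Core.

Theorem corollary2p4 (xi s : R) (Hxi : 0 < xi < 1 / 2) (Hs : 0 <= s)
  (V : CompleteNormedModule C_AbsRing) (T Tinv : V -> V)
  (HT : is_linear T) (HTinv : is_bounded_inverse T Tinv)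
  (Hspec : forall l : C, spectrum T l -> perfect_symmetric_set xi l)
  (Hpos : is_bigO (fun n => op_norm (op_pow T n))
                  (fun n => Rpower (INR n) s))
  (Hneg : exists beta : R, beta < b_exponent xi /\
     is_bigO (fun n => op_norm (op_pow Tinv n))
             (fun n => exp (Rpower (INR n) beta))) :
  forall eps : R, 0 < eps ->
    is_bigO (fun n => op_norm (op_pow Tinv n))
            (fun n => Rpower (INR n) (s + 1 / 2 + eps)).
Proof.
  intros eps Heps. destruct HTinv as (HS & HST & HTS).
  destruct Hneg as (beta0 & Hbeta0 & Mneg & nneg & Hneg).
  destruct Hpos as (Mpos & npos & Hpos).
  pose proof (b_exponent_bounds xi Hxi) as Hbb.
  (* The given exponent may be 0 or negative. Raising it weakens the growth condition for n >= 1 and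
     makes beta / (1 - beta) positive. *)
  set (beta := Rmax beta0 (b_exponent xi / 2)).
  assert (Hbeta : 0 < beta < b_exponent xi).
  { unfold beta. pose proof (Rmax_r beta0 (b_exponent xi / 2)). split; [lra|]. apply Rmax_lub_lt; lra. }
  (* Being off the spectrum is a double negation, removed classically; the existence is stated for
     every z so that choice yields one resolvent function on all of C. *)
  assert (Hinv : forall z, exists R0 : V -> V, ~ perfect_symmetric_set xi z ->
    is_bounded_inverse (fun x => minus (T x) (scal z x)) R0).
  { intros z. destruct (classic (perfect_symmetric_set xi z)) as [H|H].
    - exists T. now intros.
    - destruct (NNPP _ (fun Hn => H (Hspec z Hn))) as [R0 HR0]. now exists R0. }
  set (R0 := fun z => proj1_sig (constructive_indefinite_description _ (Hinv z))).
  assert (HR0 : forall z, ~ perfect_symmetric_set xi z ->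
    is_bounded_inverse (fun x => minus (T x) (scal z x)) (R0 z)).
  { intros z. exact (proj2_sig (constructive_indefinite_description _ (Hinv z))). }
  (* The weight uses n + 1: at n = 0 [Rpower] would only have a default value, and the tail of h
     pairs T^i with (i + 1)^s. *)
  destruct (growth_all_n T (fun n => Rpower (INR (S n)) s) HT) as (M1 & HM1 & HpT).
  { intros n. rewrite <- (Rpower_O (INR (S n))) by (apply lt_0_INR; lia).
    apply Rle_Rpower; [|auto]. apply (le_INR 1). lia. }
  { exists (Rabs Mpos), (npos + 1)%nat. intros n Hn. eapply Rle_trans; [apply Hpos; lia|].
    rewrite (Rabs_pos_eq (Rpower _ _)) by (apply Rlt_le, exp_pos).
    apply Rle_trans with (Rabs Mpos * Rpower (INR n) s).
    - apply Rmult_le_compat_r; [apply Rlt_le, exp_pos|apply Rle_abs].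
    - apply Rmult_le_compat_l; [apply Rabs_pos|].
      apply Rle_Rpower_l; auto. split; [apply lt_0_INR; lia|]. apply le_INR; lia. }
  destruct (growth_all_n Tinv (fun n => exp (Rpower (INR n) beta)) HS) as (M2 & HM2 & HpS).
  { intros n. pose proof (exp_ineq1_le (Rpower (INR n) beta)). pose proof (exp_pos (beta * ln (INR n))).
    unfold Rpower in *. lra. }
  { exists (Rabs Mneg), (nneg + 1)%nat. intros n Hn. eapply Rle_trans; [apply Hneg; lia|].
    rewrite (Rabs_pos_eq (exp _)) by (apply Rlt_le, exp_pos).
    apply Rle_trans with (Rabs Mneg * exp (Rpower (INR n) beta0)).
    - apply Rmult_le_compat_r; [apply Rlt_le, exp_pos|apply Rle_abs].
    - apply Rmult_le_compat_l; [apply Rabs_pos|]. apply exp_le.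
      apply Rle_Rpower; [apply (le_INR 1); lia|apply Rmax_l]. }
  destruct (negative_power_bound (V := V) T Tinv HT HS HST HTS xi Hxi R0) with (s := s) (beta := beta) (M1 := M1) (M2 := M2)
    as (c & N0 & Hc & Hfin); auto.
  - intros z Hz x. destruct (HR0 z Hz) as (_ & H1 & H2). split; [apply H2|apply H1].
  - intros z Hz. destruct (HR0 z Hz) as (Hlin & H1 & _).
    destruct (linear_bound (V := V) _ Hlin) as (m & Hm & H). exists m. split; [lra|].
    intros y. rewrite <- (H1 y) at 1. apply H.
  - exists c, (N0 + 1)%nat. intros n Hn.
    assert (Hn1 : 1 <= INR n) by (apply (le_INR 1); lia).
    assert (Hle : 0 <= c * Rpower (INR n) (s + 1 / 2)).
    { apply Rmult_le_pos; [lra|apply Rlt_le, exp_pos]. }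
    destruct (op_norm_lub (op_pow Tinv n) (c * Rpower (INR n) (s + 1 / 2)) Hle) as [[H0 H1] _].
    { intros x. apply Hfin. lia. }
    rewrite !Rabs_pos_eq by (auto || apply Rlt_le, exp_pos).
    eapply Rle_trans; [apply H1|]. apply Rmult_le_compat_l; [lra|]. apply Rle_Rpower; lra.
Qed.
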